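(* There is an algorithm that, given a finite digraph $G_0$, a weight function $w\colon A_{G_0}\to\mathbb{R}$ and a rainbow matroid $\mathcal{M}_V$ on $V_{G_0}$ (given by a coloring of the nodes), finds a matroid branching $B$ in $G_0$ with respect to $\mathcal{M}_V$ that has minimum weight $w(B)$ among all matroid branchings of maximum cardinality $|B|$, and runs in $O(m\log n)$ time, where $n:=|V_G|$ and $m:=|A_G|$ are the numbers of nodes and arcs of the augmented digraph $G$ obtained from $G_0$ by adding an auxiliary node $s$ and an arc $(s,v)$ for every $v\in V_{G_0}$.
   Context: A digraph $G_0$ has a finite nonempty node set $V_{G_0}$ and an arc set $A_{G_0}\subseteq V_{G_0}\times V_{G_0}$ (no parallel arcs). A branching is a set $B$ of arcs such that the underlying undirected graph spanned by $B$ is acyclic and each node is entered (covered) by at most one arc of $B$; $C(B)$ denotes the set of nodes entered by an arc of $B$. A rainbow matroid on $V_{G_0}$ is given by a partition of $V_{G_0}$ into color classes; a set of nodes is independent iff it contains at most one node of each color (equivalently, it is a direct sum of matroids whose independent sets are the empty set and the singletons). A matroid branching w.r.t. $\mathcal{M}_V$ is a branching $B$ such that $C(B)$ is independent w.r.t. $\mathcal{M}_V$. The weight of $B$ is $w(B):=\sum_{a\in B}w(a)$. Time is counted in elementary operations, with arithmetic operations and comparisons on real numbers taking unit time. *)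

(* Defs.v *)
From HB Require Import structures.
From mathcomp Require Import all_boot all_order all_algebra.
From mathcomp Require Import reals exp.

Set Implicit Arguments.
Unset Strict Implicit.
Unset Printing Implicit Defensive.

Import Order.TTheory GRing.Theory Num.Theory.

(** * Matroid branchings

    A digraph is a finite node type [V] with an arc set [A : {set V * V}]; the
    arc [(u, v)] leaves [u] and enters [v]. Loops are allowed, as
    [A] is an arbitrary subset of [V * V].  A matroid on [V] is given
    by the family of its independent sets. *)

Section Branching.
Variable V : finType.
Implicit Types (A B : {set V * V}) (M : {set {set V}}).

(* The arc [a], read as an undirected edge, joins the two nodes in [e]. *)
Definition joins (a e : V * V) : bool := (a == e) || (a == (e.2, e.1)).

(* Distinct nodes v_1, ..., v_k and distinct arcs a_1, ..., a_k (k >= 1) such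
   that a_i joins v_i and v_(i+1), indices modulo k. The underlying undirected
   graph is a multigraph: a loop is a cycle (k = 1), and so is a pair of
   opposite arcs (k = 2). *)
Definition undirected_cycle (vs : seq V) (es : seq (V * V)) : bool :=
  [&& vs != [::], uniq vs, uniq es & all2 joins es (zip vs (rot 1 vs))].

Definition undirected_acyclic B : Prop :=
  forall vs es, {subset es <= B} -> ~~ undirected_cycle vs es.

Definition branching A B : Prop :=
  [/\ B \subset A,
      undirected_acyclic B
    & forall v, #|[set a in B | a.2 == v]| <= 1].

Definition covered B : {set V} := [set a.2 | a in B].

Definition matroid_branching A M B : Prop :=
  branching A B /\ covered B \in M.

Definition max_matroid_branching A M B : Prop :=
  matroid_branching A M B /\
  forall B', matroid_branching A M B' -> #|B'| <= #|B|.

Definition arcs_weight (R : realType) (w : V * V -> R) B : R :=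
  (\sum_(a in B) w a)%R.

Definition min_weight_max_matroid_branching
    (R : realType) A M (w : V * V -> R) B : Prop :=
  max_matroid_branching A M B /\
  forall B', max_matroid_branching A M B' ->
    (arcs_weight w B <= arcs_weight w B')%R.

(* The color classes are the nonempty fibers of [c]. *)
Definition rainbow_matroid (c : V -> nat) : {set {set V}} :=
  [set S : {set V} | [forall u, #|[set v in S | c v == c u]| <= 1]].

(* The node set of the augmented digraph is [option V], with [s = None]. *)
Definition augmented_arcs A : {set option V * option V} :=
  [set (Some a.1, Some a.2) | a in A] :|: [set (None, Some v) | v : V].

End Branching.

(** * Unit-cost real RAM

    Programs of a while language over a memory made of arrays of natural
    numbers and arrays of reals. Both kinds of arrays are named by natural
    numbers, and are unbounded; a scalar variable is the cell 0 of an array.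
    A program is a finite piece of syntax: it contains neither real constants
    nor data depending on the input. The elementary operations on integers are
    addition, truncated subtraction and comparison, so that integers cannot be
    used to pack data; reals have the four field operations and comparison, and
    there is no conversion (such as rounding) from reals to integers. *)

Inductive iexp : Type :=
| IConst of nat
| IGet of nat & iexp
| IAdd of iexp & iexp
| ISub of iexp & iexp.

Inductive rexp : Type :=
| RConst of nat
| RGet of nat & iexp
| RAdd of rexp & rexp
| RSub of rexp & rexp
| RMul of rexp & rexp
| RDiv of rexp & rexp.

Inductive bexp : Type :=
| BILe of iexp & iexp
| BRLe of rexp & rexp
| BNot of bexp
| BAnd of bexp & bexp.

Inductive cmd : Type :=
| Skip
| IPut of nat & iexp & iexp (* IPut a i e : a[i] := e *)
| RPut of nat & iexp & rexp
| Seq of cmd & cmd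
| If of bexp & cmd & cmd
| While of bexp & cmd.

Section Semantics.
Variable R : realType.

Record state : Type := State {
  imem : nat -> nat -> nat;
  rmem : nat -> nat -> R
}.

Definition upd (T : Type) (mem : nat -> nat -> T) (a i : nat) (x : T) :
    nat -> nat -> T :=
  fun b j => if (b == a) && (j == i) then x else mem b j.

Fixpoint ieval (s : state) (e : iexp) : nat :=
  match e with
  | IConst k => k
  | IGet a e1 => imem s a (ieval s e1)
  | IAdd e1 e2 => ieval s e1 + ieval s e2
  | ISub e1 e2 => ieval s e1 - ieval s e2
  end.

(* Division by zero yields 0, as in every MathComp field. *)
Fixpoint reval (s : state) (e : rexp) : R :=
  match e with
  | RConst k => k%:R
  | RGet a e1 => rmem s a (ieval s e1)
  | RAdd e1 e2 => reval s e1 + reval s e2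
  | RSub e1 e2 => reval s e1 - reval s e2
  | RMul e1 e2 => reval s e1 * reval s e2
  | RDiv e1 e2 => reval s e1 / reval s e2
  end%R.

Fixpoint beval (s : state) (b : bexp) : bool :=
  match b with
  | BILe e1 e2 => ieval s e1 <= ieval s e2
  | BRLe e1 e2 => (reval s e1 <= reval s e2)%R
  | BNot b1 => ~~ beval s b1
  | BAnd b1 b2 => beval s b1 && beval s b2
  end.

(* Every constant, memory access and operation takes one unit of time, and
   both operands of a conjunction are always evaluated. *)
Fixpoint icost (e : iexp) : nat :=
  match e with
  | IConst _ => 1
  | IGet _ e1 => (icost e1).+1
  | IAdd e1 e2 | ISub e1 e2 => (icost e1 + icost e2).+1
  end.

Fixpoint rcost (e : rexp) : nat :=
  match e with
  | RConst _ => 1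
  | RGet _ e1 => (icost e1).+1
  | RAdd e1 e2 | RSub e1 e2 | RMul e1 e2 | RDiv e1 e2 =>
      (rcost e1 + rcost e2).+1
  end.

Fixpoint bcost (b : bexp) : nat :=
  match b with
  | BILe e1 e2 => (icost e1 + icost e2).+1
  | BRLe e1 e2 => (rcost e1 + rcost e2).+1
  | BNot b1 => (bcost b1).+1
  | BAnd b1 b2 => (bcost b1 + bcost b2).+1
  end.

(* [exec p s s' t]: started in [s], the program [p] halts in [s'] after time
   [t]. The language is deterministic. *)
Inductive exec : cmd -> state -> state -> nat -> Prop :=
| ExecSkip s : exec Skip s s 1
| ExecIPut s a i e :
    exec (IPut a i e) s
      (State (upd (imem s) a (ieval s i) (ieval s e)) (rmem s))
      (icost i + icost e).+1
| ExecRPut s a i e :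
    exec (RPut a i e) s
      (State (imem s) (upd (rmem s) a (ieval s i) (reval s e)))
      (icost i + rcost e).+1
| ExecSeq s s1 s2 p1 p2 t1 t2 :
    exec p1 s s1 t1 -> exec p2 s1 s2 t2 -> exec (Seq p1 p2) s s2 (t1 + t2)
| ExecIf s s1 b p1 p2 t :
    exec (if beval s b then p1 else p2) s s1 t ->
    exec (If b p1 p2) s s1 (bcost b + t).+1
| ExecWhileFalse s b p :
    ~~ beval s b -> exec (While b p) s s (bcost b).+1
| ExecWhileTrue s s1 s2 b p t1 t2 :
    beval s b -> exec p s s1 t1 -> exec (While b p) s1 s2 t2 ->
    exec (While b p) s s2 (bcost b + t1 + t2).+1.

(** * Input and output

    The nodes and the arcs are listed in some order, [nodes] and [arcs], and
    are represented by their positions in these lists. All cells that do not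
    hold the input are 0. *)

Section Encoding.
Variable V : finType.
Implicit Types (nodes : seq V) (arcs : seq (V * V)).

Definition input_state nodes arcs (w : V * V -> R) (c : V -> nat) : state :=
  {| imem := fun a =>
       match a with
       | 0 => nth 0 [:: size nodes; size arcs]
       | 1 => nth 0 [seq index a.1 nodes | a <- arcs]
       | 2 => nth 0 [seq index a.2 nodes | a <- arcs]
       | 3 => nth 0 [seq c v | v <- nodes]
       | _ => fun=> 0
       end;
     rmem := fun a =>
       match a with
       | 0 => nth 0%R [seq w a | a <- arcs]
       | _ => fun=> 0%R
       end |}.

(* The result consists of the arcs marked by a nonzero entry of the integer
   array 4. *)
Definition output_arcs arcs (s : state) : {set V * V} :=
  [set a in arcs | imem s 4 (index a arcs) != 0].

End Encoding.
End Semantics.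

(* Main.v *)
(** The auxiliary node [s] gets a very heavy arc to every node; then the task is
    to select, for each color class, exactly one arc entering it, such that the
    selected arcs form no cycle and have minimum weight (weights are shifted so
    as to be nonnegative). This is solved in the manner of Edmonds. An unserved
    class selects a cheapest entering arc, whose weight is subtracted from all
    the arcs entering the class. If the selected arcs contain a cycle, its nodes
    are contracted to a supernode and the classes that they cover are merged; as
    the merged class must again be entered from outside, it is served anew.
    The subtracted amounts form a dual solution: a class containing [k] colors
    has supernodes of total rank [k - 1], so that every acyclic selection enters
    it from outside at least once. Undoing the merges in reverse order turns the
    final choice into a selection attaining the dual bound: the arc selected for
    a merged class serves one of its two parts, and the other part takes the arc
    recorded at the merge.

    Supernodes, classes and the components of the selected arcs are kept in
    union-find forests by rank. The arcs entering a class are in a weight-biased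
    leftist heap whose keys are relative to those of the parents: extracting the
    minimum and subtracting it from all the keys of the heap amounts to melding
    the two subheaps of the root. Each arc is extracted at most once, and there
    are fewer merges than nodes, whence O(m) steps of O(log n) time each. *)
Require Import Defs.
From HB Require Import structures.
From mathcomp Require Import all_boot all_order all_algebra.
From mathcomp Require Import reals exp.
From mathcomp Require Import zify ring lra.
From mathcomp Require Import boolp.

Set Implicit Arguments.
Unset Strict Implicit.
Unset Printing Implicit Defensive.

Import Order.TTheory GRing.Theory Num.Theory.

(** * Total correctness with running time *)

(** A cycle is contracted arc by arc. Each step merges the two ends of the candidate and their
    classes, and the arc that entered the tail, again of reduced weight 0, becomes the next
    candidate; the cycle is finished when the candidate is a loop. The obstacle is that a selection
    of a half-contracted cycle need not lift: the released arc may close a cycle with other selected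
    arcs. Hence lifting is promised only for selections that contain the candidate or follow the
    chosen arcs back from its tail; once the candidate is a loop, the promise is unconditional. For
    selections, acyclicity means that every backward walk stops; undirected cycles appear only in
    the comparison with branchings. Correctness and time are proved together, by budgets paid down
    along the loops. All logarithms are one parameter [L] with n + 1 <= 2 ^ L; heaps get 2L, because
    without parallel arcs there are at most n ^ 2 arcs. The auxiliary arcs also guarantee that the
    heap of an unserved class is never empty. *)

Section Wp.
Variable R : realType.
Implicit Types (s : state R) (Q : state R -> nat -> Prop).

(** Since execution is deterministic, the existence of one halting run with a good result is total
    correctness. *)
Definition wp (p : cmd) s Q := exists s' t, exec p s s' t /\ Q s' t.

Lemma wp_mono p s Q Q' :
  wp p s Q -> (forall s' t, Q s' t -> Q' s' t) -> wp p s Q'.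
Proof. by move=> [s' [t [H1 H2]]] H; exists s', t; split => //; exact: H. Qed.

Lemma wp_skip s Q : Q s 1 -> wp Skip s Q.
Proof. by move=> H; exists s, 1; split => //; constructor. Qed.

Lemma wp_iput s a i e Q :
  Q (State (upd (imem s) a (ieval s i) (ieval s e)) (rmem s))
    (icost i + icost e).+1 -> wp (IPut a i e) s Q.
Proof. by move=> H; do 2 eexists; split; [constructor|]. Qed.

Lemma wp_rput s a i e Q :
  Q (State (imem s) (upd (rmem s) a (ieval s i) (reval s e)))
    (icost i + rcost e).+1 -> wp (RPut a i e) s Q.
Proof. by move=> H; do 2 eexists; split; [constructor|]. Qed.

Lemma wp_seq p1 p2 s Q :
  wp p1 s (fun s1 t1 => wp p2 s1 (fun s2 t2 => Q s2 (t1 + t2))) ->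
  wp (Seq p1 p2) s Q.
Proof.
move=> [s1 [t1 [H1 [s2 [t2 [H2 HQ]]]]]].
by exists s2, (t1 + t2); split => //; econstructor; eauto.
Qed.

Lemma wp_if b p1 p2 s Q :
  (beval s b -> wp p1 s (fun s1 t => Q s1 (bcost b + t).+1)) ->
  (~~ beval s b -> wp p2 s (fun s1 t => Q s1 (bcost b + t).+1)) ->
  wp (If b p1 p2) s Q.
Proof.
move=> H1 H2; case: (boolP (beval s b)) => hb.
  case: (H1 hb) => s1 [t [He HQ]].
  by exists s1, (bcost b + t).+1; split => //; constructor; rewrite hb.
case: (H2 hb) => s1 [t [He HQ]].
by exists s1, (bcost b + t).+1; split => //; constructor; rewrite (negbTE hb).
Qed.

Lemma wp_while b p s Q :
  (beval s b -> wp p s (fun s1 t1 => wp (While b p) s1 (fun s2 t2 =>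
     Q s2 (bcost b + t1 + t2).+1))) ->
  (~~ beval s b -> Q s (bcost b).+1) ->
  wp (While b p) s Q.
Proof.
move=> H1 H2; case: (boolP (beval s b)) => hb.
  case: (H1 hb) => s1 [t1 [He [s2 [t2 [He2 HQ]]]]].
  exists s2, (bcost b + t1 + t2).+1; split => //.
  exact: ExecWhileTrue hb He He2.
exists s, (bcost b).+1; split; last exact: H2.
by constructor.
Qed.

(* The natural number in the invariant is a budget that pays for the running
   time; since every iteration costs at least 1, it also forces termination. *)
Lemma wp_while_budget (I : state R -> nat -> Prop) b p s k Q :
  (forall s k, I s k -> beval s b -> wp p s (fun s1 t1 =>
     exists2 k1, I s1 k1 & k1 + (bcost b + t1).+1 <= k)) ->
  I s k ->
  (forall s' k' t, I s' k' -> ~~ beval s' b -> t + k' <= k + (bcost b).+1 ->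
     Q s' t) ->
  wp (While b p) s Q.
Proof.
move=> step; move: {2}k (leqnn k) => N.
elim: N s k Q => [|N IH] s k Q hk Is HQ; apply: wp_while => hb.
- case: (step _ _ Is hb) => s1 [t1 [_ [k1 _ hk1]]]; lia.
- by apply: (HQ _ _ _ Is hb); lia.
- case: (step _ _ Is hb) => s1 [t1 [He [k1 Ik1 hk1]]].
  exists s1, t1; split => //; apply: (IH _ k1) => //; first lia.
  move=> s' k' t Ik' hb' ht; apply: (HQ _ _ _ Ik' hb'); lia.
- by apply: (HQ _ _ _ Is hb); lia.
Qed.

End Wp.

Lemma upd_same (T : Type) (m : nat -> nat -> T) a i x y :
  upd (upd m a i x) a i y = upd m a i y.
Proof.
apply: funext => b; apply: funext => j; rewrite /upd.
by case: ((b == a) && (j == i)).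
Qed.

Lemma upd_hit (T : Type) (m : nat -> nat -> T) a i x : upd m a i x a i = x.
Proof. by rewrite /upd !eqxx. Qed.

Lemma upd_off (T : Type) (m : nat -> nat -> T) a b i x :
  b != a -> upd m a i x b = m b.
Proof. by move=> h; apply: funext => j; rewrite /upd (negbTE h). Qed.

Lemma upd_row (T : Type) (m : nat -> nat -> T) a i x :
  upd m a i x a = fun j => if j == i then x else m a j.
Proof. by apply: funext => j; rewrite /upd eqxx. Qed.

(** * Union-find *)

Notation var a := (IGet a (IConst 0)).
Notation "a <-- e" := (IPut a (IConst 0) e) (at level 70).
Notation BIEq e1 e2 := (BAnd (BILe e1 e2) (BILe e2 e1)).

Section UnionFind.
Variable R : realType.
Implicit Types (s : state R) (Q : state R -> nat -> Prop).

Record ranked (N : nat) (par rk S : nat -> nat) : Prop := Ranked {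
  rk_par : forall i, i < N -> par i < N;
  rk_rep : forall i, i < N -> S (par i) = S i;
  rk_root : forall i, i < N -> (par i == i) = (S i == i);
  rk_lt : forall i, i < N -> par i != i -> rk i < rk (par i);
  rk_bnd : forall i, i < N -> S i < N;
  rk_idem : forall i, i < N -> S (S i) = S i
}.

(** The ranks are only asserted to exist: undoing merges restores the parent array but not the rank
    array, and a search needs no more than bounded ranks. *)
Definition shallow N L par S :=
  exists2 rk, ranked N par rk S & forall i, i < N -> rk i <= L.

Definition find_root par d e : cmd :=
  Seq (d <-- e)
      (While (BNot (BIEq (IGet par (var d)) (var d)))
             (d <-- IGet par (var d))).

(** Ranks increase strictly towards the root and are at most [L], so [L - rk x] bounds the number of
    steps left. *)
Lemma find_loop N L S par d s rk :
  ranked N (imem s par) rk S -> (forall i, i < N -> rk i <= L) -> par != d ->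
  forall k x Q, x < N -> L - rk x <= k ->
  (forall t, t <= 20 * k + 20 ->
    Q (State (upd (imem s) d 0 (S x)) (rmem s)) t) ->
  wp (While (BNot (BIEq (IGet par (var d)) (var d)))
             (d <-- IGet par (var d)))
     (State (upd (imem s) d 0 x) (rmem s)) Q.
Proof.
move=> uf hL hpd; elim=> [|k IH] x Q hx hk HQ.
- apply: wp_while; rewrite /= !upd_hit !(upd_off _ _ _ hpd) => hb.
    have hne : imem s par x != x by apply: contra hb => /eqP ->; rewrite leqnn.
    exfalso; have := rk_lt uf hx hne; have := hL _ (rk_par uf hx); lia.
  suff <- : S x = x by apply: HQ; lia.
  apply/eqP; rewrite -(rk_root uf hx) eqn_leq; move: hb; by rewrite negbK.
- apply: wp_while; rewrite /= !upd_hit !(upd_off _ _ _ hpd) => hb.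
    have hne : imem s par x != x by apply: contra hb => /eqP ->; rewrite leqnn.
    apply: wp_iput; rewrite /= upd_same upd_hit (upd_off _ _ _ hpd).
    apply: IH; first exact: rk_par uf _ hx.
      have := rk_lt uf hx hne; lia.
    by move=> t ht; rewrite (rk_rep uf hx); apply: HQ; lia.
  suff <- : S x = x by apply: HQ; lia.
  apply/eqP; rewrite -(rk_root uf hx) eqn_leq; move: hb; by rewrite negbK.
Qed.

Lemma wp_find_root N L S par d e s Q :
  shallow N L (imem s par) S -> par != d -> ieval s e < N ->
  (forall t, t <= 20 * L + icost e + 22 ->
    Q (State (upd (imem s) d 0 (S (ieval s e))) (rmem s)) t) ->
  wp (find_root par d e) s Q.
Proof.
move=> [rk uf hL] hpd hx HQ; apply: wp_seq; apply: wp_iput => /=.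
apply: (find_loop uf hL hpd (k := L)) => //; first lia.
move=> t ht; apply: HQ; lia.
Qed.

Definition ncount N (p : nat -> bool) := count p (iota 0 N).

(** The factor 2 is needed for the class forest, which starts with stars: the first node of a color
    has rank 1 even if it is alone. It costs one more level, hence the bound [L.+1] on ranks. *)
Definition sized N par rk S :=
  ranked N par rk S /\
  forall i, i < N -> S i = i -> 2 ^ rk i <= 2 * ncount N (fun j => S j == i).

Lemma ncount_le N p : ncount N p <= N.
Proof. by rewrite /ncount -{2}(size_iota 0 N) count_size. Qed.

Lemma rank_le_rep N par rk S : ranked N par rk S ->
  forall i, i < N -> rk i <= rk (S i).
Proof.
move=> uf.
have [M hM] : exists M, forall i, i < N -> rk i <= M.
  exists (\max_(i < N) rk i) => i hi.
  exact: (leq_bigmax_cond (Ordinal hi)).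
move=> i; move: {2}(M - rk i) (leqnn (M - rk i)) => k.
elim: k i => [|k IH] i hk hi; (case: (boolP (par i == i)) => hp;
  [by move: hp; rewrite (rk_root uf hi) => /eqP ->|]);
  have := rk_lt uf hi hp; have := hM _ (rk_par uf hi); first lia.
move=> h1 h2; rewrite -(rk_rep uf hi); apply: leq_trans (IH _ _ _) => //.
- exact: ltnW.
- lia.
- exact: rk_par uf _ hi.
Qed.

Lemma sized_shallow N L par rk S : sized N par rk S -> N <= 2 ^ L ->
  shallow N L.+1 par S.
Proof.
move=> [uf hs] hN; exists rk => // i hi.
apply: leq_trans (rank_le_rep uf hi) _.
rewrite -(@leq_exp2l 2) //.
apply: leq_trans (hs _ (rk_bnd uf hi) (rk_idem uf hi)) _.
by rewrite expnS leq_mul2l /=; apply: leq_trans (ncount_le _ _) hN.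
Qed.

(* [u] and [v] must be roots. On return [ch] holds the one that became a child
   of the other, which is in [rt]. There is no path compression, so that a
   union is undone by making [ch] a root again. *)
Definition union par rk ch rt u v : cmd :=
  Seq (If (BILe (IGet rk u) (IGet rk v))
          (Seq (ch <-- u) (rt <-- v))
          (Seq (ch <-- v) (rt <-- u)))
  (Seq (IPut par (var ch) (var rt))
       (If (BILe (IGet rk (var rt)) (IGet rk (var ch)))
           (IPut rk (var rt) (IAdd (IGet rk (var rt)) (IConst 1)))
           Skip)).

Definition join (S : nat -> nat) c r : nat -> nat :=
  fun i => if S i == c then r else S i.

Lemma join_sized N par rk S c r :
  sized N par rk S -> c < N -> r < N -> S c = c -> S r = r -> c != r ->
  rk c <= rk r ->
  sized N (fun j => if j == c then r else par j)
          (fun j => if (j == r) && (rk r <= rk c) then (rk r).+1 else rk j)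
          (join S c r).
Proof.
move=> [uf hs] hc hr Sc Sr hcr hrk.
have parr : par r = r by apply/eqP; rewrite (rk_root uf hr) Sr.
have parc : par c = c by apply/eqP; rewrite (rk_root uf hc) Sc.
rewrite /join; split; first split.
- by move=> i hi; case: eqP => // _; exact: (rk_par uf hi).
- move=> i hi; case: (eqVneq i c) => [->|hic].
    by rewrite Sr Sc eqxx eq_sym (negbTE hcr).
  by rewrite (rk_rep uf hi).
- move=> i hi; case: (eqVneq i c) => [->|hic]; first by rewrite Sc eqxx.
  case: (eqVneq (S i) c) => [hS|hS]; last exact: (rk_root uf hi).
  rewrite (rk_root uf hi) hS eq_sym (negbTE hic).
  apply/esym/negbTE/eqP => hri; move: hcr.
  by rewrite hri -hS -hri Sr eqxx.
- move=> i hi; case: (eqVneq i c) => [->|hic] hne.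
    by rewrite eqxx (negbTE hcr) /=; case: (leqP (rk r) (rk c)).
  have hlt := rk_lt uf hi hne.
  case: (eqVneq i r) hne => [->|hir] hne; first by rewrite parr eqxx in hne.
  rewrite /=; case: (eqVneq (par i) r) => [hp|//] /=.
  by rewrite hp in hlt *; case: ifP => // _; exact: leqW.
- by move=> i hi; case: eqP => // _; exact: (rk_bnd uf hi).
- move=> i hi; case: (eqVneq (S i) c) => [_|hS].
    by rewrite Sr eq_sym (negbTE hcr).
  by rewrite (rk_idem uf hi) (negbTE hS).
- move=> i hi hS.
  have hSi : S i = i.
    case: (eqVneq (S i) c) hS => [_ h|//]; by rewrite -h.
  have hic : i != c.
    apply/negP => /eqP hic; move: hS; rewrite hSi hic eqxx => hrc.
    by rewrite hrc eqxx in hcr.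
  have mono : ncount N (fun j => S j == i) <=
              ncount N (fun j => (if S j == c then r else S j) == i).
    apply: sub_count => j /= /eqP hj; by rewrite hj (negbTE hic).
  case: (eqVneq i r) => [hir|hir] /=; last first.
    by apply: leq_trans (hs _ hi hSi) _; rewrite leq_mul2l mono.
  case: (leqP (rk r) (rk c)) => hrk2; last first.
    by apply: leq_trans (hs _ hi hSi) _; rewrite leq_mul2l mono.
  (* Only a union of equal ranks raises a rank; then the doubled power is the sum of the two old
     ones, and the sizes add up as well. *)
  have e : rk c = rk r by apply/eqP; rewrite eqn_leq hrk hrk2.
  have h : ncount N (fun j => (if S j == c then r else S j) == i) =
     ncount N (fun j => S j == c) + ncount N (fun j => S j == r).
    rewrite /ncount hir; elim: (iota 0 N) => //= j l ->.
    case: (eqVneq (S j) c) => [->|_]; rewrite ?eqxx /=; last lia.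
    rewrite (negbTE hcr); lia.
  rewrite h expnS; have := hs _ hr Sr; have := hs _ hc Sc; rewrite e; lia.
Qed.

(** The third premise says that [u] and [v] do not read the cells [ch] and [rt], which are written
    between their evaluations. The continuation must accept either orientation of the union, so
    everything built on it is symmetric in the two roots. *)
Lemma wp_union N S par rk ch rt u v s Q :
  sized N (imem s par) (imem s rk) S ->
  uniq [:: par; rk; ch; rt] ->
  (forall f, (forall a i, a != ch -> a != rt -> f a i = imem s a i) ->
     ieval (State f (rmem s)) u = ieval s u /\
     ieval (State f (rmem s)) v = ieval s v) ->
  ieval s u < N -> ieval s v < N ->
  S (ieval s u) = ieval s u -> S (ieval s v) = ieval s v ->
  ieval s u != ieval s v ->
  (forall c r f t, 
     (c = ieval s u /\ r = ieval s v) \/ (c = ieval s v /\ r = ieval s u) ->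
     sized N (f par) (f rk) (join S c r) ->
     f par = (fun j => if j == c then r else imem s par j) ->
     f ch 0 = c -> f rt 0 = r ->
     (forall a, a \notin [:: par; rk; ch; rt] -> f a = imem s a) ->
     t <= 5 * (icost u + icost v) + 40 ->
     Q (State f (rmem s)) t) ->
  wp (union par rk ch rt u v) s Q.
Proof.
move=> uf huniq hev hu hv Su Sv huv HQ.
have [h1 [h2 [h3 [h4 [h5 h6]]]]] : par != rk /\ par != ch /\ par != rt /\ 
   rk != ch /\ rk != rt /\ ch != rt.
  move: huniq; rewrite /= !inE !negb_or.
  by case/and4P => /and3P[-> -> ->] /andP[-> ->] -> _.
have common c r k : 
   (c = ieval s u /\ r = ieval s v) \/ (c = ieval s v /\ r = ieval s u) ->
   imem s rk c <= imem s rk r ->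
   k <= 3 * (icost u + icost v) + 10 ->
   wp (Seq (IPut par (var ch) (var rt))
       (If (BILe (IGet rk (var rt)) (IGet rk (var ch)))
           (IPut rk (var rt) (IAdd (IGet rk (var rt)) (IConst 1)))
           Skip))
      (State (upd (upd (imem s) ch 0 c) rt 0 r) (rmem s))
      (fun s2 t2 => Q s2 (k + t2)).
  move=> hcr hrk hk.
  have uf' : sized N (fun j => if j == c then r else imem s par j)
    (fun j => if (j == r) && (imem s rk r <= imem s rk c) then (imem s rk r).+1
              else imem s rk j) (join S c r).
    by case: hcr => -[-> ->] in hrk *; apply: join_sized => //; rewrite eq_sym.
  apply: wp_seq; apply: wp_iput.
  set f1 := upd _ _ _ _.
  have E1 : f1 par = fun j => if j == c then r else imem s par j.
    apply: funext => j.
    by rewrite /f1 /= /upd !eqxx /= (negbTE h2) (negbTE h3) /= (negbTE h6).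
  have E2 : f1 rk = imem s rk.
    apply: funext => j.
    by rewrite /f1 /= /upd eq_sym (negbTE h1) (negbTE h4) (negbTE h5).
  have E3 : f1 ch 0 = c.
    rewrite /f1 /= /upd eq_sym (negbTE h2) /= (negbTE h6) !eqxx //.
  have E4 : f1 rt 0 = r.
    by rewrite /f1 /= /upd eq_sym (negbTE h3) /= !eqxx.
  have E5 a : a \notin [:: par; rk; ch; rt] -> f1 a = imem s a.
    rewrite !inE !negb_or => /and4P[ha hb hc hd].
    apply: funext => j.
    by rewrite /f1 /= /upd (negbTE ha) (negbTE hc) (negbTE hd).
  apply: wp_if => /=; rewrite E3 E4 E2 => hb.
  - apply: wp_iput; rewrite /= E4 E2.
    set f2 := upd f1 _ _ _.
    have E6 : f2 rk = fun j => if (j == r) && (imem s rk r <= imem s rk c) then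
       (imem s rk r).+1 else imem s rk j.
      by apply: funext => j; rewrite /f2 /upd eqxx /= hb andbT E2 addn1.
    have E7 a : a != rk -> f2 a = f1 a.
      by move=> ha; apply: funext => j; rewrite /f2 /upd (negbTE ha).
    apply: (HQ c r f2) => //.
    + by rewrite E6 E7 // E1.
    + by rewrite E7 // E1.
    + by rewrite E7 // eq_sym.
    + by rewrite E7 // eq_sym.
    + move=> a ha; rewrite E7 ?E5 //; move: ha.
      by rewrite !inE !negb_or => /and4P[].
    + lia.
  - apply: wp_skip; apply: (HQ c r f1) => //; last lia.
    rewrite E1 E2; rewrite (_ : (fun j => if (j == r) && _ then _ else _) = imem s rk) // in uf'.
    by apply: funext => j; rewrite (negbTE hb) andbF.
apply: wp_seq; apply: wp_if => /= hb; apply: wp_seq; apply: wp_iput => /=;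
  apply: wp_iput => /=.
- have -> : ieval (State (upd (imem s) ch 0 (ieval s u)) (rmem s)) v = ieval s v.
    case: (hev (upd (imem s) ch 0 (ieval s u))) => // a i ha _.
    by rewrite upd_off.
  apply: common => //; [by left|lia].
- have -> : ieval (State (upd (imem s) ch 0 (ieval s v)) (rmem s)) u = ieval s u.
    case: (hev (upd (imem s) ch 0 (ieval s v))) => // a i ha _.
    by rewrite upd_off.
  apply: common => //; [by right|lia|lia].
Qed.

End UnionFind.

(** * Mergeable heaps *)

Inductive tree : Type := Leaf | Node of nat & tree & tree.

Fixpoint keys t : seq nat :=
  if t is Node x l r then x :: keys l ++ keys r else [::].

Fixpoint balanced t : bool :=
  if t is Node x l r then
    [&& size (keys r) <= size (keys l), balanced l & balanced r]
  else true.

Fixpoint spine t : nat := if t is Node x l r then (spine r).+1 else 0.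

Lemma spine_log t : balanced t -> 2 ^ spine t <= (size (keys t)).+1.
Proof.
elim: t => [|x l _ r IH] //= /and3P[h1 h2 h3].
have := IH h3; rewrite expnS size_cat; lia.
Qed.

Lemma spine_le t L : balanced t -> (size (keys t)).+1 <= 2 ^ L -> spine t <= L.
Proof.
move=> h1 h2; rewrite -(@leq_exp2l 2) //.
exact: leq_trans (spine_log h1) h2.
Qed.

Notation aNext := 20.
Notation aSize := 21.
Notation vA := 22.
Notation vB := 23.
Notation vHole := 24.
Notation vRight := 25.
Notation vTmp := 26.
Notation aKey := 1.

Notation left_slot e := (IAdd e e).
Notation right_slot e := (IAdd (IAdd e e) (IConst 1)).

(** The key of [vA] is not larger, so its place is final, and the key of [vB] becomes relative to it
    because [vB] will lie below it. Comparing the future size of the melded subtree with that of the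
    left one tells which slot of [vA] must be the next hole. *)
Definition descend : cmd :=
  Seq (RPut aKey (var vB) (RSub (RGet aKey (var vB)) (RGet aKey (var vA))))
  (Seq (IPut aNext (var vHole) (var vA))
  (Seq (IPut aSize (var vA)
              (IAdd (IGet aSize (var vA)) (IGet aSize (var vB))))
  (Seq (vRight <-- IGet aNext (right_slot (var vA)))
  (Seq (If (BILe (IAdd (IGet aSize (var vRight)) (IGet aSize (var vB)))
                 (IGet aSize (IGet aNext (left_slot (var vA)))))
           (vHole <-- right_slot (var vA))
           (Seq (IPut aNext (right_slot (var vA))
                      (IGet aNext (left_slot (var vA))))
                (vHole <-- left_slot (var vA))))
       (vA <-- var vRight))))).

Definition meld_step : cmd :=
  Seq (If (BRLe (RGet aKey (var vA)) (RGet aKey (var vB))) Skip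
          (Seq (vTmp <-- var vA) (Seq (vA <-- var vB) (vB <-- var vTmp))))
      descend.

Definition meld_loop : cmd :=
  Seq (While (BAnd (BNot (BILe (var vA) (IConst 0)))
                   (BNot (BILe (var vB) (IConst 0))))
             meld_step)
      (IPut aNext (var vHole) (IAdd (var vA) (var vB))).

(* Top-down melding of weight-biased leftist heaps: the slot [vHole] waits for
   the root of the heap resulting from [vA] and [vB]. The sizes are known in
   advance, so that no second, bottom-up pass is needed. *)
Definition meld : cmd := Seq (vHole <-- IConst 0) meld_loop.

(** * Correctness and cost of top-down melding *)

Section Heap.
Variable R : realType.
Implicit Types (s : state R) (Q : state R -> nat -> Prop) (red : nat -> R).

Fixpoint ordered red t : bool :=
  if t is Node x l r then
    [&& all (fun y => (red x <= red y)%R) (keys l ++ keys r),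
        ordered red l & ordered red r]
  else true.

(* [Next (x + x)] and [Next (x + x + 1)] hold the children of [x], and [Key x]
   holds the key of [x] relative to that of its parent. *)
Fixpoint repr (Next Size : nat -> nat) (Key : nat -> R) red (base : R) p t :
    Prop :=
  if t is Node x l r then
    [/\ p = x, 0 < x, Size x = size (keys t), Key x = (red x - base)%R
      & repr Next Size Key red (red x) (Next (x + x)) l /\
        repr Next Size Key red (red x) (Next (x + x + 1)) r]
  else p = 0.

(** Stored keys are differences, so subtracting the same [y] from all keys and from the base changes
    no cell. This makes lowering a whole heap free; with [y] equal to 0 it is the frame rule for
    heaps. *)
Lemma repr_ext N1 S1 K1 red1 b1 N2 S2 K2 red2 b2 (y : R) p t :
  (forall x, x \in keys t -> [/\ N2 (x + x) = N1 (x + x),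
     N2 (x + x + 1) = N1 (x + x + 1), S2 x = S1 x, K2 x = K1 x
     & red2 x = (red1 x - y)%R]) ->
  b2 = (b1 - y)%R ->
  repr N1 S1 K1 red1 b1 p t -> repr N2 S2 K2 red2 b2 p t.
Proof.
elim: t p b1 b2 => [|x l IHl r IHr] p b1 b2 //= h hb [-> hx hS hK [hl hr]].
have [e1 e2 e3 e4 e5] := h x (mem_head _ _).
split => //; [by rewrite e3|by rewrite e4 hK e5 hb; ring|].
rewrite e1 e2; split; [apply: IHl hl|apply: IHr hr] => // z hz;
  by apply: h; rewrite inE mem_cat hz ?orbT.
Qed.

Lemma repr_gt0 N S K red b p t : repr N S K red b p t ->
  forall x, x \in keys t -> 0 < x.
Proof.
elim: t p b => [|x l IHl r IHr] p b //= [_ hx _ _ [hl hr]] y.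
rewrite inE mem_cat => /or3P[/eqP ->|h|h] //; [exact: IHl hl _ h|exact: IHr hr _ h].
Qed.

Lemma repr_size N S K red b p t : S 0 = 0 -> repr N S K red b p t ->
  S p = size (keys t).
Proof. by case: t => [|x l r] h0 /=; [move=> ->|case=> -> _ ->]. Qed.

Lemma orderedP red t x : ordered red t -> x \in keys t ->
  (red (head 0 (keys t)) <= red x)%R.
Proof.
case: t => //= z l r /and3P[/allP h _ _].
by rewrite inE => /orP[/eqP ->|/h].
Qed.

Lemma ordered_ext red1 red2 (y : R) t :
  (forall x, x \in keys t -> red2 x = (red1 x - y)%R) ->
  ordered red2 t = ordered red1 t.
Proof.
elim: t => //= x l IHl r IHr h.
rewrite IHl ?IHr; last 2 first.
- by move=> z hz; apply: h; rewrite inE mem_cat hz !orbT.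
- by move=> z hz; apply: h; rewrite inE mem_cat hz !orbT.
congr andb; apply: eq_in_all => z hz.
by rewrite !h ?mem_head ?inE ?hz ?orbT // lerD2r.
Qed.

Definition slots (ks : seq nat) := flatten [seq [:: x + x; x + x + 1] | x <- ks].

Lemma mem_slots ks j :
  (j \in slots ks) = has (fun x => (j == x + x) || (j == x + x + 1)) ks.
Proof.
elim: ks => //= x ks IH; rewrite /slots /= !inE -/(slots _) IH; by rewrite orbA.
Qed.

(** Peels off one iteration but keeps the command after the loop, so that an induction can speak of
    [meld_loop] as a whole, including its final store into the hole. *)
Lemma wp_while_seq b p q s Q :
  (beval s b -> wp p s (fun s1 t1 => wp (Seq (While b p) q) s1 (fun s2 t2 =>
     Q s2 (bcost b + t1 + t2).+1))) ->
  (~~ beval s b -> wp q s (fun s2 t2 => Q s2 ((bcost b).+1 + t2))) ->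
  wp (Seq (While b p) q) s Q.
Proof.
move=> H1 H2; apply: wp_seq; apply: wp_while => hb; last exact: H2.
apply: wp_mono (H1 hb) _ => s1 t1 [s3 [t3 [He HQ]]].
inversion He; subst.
exists s2, t0; split => //; exists s3, t2; split => //.
by move: HQ; congr Q; lia.
Qed.

Definition scratch := [:: aNext; aSize; vA; vB; vHole; vRight; vTmp].

(** The clauses on unchanged cells are what allows all heaps to live in the same arrays: a meld
    touches only the hole and the cells of its own arcs. *)
Definition merged red base s ta tb hole s' : Prop :=
  [/\ exists tr, [/\ perm_eq (keys tr) (keys ta ++ keys tb), ordered red tr,
        balanced tr &
        repr (imem s' aNext) (imem s' aSize) (rmem s' aKey) red base
             (imem s' aNext hole) tr],
      forall j, j != hole -> j \notin slots (keys ta ++ keys tb) ->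
        imem s' aNext j = imem s aNext j,
      forall j, j \notin keys ta ++ keys tb ->
        imem s' aSize j = imem s aSize j /\ rmem s' aKey j = rmem s aKey j,
      forall a, a \notin scratch -> imem s' a = imem s a
    & forall a, a != aKey -> rmem s' a = rmem s a].

(** The pointer 0 is the empty heap, and its size cell must be 0 because [descend] reads sizes of
    possibly empty subtrees. The hole must not be a slot of the heaps, or filling it would cut off a
    subtree. *)
Definition mergeable red base s ta tb hole : Prop :=
  [/\ uniq (keys ta ++ keys tb), ordered red ta && ordered red tb,
      balanced ta && balanced tb, imem s aSize 0 = 0
    & [/\ repr (imem s aNext) (imem s aSize) (rmem s aKey) red base
            (imem s vA 0) ta,
          repr (imem s aNext) (imem s aSize) (rmem s aKey) red base
            (imem s vB 0) tb,
          imem s vHole 0 = hole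
        & hole \notin slots (keys ta ++ keys tb)]].

Lemma slot_self x : (x + x \in slots [:: x]) && (x + x + 1 \in slots [:: x]).
Proof. by rewrite !mem_slots /= !eqxx orbT. Qed.

Lemma slots_cat k1 k2 : slots (k1 ++ k2) = slots k1 ++ slots k2.
Proof. by rewrite /slots map_cat flatten_cat. Qed.

Lemma slot_left x ks : (x + x \in slots ks) = (x \in ks).
Proof.
rewrite mem_slots; apply/hasP/idP => [[y hy /orP[/eqP h|/eqP h]]|h].
- by have -> : x = y by lia.
- by lia.
- by exists x => //; rewrite eqxx.
Qed.

Lemma slot_right x ks : (x + x + 1 \in slots ks) = (x \in ks).
Proof.
rewrite mem_slots; apply/hasP/idP => [[y hy /orP[/eqP h|/eqP h]]|h].
- by lia.
- by have -> : x = y by lia.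
- by exists x => //; rewrite eqxx orbT.
Qed.

Lemma slots_node x l r j : (j \notin slots (keys (Node x l r))) =
  [&& j \notin slots [:: x], j \notin slots (keys l) & j \notin slots (keys r)].
Proof.
rewrite -[keys (Node x l r)]/([:: x] ++ keys l ++ keys r) !slots_cat !mem_cat.
by rewrite !(negb_or, orbA) andbA.
Qed.

(* One merging step descends from [x] into its right subtree; [h] is the new
   hole, which is the slot of [x] not holding the old left subtree. *)
Lemma merged_node red base s s1 s' x l r tb hole h :
  mergeable red base s (Node x l r) tb hole ->
  tb <> Leaf ->
  (forall y, y \in keys tb -> (red x <= red y)%R) ->
  (h = x + x + 1 /\ size (keys r) + size (keys tb) <= size (keys l) /\
     imem s1 aNext (x + x) = imem s aNext (x + x) \/
   h = x + x /\ size (keys l) < size (keys r) + size (keys tb) /\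
     imem s1 aNext (x + x + 1) = imem s aNext (x + x)) ->
  imem s1 aNext hole = x ->
  (forall j, j != hole -> j \notin slots [:: x] ->
     imem s1 aNext j = imem s aNext j) ->
  imem s1 aSize x = size (keys (Node x l r)) + size (keys tb) ->
  (forall j, j != x -> imem s1 aSize j = imem s aSize j) ->
  (forall j, j != imem s vB 0 -> rmem s1 aKey j = rmem s aKey j) ->
  rmem s1 aKey (imem s vB 0) =
    (rmem s aKey (imem s vB 0) - rmem s aKey x)%R ->
  imem s1 vA 0 = imem s aNext (x + x + 1) ->
  imem s1 vB 0 = imem s vB 0 ->
  imem s1 vHole 0 = h ->
  (forall a, a \notin scratch -> imem s1 a = imem s a) ->
  (forall a, a != aKey -> rmem s1 a = rmem s a) ->
  mergeable red (red x) s1 r tb h /\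
  (merged red (red x) s1 r tb h s' ->
   merged red base s (Node x l r) tb hole s').
Proof.
move=> [hu /andP[ho hob] /andP[hbal hbalb] hs0 [hra hrb _ hhole]] htb hred.
move=> hh hNhole hN hSx hS hK hKb hA hB hH hF hFr.
have hu' := hu; move: hu'; rewrite cat_uniq => /and3P[hua hdis hub].
move: (hua) => /= /andP[hxlr hulr].
have hxl : x \notin keys l by move: hxlr; rewrite mem_cat negb_or => /andP[].
have hxr : x \notin keys r by move: hxlr; rewrite mem_cat negb_or => /andP[].
have hxb : x \notin keys tb.
  by apply/negP => hx; move/hasPn: hdis => /(_ _ hx); rewrite /= inE eqxx.
have hlb z : z \in keys l -> z \notin keys tb.
  move=> hz; apply/negP => hz'; move/hasPn: hdis => /(_ _ hz').
  by rewrite /= inE mem_cat hz orbT.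
have hrb' z : z \in keys r -> z \notin keys tb.
  move=> hz; apply/negP => hz'; move/hasPn: hdis => /(_ _ hz').
  by rewrite /= inE mem_cat hz !orbT.
have hlr z : z \in keys l -> z \notin keys r.
  move=> hz; apply/negP => hz'; move: hulr; rewrite cat_uniq => /and3P[_ hd _].
  by move/hasPn: hd => /(_ _ hz'); rewrite /= hz.
move: (hra) => /= [_ hx0 hSx0 hKx [hrl hrr]].
move: (ho) => /= /and3P[hmin hol hor].
move: (hbal) => /= /and3P[hsz hball hbalr].
have hx1 : h \in slots [:: x].
  by case: hh => -[-> _]; have /andP[] := slot_self x.
have hout z : z \in keys l ++ keys r ++ keys tb -> 
    [/\ z + z != hole, z + z + 1 != hole, z + z \notin slots [:: x] 
      & z + z + 1 \notin slots [:: x]].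
  move=> hz; have hzx : z != x.
    apply/eqP => e; rewrite e !mem_cat in hz.
    by rewrite (negbTE hxl) (negbTE hxr) (negbTE hxb) in hz.
  have hz' : z \in keys (Node x l r) ++ keys tb.
    by move: hz; rewrite /= inE !mem_cat orbA => ->; rewrite orbT.
  split.
  - by apply: contraNneq hhole => <-; rewrite slot_left.
  - by apply: contraNneq hhole => <-; rewrite slot_right.
  - by rewrite slot_left inE.
  - by rewrite slot_right inE.
have hBin : imem s vB 0 \in keys tb.
  by case: (tb) htb hrb => //= y lb rb _ [-> *]; rewrite mem_head.
have agree z : z \in keys l ++ keys r -> 
    [/\ imem s1 aNext (z + z) = imem s aNext (z + z),
     imem s1 aNext (z + z + 1) = imem s aNext (z + z + 1),
     imem s1 aSize z = imem s aSize z, rmem s1 aKey z = rmem s aKey z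
     & red z = (red z - 0)%R].
  move=> hz; have [|h1 h2 h3 h4] := hout z; first by rewrite catA mem_cat hz.
  split; [exact: hN|exact: hN| | |by rewrite subr0].
    apply: hS; apply: contraNneq hxlr => <-; exact: hz.
  apply: hK; apply: contraTneq hBin => <-.
  by move: hz; rewrite mem_cat => /orP[/hlb|/hrb'].
have reprB : repr (imem s1 aNext) (imem s1 aSize) (rmem s1 aKey) red (red x)
            (imem s1 vB 0) tb.
  rewrite hB; move: htb hrb hub hxb hBin hout hKb => {hh hob hbalb hred hdis hu hhole hrb' hlb hSx}.
  case: tb => //= y lb rb _ [hy hy0 hSy hKy [hlb hrb]].
  move=> /andP[hyn _] hxn _ hout; rewrite hy => hKb.
  have hyx : y != x by apply: contraNneq hxn => <-; rewrite mem_head.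
  have agree' z : z \in keys lb ++ keys rb ->
    [/\ imem s1 aNext (z + z) = imem s aNext (z + z),
     imem s1 aNext (z + z + 1) = imem s aNext (z + z + 1),
     imem s1 aSize z = imem s aSize z, rmem s1 aKey z = rmem s aKey z
     & red z = (red z - 0)%R].
    move=> hz; have [|h1 h2 h3 h4] := hout z.
      by rewrite !mem_cat inE hz !orbT.
    split; [exact: hN|exact: hN| | |by rewrite subr0].
      apply: hS; apply: contraNneq hxn => <-; by rewrite inE hz orbT.
    by apply: hK; rewrite hy; apply: contraNneq hyn => <-.
  have [|h1 h2 h3 h4] := hout y.
    by rewrite !mem_cat mem_head !orbT.
  split => //.
  - by rewrite hS.
  - by rewrite hKb hKy hKx; ring.
  - split.
      rewrite hN //; apply: (repr_ext (y := 0%R)) hlb; last by rewrite subr0.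
      by move=> z hz; apply: agree'; rewrite mem_cat hz.
    rewrite hN //; apply: (repr_ext (y := 0%R)) hrb; last by rewrite subr0.
    by move=> z hz; apply: agree'; rewrite mem_cat hz orbT.
split.
  split => //.
  - move: hulr hub hdis; rewrite /= !cat_uniq => /and3P[_ _ ->] -> hd.
    rewrite andbT; apply/hasPn => z hz; apply: contraL hz; exact: hrb'.
  - by rewrite hor hob.
  - by rewrite hbalr hbalb.
  - by rewrite hS // neq_ltn hx0.
  - split => //.
      rewrite hA; apply: (repr_ext (y := 0%R)) hrr; last by rewrite subr0.
      by move=> z hz; apply: agree; rewrite mem_cat hz orbT.
    have hxrb : x \notin keys r ++ keys tb.
      by rewrite mem_cat negb_or hxr hxb.
    by case: hh => -[-> _]; [rewrite slot_right|rewrite slot_left].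
move=> [[tr [hp hot hbt hrt]] hN' hSK hF' hFr'].
have hpm z : (z \in keys tr) = (z \in keys r ++ keys tb) by apply: perm_mem.
have hxr' : x \notin keys r ++ keys tb by rewrite mem_cat negb_or hxr hxb.
have hsl : x + x \notin slots (keys r ++ keys tb) by rewrite slot_left.
have hsl1 : x + x + 1 \notin slots (keys r ++ keys tb) by rewrite slot_right.
have hholex : hole \notin slots [:: x].
  by move: hhole; rewrite slots_cat mem_cat negb_or slots_node => /andP[/andP[]].
have hholeh : hole != h by apply: contraNneq hholex => ->.
have hholer : hole \notin slots (keys r ++ keys tb).
  move: hhole; rewrite slots_cat mem_cat negb_or slots_node.
  by case/andP => /and3P[_ _ h1] h2; rewrite slots_cat mem_cat negb_or h1.
have [hSx' hKx'] := hSK _ hxr'.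
have hNhole' : imem s' aNext hole = x by rewrite hN'.
have hKxs : rmem s1 aKey x = rmem s aKey x.
  by apply: hK; apply: contraNneq hxb => ->.
have reprL : repr (imem s' aNext) (imem s' aSize) (rmem s' aKey) red (red x)
            (imem s aNext (x + x)) l.
  apply: (repr_ext (y := 0%R)) hrl; last by rewrite subr0.
  move=> z hz; have hzl : z \in keys l ++ keys r by rewrite mem_cat hz.
  have [e1 e2 e3 e4 e5] := agree _ hzl.
  have hzrb : z \notin keys r ++ keys tb.
    by rewrite mem_cat negb_or hlr ?hlb.
  have [hs' hk'] := hSK _ hzrb.
  have [|h1 h2 h3 h4] := hout z; first by rewrite mem_cat hz.
  rewrite hs' hk' -e1 -e2 -e3 -e4; split => //.
    apply: hN'; last by rewrite slot_left.
    by apply: contraNneq h3 => ->.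
  apply: hN'; last by rewrite slot_right.
  by apply: contraNneq h4 => ->.
have hmin' z : z \in keys r ++ keys tb -> (red x <= red z)%R.
  rewrite mem_cat => /orP[hz|]; last exact: hred.
  by move/allP: hmin; apply; rewrite mem_cat hz orbT.
split.
- case: hh => -[hh [hsz' hN1]].
  + exists (Node x l tr); split.
    * rewrite /= -!catA /= perm_cons perm_cat2l; exact: hp.
    * rewrite /= hol hot !andbT; apply/allP => z; rewrite mem_cat => /orP[hz|].
        by move/allP: hmin; apply; rewrite mem_cat hz.
      by rewrite hpm => /hmin'.
    * by rewrite /= hball hbt !andbT (perm_size hp) size_cat.
    * rewrite hNhole' /=; split => //.
      - by rewrite hSx' hSx /= !size_cat (perm_size hp) size_cat addSn addnA.
      - by rewrite hKx' hKxs.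
      - rewrite -hh; split => //; rewrite hN' //; first by rewrite hN1.
        by rewrite hh addn1 neq_ltn ltnSn ?orbT.
  + exists (Node x tr l); split.
    * rewrite /= -!catA /= perm_cons.
      by rewrite perm_catC perm_cat2l; exact: hp.
    * rewrite /= hol hot !andbT; apply/allP => z; rewrite mem_cat => /orP[].
        by rewrite hpm => /hmin'.
      by move=> hz; move/allP: hmin; apply; rewrite mem_cat hz.
    * by rewrite /= hball hbt !andbT (perm_size hp) size_cat ltnW.
    * rewrite hNhole' /=; split => //.
      - rewrite hSx' hSx /= !size_cat (perm_size hp) size_cat.
        by rewrite addSn -addnA addnC.
      - by rewrite hKx' hKxs.
      - split; first by rewrite -hh.
        rewrite hN' //; first by rewrite hN1.
        by rewrite hh addn1 neq_ltn ltnSn orbT.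
- move=> j hj; rewrite slots_cat mem_cat negb_or slots_node.
  case/andP => /and3P[hj1 hj2 hj3] hj4.
  rewrite hN'; first exact: hN.
    by apply: contraNneq hj1 => ->.
  by rewrite slots_cat mem_cat negb_or hj3.
- move=> j; rewrite /= inE !mem_cat !negb_or => /andP[hj1 /andP[/andP[hj2 hj3] hj4]].
  have [|-> ->] := hSK j; first by rewrite mem_cat negb_or hj3.
  by rewrite hS // hK //; apply: contraNneq hj4 => ->.
- by move=> a ha; rewrite hF' // hF.
- by move=> a ha; rewrite hFr' // hFr.
Qed.

Lemma wp_descend red base s x l r tb hole :
  mergeable red base s (Node x l r) tb hole -> tb <> Leaf ->
  (forall y, y \in keys tb -> (red x <= red y)%R) ->
  wp descend s (fun s1 t1 => t1 <= 80 /\ exists h,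
    mergeable red (red x) s1 r tb h /\
    forall s', merged red (red x) s1 r tb h s' ->
      merged red base s (Node x l r) tb hole s').
Proof.
move=> hm htb hred.
have [hu _ _ hs0 [hra hrb hhole hslot]] := hm.
move: (hra) => /= [hA hx0 hSx hKx [hrl hrr]].
have hslotx : hole \notin slots [:: x].
  by move: hslot; rewrite slots_cat mem_cat negb_or slots_node => /andP[/andP[]].
have hh2 : x + x != hole.
  by apply: contraNneq hslotx => <-; rewrite slot_left mem_head.
have hh3 : x + x + 1 != hole.
  by apply: contraNneq hslotx => <-; rewrite slot_right mem_head.
(* The size of [x] is overwritten before other sizes are compared. The pointers read afterwards are
   0 or other keys, by uniqueness, so their sizes are still the old ones. *)
have hrx : imem s aNext (x + x + 1) != x.
  apply/eqP => e; rewrite e in hrr; move: hu; rewrite /=.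
  case: (r) hrr => /= [e'|z lz rz [-> _ _ _ _]]; first by rewrite e' in hx0.
  by rewrite !(mem_cat, inE) eqxx ?orbT.
have hBx : imem s vB 0 != x.
  apply/eqP => e; rewrite e in hrb; move: hu; rewrite /=.
  case: (tb) hrb => /= [e'|z lz rz [-> _ _ _ _]]; first by rewrite e' in hx0.
  by rewrite !(mem_cat, inE) eqxx ?orbT.
have hlx : imem s aNext (x + x) != x.
  apply/eqP => e; rewrite e in hrl; move: hu; rewrite /=.
  case: (l) hrl => /= [e'|z lz rz [-> _ _ _ _]]; first by rewrite e' in hx0.
  by rewrite !(mem_cat, inE) eqxx ?orbT.
have hszr := repr_size hs0 hrr; have hszb := repr_size hs0 hrb.
have hszl := repr_size hs0 hrl.
rewrite /descend.
apply: wp_seq; apply: wp_rput; rewrite /= hA.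
apply: wp_seq; apply: wp_iput; rewrite /= hA hhole.
apply: wp_seq; apply: wp_iput; rewrite /= !(@upd_off _ _ aNext) // hA.
set M2 := upd (upd _ _ _ _) _ _ _.
have e2 : M2 vA 0 = x by rewrite /M2 /upd.
have e3 : M2 aNext (x + x + 1) = imem s aNext (x + x + 1).
  by rewrite /M2 /upd /= (negbTE hh3).
apply: wp_seq; apply: wp_iput; rewrite /= e2 e3 /M2.
apply: wp_seq.
set M := upd _ vRight 0 _.
have eA : M vA 0 = x by rewrite /M /upd.
have eB : M vB 0 = imem s vB 0 by rewrite /M /upd.
have eR : M vRight 0 = imem s aNext (x + x + 1) by rewrite /M /upd.
have eN j : M aNext j = if j == hole then x else imem s aNext j.
  by rewrite /M /upd /=.
have eS j : M aSize j = if j == x then imem s aSize x + imem s aSize (imem s vB 0)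
    else imem s aSize j.
  by rewrite /M /upd /=.
have eF a : a \notin scratch -> M a = imem s a.
  rewrite !inE !negb_or => /and5P[h1 h2 h3 h4 /and3P[h5 h6 h7]].
  by rewrite /M !upd_off.
set K := upd (rmem s) _ _ _.
have core M' h : 
   (h = x + x + 1 /\ size (keys r) + size (keys tb) <= size (keys l) /\
     M' aNext (x + x) = imem s aNext (x + x) \/
   h = x + x /\ size (keys l) < size (keys r) + size (keys tb) /\
     M' aNext (x + x + 1) = imem s aNext (x + x)) ->
   M' aNext hole = x ->
   (forall j, j != hole -> j \notin slots [:: x] -> M' aNext j = M aNext j) ->
   M' aSize = M aSize -> M' vA 0 = M vRight 0 -> M' vB 0 = M vB 0 ->
   M' vHole 0 = h -> (forall a, a \notin scratch -> M' a = M a) ->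
   exists h, mergeable red (red x) (State M' K) r tb h /\
    forall s', merged red (red x) (State M' K) r tb h s' ->
      merged red base s (Node x l r) tb hole s'.
  move=> c1 c2 c3 c4 c5 c6 c7 c8; exists h.
  have h1 (s' : state R) := @merged_node red base s (State M' K) s' x l r tb hole h hm htb hred c1 c2.
  have {}h1 (s' : state R) : mergeable red (red x) (State M' K) r tb h /\
     (merged red (red x) (State M' K) r tb h s' ->
        merged red base s (Node x l r) tb hole s').
    apply: h1 => /=.
    - by move=> j hj hj'; rewrite c3 // eN (negbTE hj).
    - by rewrite c4 eS eqxx hszb hSx.
    - by move=> j hj; rewrite c4 eS (negbTE hj).
    - by move=> j hj; rewrite /K upd_row (negbTE hj).
    - by rewrite /K upd_hit.
    - by rewrite c5 eR.
    - by rewrite c6.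
    - by [].
    - by move=> a ha; rewrite c8 // eF.
    - by move=> a ha; rewrite /K upd_off.
  split; first by case: (h1 s).
  by move=> s'; case: (h1 s').
apply: wp_if => /=; rewrite eR eA eB !eN (negbTE hh2) !eS (negbTE hrx)
    (negbTE hlx) (negbTE hBx) hszr hszb hszl => hcmp.
- apply: wp_iput; rewrite /= eA; apply: wp_iput; rewrite /= upd_off // eR.
  split => //; apply: (core _ (x + x + 1)).
  + by left; split => //; rewrite !upd_off // eN (negbTE hh2).
  + by rewrite !upd_off // eN eqxx.
  + by move=> j _ _; rewrite !upd_off.
  + by rewrite !upd_off.
  + by rewrite upd_hit eR.
  + by rewrite !upd_off.
  + by rewrite upd_off // upd_hit.
  + move=> a; rewrite !inE !negb_or => /and5P[h1 h2 h3 h4 /and3P[h5 h6 h7]].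
    by rewrite !upd_off.
- apply: wp_seq; apply: wp_iput; rewrite /= eA eN (negbTE hh2).
  apply: wp_iput; rewrite /= upd_off // eA.
  apply: wp_iput; rewrite /= !(@upd_off _ _ _ vRight) // eR.
  split => //; apply: (core _ (x + x)).
  + by right; split => //; split; [lia|rewrite 2?upd_off // upd_hit].
  + by rewrite 2?upd_off // upd_row eq_sym (negbTE hh3) eN eqxx.
  + move=> j _ hj; rewrite 2?upd_off // upd_row; case: eqP => // e.
    by rewrite e slot_right mem_head in hj.
  + by rewrite !upd_off.
  + by rewrite upd_hit eR.
  + by rewrite !upd_off.
  + by rewrite upd_off // upd_hit.
  + move=> a; rewrite !inE !negb_or => /and5P[h1 h2 h3 h4 /and3P[h5 h6 h7]].
    by rewrite !upd_off.
Qed.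

Lemma merged_swap red base s s2 ta tb hole s' :
  (forall a, a \notin [:: vA; vB; vTmp] -> imem s2 a = imem s a) ->
  rmem s2 = rmem s ->
  merged red base s2 tb ta hole s' -> merged red base s ta tb hole s'.
Proof.
move=> hI hR [[tr [h1 h2 h3 h4]] g1 g2 g3 g4].
have hsw : keys tb ++ keys ta =i keys ta ++ keys tb.
  by move=> z; rewrite !mem_cat orbC.
split.
- by exists tr; split => //; rewrite perm_sym perm_catC perm_sym.
- move=> j hj hj'; rewrite g1 ?hI //; move: hj'.
  by rewrite !slots_cat !mem_cat orbC.
- by move=> j hj; rewrite -hsw in hj; have [-> ->] := g2 _ hj; rewrite hI // hR.
- move=> a ha; rewrite g3 // hI //; move: ha.
  rewrite !inE !negb_or => /and5P[_ _ -> -> /and3P[_ _ ->]] //.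
- by move=> a ha; rewrite g4 // hR.
Qed.

Lemma mergeable_swap red base s s2 ta tb hole :
  (forall a, a \notin [:: vA; vB; vTmp] -> imem s2 a = imem s a) ->
  imem s2 vA 0 = imem s vB 0 -> imem s2 vB 0 = imem s vA 0 ->
  rmem s2 = rmem s ->
  mergeable red base s ta tb hole -> mergeable red base s2 tb ta hole.
Proof.
move=> hI hA hB hR [h1 /andP[h2 h2'] /andP[h3 h3'] h4 [h5 h6 h7 h8]].
split; [by rewrite uniq_catC|by rewrite h2 h2'|by rewrite h3 h3'|by rewrite hI|].
split; [by rewrite hA hR !hI|by rewrite hB hR !hI|by rewrite hI|].
by move: h8; rewrite !slots_cat !mem_cat orbC.
Qed.

(** Every iteration replaces one heap by its right subtree. The time is therefore charged to the two
    right spines, while the induction itself runs on the number of keys. *)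
Lemma wp_meld_loop N red ta tb s base hole :
  size (keys ta) + size (keys tb) <= N ->
  mergeable red base s ta tb hole ->
  wp meld_loop s (fun s' t => merged red base s ta tb hole s' /\
    t <= 140 * (spine ta + spine tb) + 40).
Proof.
elim: N ta tb s base hole => [|N IH] ta tb s base hole hN hm.
  have [_ _ _ h0 [hA hB hH hsl]] := hm.
  have eA : ta = Leaf by case: (ta) hN.
  have eB : tb = Leaf by case: (tb) hN; case: (ta).
  subst; rewrite /= in hA hB.
  apply: wp_while_seq; rewrite /= hA //= => _.
  apply: wp_iput; rewrite /= hA hB; split => //.
  split => //=.
  - by exists Leaf; split => //=; rewrite upd_hit.
  - by move=> j hj _; rewrite upd_row (negbTE hj).
  - by move=> a; rewrite !inE !negb_or => /andP[h _]; rewrite upd_off.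
have [hu hord hbal h0 [hA hB hH hsl]] := hm.
have hpA x l r : ta = Node x l r -> imem s vA 0 = x /\ 0 < x.
  by move=> e; move: hA; rewrite e => -[].
have hpB x l r : tb = Node x l r -> imem s vB 0 = x /\ 0 < x.
  by move=> e; move: hB; rewrite e => -[].
(* The loop stops when one of the pointers is 0, so the sum stored in the hole is the other
   pointer. *)
have final tr : tr = ta /\ tb = Leaf \/ tr = tb /\ ta = Leaf ->
   wp meld_loop s (fun s' t => merged red base s ta tb hole s' /\
    t <= 140 * (spine ta + spine tb) + 40).
  move=> htr.
  apply: wp_while_seq => /= [|_].
    by case: htr => -[_ e]; subst; rewrite /= in hA hB; [rewrite hB andbF|rewrite hA].
  apply: wp_iput; rewrite /= hH; split; last lia.
  have e : keys tr = keys ta ++ keys tb.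
    by case: htr => -[-> ->] //; rewrite cats0.
  have e2 : repr (imem s aNext) (imem s aSize) (rmem s aKey) red base
          (imem s vA 0 + imem s vB 0) tr.
    case: htr => -[e1 e2]; subst => /=; rewrite /= in hA hB; [rewrite hB|rewrite hA];
    by rewrite ?addn0.
  split => /=.
  - exists tr; split.
    + by rewrite e.
    + by case/andP: hord htr => ? ? [[-> _]|[-> _]].
    + by case/andP: hbal htr => ? ? [[-> _]|[-> _]].
    + rewrite upd_hit; apply: (repr_ext (y := 0%R)) e2; last by rewrite subr0.
      move=> z hz; rewrite upd_row (@upd_off _ _ aNext aSize) // subr0 -e in hsl *.
      split => //; case: eqP => // e3; move: hsl;
      by rewrite -e3 ?slot_left ?slot_right hz.
  - by move=> j hj _; rewrite upd_row (negbTE hj).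
  - by move=> j _; rewrite upd_off.
  - by move=> a; rewrite !inE !negb_or => /andP[h _]; rewrite upd_off.
  - by [].
case eA : ta => [|x l r]; first by rewrite -eA; apply: (final tb); right.
case eB : tb => [|y lb rb]; first by rewrite -eA -eB; apply: (final ta); left.
have [ex hx] := hpA _ _ _ eA; have [ey hy] := hpB _ _ _ eB.
apply: wp_while_seq => /= [_|]; last by rewrite ex ey; lia.
rewrite /meld_step -eA -eB.
have [hoA hoB] := andP hord.
have hkx : rmem s aKey x = (red x - base)%R.
  by move: hA; rewrite eA => -[].
have hky : rmem s aKey y = (red y - base)%R.
  by move: hB; rewrite eB => -[].
have key : wp (Seq (If (BRLe (RGet aKey (var vA)) (RGet aKey (var vB))) Skip
          (Seq (vTmp <-- var vA) (Seq (vA <-- var vB) (vB <-- var vTmp))))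
           descend) s (fun s1 t1 => t1 <= 110 /\ exists ta' tb' h base',
    [/\ mergeable red base' s1 ta' tb' h,
     spine ta' + spine tb' < spine ta + spine tb,
     size (keys ta') + size (keys tb') < size (keys ta) + size (keys tb)
     & forall s', merged red base' s1 ta' tb' h s' ->
      merged red base s ta tb hole s']).
  apply: wp_seq; apply: wp_if => /=; rewrite ex ey hkx hky lerD2r => hle.
  - apply: wp_skip; rewrite eA in hm *.
    apply: wp_mono (wp_descend hm _ _) _; first by rewrite eB.
      move=> z hz; apply: le_trans hle _.
      by have := orderedP hoB hz; rewrite eB.
    move=> s1 t1 [ht [h [h1 h2]]]; split; first lia.
    exists r, tb, h, (red x); split => //=; rewrite size_cat; lia.
  - apply: wp_seq; apply: wp_iput => /=; rewrite ex.
    apply: wp_seq; apply: wp_iput => /=; rewrite upd_off // ey.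
    apply: wp_iput; rewrite /= upd_off // upd_hit.
    set s2 := State _ _.
    have hI : forall a, a \notin [:: vA; vB; vTmp] -> imem s2 a = imem s a.
      by move=> a; rewrite !inE !negb_or => /and3P[? ? ?]; rewrite /= !upd_off.
    have hm2 : mergeable red base s2 tb ta hole.
      by apply: mergeable_swap hm.
    rewrite eB in hm2.
    apply: wp_mono (wp_descend hm2 _ _) _; first by rewrite eA.
      move=> z hz; apply: (@le_trans _ _ (red x)).
        by rewrite leNgt; apply: contra hle => /ltW.
      by have := orderedP hoA hz; rewrite eA.
    move=> s1 t1 [ht [h [h1 h2]]]; split; first lia.
    exists rb, ta, h, (red y); rewrite eB; split => //=; [lia|rewrite size_cat; lia|].
    move=> s' hs'; apply: merged_swap hI _ (h2 _ hs') => //.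
apply: wp_mono key _ => s1 t1 [ht [ta' [tb' [h [base' [hm' hsp hsz hf]]]]]].
apply: wp_mono (IH ta' tb' s1 base' h _ hm') _; first lia.
move=> s2 t2 [h2 ht2]; split; first exact: hf.
move: hsp ht ht2; rewrite eA eB /=; lia.
Qed.

(** Slot 0 would be the left child of node 0. As keys are positive, it belongs to no heap and can
    receive the resulting root. *)
Lemma wp_meld red base ta tb s :
  uniq (keys ta ++ keys tb) -> ordered red ta && ordered red tb ->
  balanced ta && balanced tb -> imem s aSize 0 = 0 ->
  repr (imem s aNext) (imem s aSize) (rmem s aKey) red base (imem s vA 0) ta ->
  repr (imem s aNext) (imem s aSize) (rmem s aKey) red base (imem s vB 0) tb ->
  wp meld s (fun s' t => merged red base s ta tb 0 s' /\
    t <= 140 * (spine ta + spine tb) + 45).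
Proof.
move=> h1 h2 h3 h4 h5 h6; apply: wp_seq; apply: wp_iput => /=.
set s1 := State _ _.
have h : mergeable red base s1 ta tb 0.
  split => //; split; rewrite /s1 /= ?upd_hit //.
  rewrite mem_slots; apply/hasPn => z.
  rewrite mem_cat => /orP[hz|hz].
    by have := repr_gt0 h5 hz; lia.
  by have := repr_gt0 h6 hz; lia.
apply: wp_mono (wp_meld_loop (leqnn _) h) _ => s' t [hm ht]; split; last lia.
have [g1 g2 g3 g4 g5] := hm.
split => //.
by move=> a ha; rewrite g4 // /s1 /= upd_off //; apply: contraNneq ha => ->.
Qed.

End Heap.

(** * Contraction of cycles *)

Section Tally.

Lemma ncount_add N (p q r : nat -> bool) :
  (forall i, i < N -> (p i = q i + r i :> nat)) ->
  ncount N p = ncount N q + ncount N r.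
Proof.
move=> h; rewrite /ncount.
have {}h i : i \in iota 0 N -> (p i = q i + r i :> nat).
  by rewrite mem_iota => /h.
elim: (iota 0 N) h => //= i l IH h.
by rewrite h ?mem_head // IH => [|j hj]; [lia|apply: h; rewrite inE hj orbT].
Qed.

Lemma eq_ncount N (p q : nat -> bool) :
  (forall i, i < N -> p i = q i) -> ncount N p = ncount N q.
Proof.
by move=> h; apply: eq_in_count => i; rewrite mem_iota => /h.
Qed.

Lemma ncount1 N x : x < N -> ncount N (fun i => i == x) = 1.
Proof.
move=> h; rewrite /ncount (count_uniq_mem _ (iota_uniq _ _)) mem_iota.
by rewrite h.
Qed.

Lemma leq_ncount_surj N (p q : nat -> bool) (h : nat -> nat) :
  (forall i, i < N -> p i -> exists j, [/\ j < N, q j & h j = i]) ->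
  ncount N p <= ncount N q.
Proof.
move=> hpq; rewrite /ncount -!size_filter -(size_map h (filter q _)).
apply: uniq_leq_size; first by rewrite filter_uniq // iota_uniq.
move=> i; rewrite mem_filter mem_iota /= => /andP[hi1 hi2].
have [j [hj1 hj2 <-]] := hpq i hi2 hi1.
by apply: map_f; rewrite mem_filter hj2 mem_iota.
Qed.

End Tally.

Section Contraction.
Variable R : realType.
Variables n E : nat.
Variables tl hd K0 : nat -> nat.
Variable w0 : nat -> R.
Implicit Types (S K W ch f g : nat -> nat) (red : nat -> R) (D : R).

Definition arc a := 0 < a <= E.

Hypothesis tl_le : forall a, tl a <= n.
Hypothesis hd_lt : forall a, hd a < n.
Hypothesis K0_lt : forall i, i < n -> K0 i < n.
Hypothesis K0_idem : forall i, i < n -> K0 (K0 i) = K0 i.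
Hypothesis K0_n : K0 n = n.
Hypothesis source_arc :
  forall i, i < n -> exists a, [/\ arc a, tl a = n & hd a = i].

(* Walking backwards along the arcs selected by [f] from the supernode of [y],
   one reaches a supernode that is not entered by a selected arc. *)
Inductive rooted S K f : nat -> Prop :=
| Rooted_top y : S (hd (f (K y))) <> S y -> rooted S K f y
| Rooted_step y : S (hd (f (K y))) = S y -> rooted S K f (tl (f (K y))) ->
    rooted S K f y.

Definition selection S K f : Prop :=
  (forall k, k < n -> K k = k -> arc (f k) /\ K (hd (f k)) = k) /\
  forall y, y <= n -> rooted S K f y.

Record parts S K W : Prop := Parts {
  S_lt : forall i, i < n -> S i < n;
  S_idem : forall i, i <= n -> S (S i) = S i;
  S_n : S n = n;
  K_lt : forall i, i < n -> K i < n;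
  K_idem : forall i, i <= n -> K (K i) = K i;
  K_n : K n = n;
  K_S : forall i, i <= n -> K (S i) = K i;
  K_K0 : forall i, i < n -> K (K0 i) = K i;
  W_S : forall i, i <= n -> W (S i) = W i
}.

(* In each class, the supernodes have total rank (number of nodes minus number of
   supernodes) one less than the number of colors. *)
Definition counted S K : Prop := forall k, k < n -> K k = k ->
  ncount n (fun i => K i == k) + 1 =
  ncount n (fun i => (K0 i == i) && (K i == k)) +
  ncount n (fun i => (S i == i) && (K i == k)).

Lemma eq_SK S K W i j : parts S K W -> i <= n -> j <= n -> S i = S j ->
  K i = K j /\ W i = W j.
Proof.
move=> p hi hj e; split.
  by rewrite -(K_S p hi) e (K_S p).
by rewrite -(W_S p hi) e (W_S p).
Qed.

Lemma rooted_closed g (Z : nat -> bool) y :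
  rooted id K0 g y -> Z y ->
  (forall z, Z z -> hd (g (K0 z)) = z /\ Z (tl (g (K0 z)))) -> False.
Proof.
move=> hr hz hZ; elim: hr hz => {y} [y hne|y _ _ IH] hz.
  by apply: hne; case: (hZ _ hz).
by apply: IH; case: (hZ _ hz).
Qed.

(** If all arcs that [g] selects for the colors of the class were loops, each of its supernodes
    would contain a node not entered, as a backward walk could not leave the supernode and yet has
    to stop. The entered nodes are at least as many as the colors, so the class would have at least
    as many nodes as colors and supernodes together, one more than [counted] allows. *)
Lemma nonloop_exists S K W g k :
  parts S K W -> counted S K -> selection id K0 g -> k < n -> K k = k ->
  exists i, [/\ i < n, K0 i = i, K i = k & S (tl (g i)) <> S (hd (g i))].
Proof.
move=> p hc [hg hr] hk Kk; apply: contrapT => hno.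
have {}hno i : i < n -> K0 i = i -> K i = k -> S (tl (g i)) = S (hd (g i)).
  by move=> h1 h2 h3; apply: contrapT => h4; apply: hno; exists i.
pose ent i := hd (g (K0 i)) == i.
have e1 : ncount n (fun i => K i == k) =
   ncount n (fun i => (K i == k) && ent i) + ncount n (fun i => (K i == k) && ~~ ent i).
  by apply: ncount_add => i _; case: (K i == k); case: (ent i).
have e2 : ncount n (fun i => (K0 i == i) && (K i == k)) <=
          ncount n (fun i => (K i == k) && ent i).
  apply: (leq_ncount_surj (h := K0)) => i hi /andP[/eqP h1 /eqP h2].
  have [_ h3] := hg _ hi h1; exists (hd (g i)); split => //.
  by rewrite -(K_K0 p) // h3 h2 /ent h3 !eqxx.
have e3 : ncount n (fun i => (S i == i) && (K i == k)) <=
          ncount n (fun i => (K i == k) && ~~ ent i).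
  apply: (leq_ncount_surj (h := S)) => z hz /andP[/eqP Sz /eqP Kz].
  apply: contrapT => hno2.
  apply: (@rooted_closed g (fun y => (y < n) && (S y == z)) z).
  - by apply: hr; exact: ltnW.
  - by rewrite hz Sz eqxx.
  - move=> y /andP[hy /eqP Sy].
    have Ky : K y = k by rewrite -(K_S p (ltnW hy)) Sy.
    have hent : hd (g (K0 y)) = y.
      apply: contrapT => hne; apply: hno2; exists y; split => //.
      by rewrite Ky eqxx /ent; apply/eqP.
    split => //.
    have h := hno (K0 y) (K0_lt hy) (K0_idem hy).
    have {h} := h _; rewrite (K_K0 p) // => /(_ Ky); rewrite hent Sy => h.
    rewrite h eqxx andbT ltn_neqAle tl_le andbT; apply/eqP => e.
    by move: h hz; rewrite e (S_n p) => <-; rewrite ltnn.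
have := hc _ hk Kk; lia.
Qed.

(* A merge of the classes [entry_child] and [entry_root] of [entry_K]. The chosen
   arc of the child is not recorded, as it is never overwritten. *)
Record entry := Entry {
  entry_K : nat -> nat; entry_child : nat; entry_root : nat; entry_arc : nat
}.

(** The arc of the merged class goes to the part that contains its head. If that is the root part,
    nothing changes, because the cell of the child still holds its own arc. *)
Definition undo (e : entry) f : nat -> nat :=
  if entry_K e (hd (f (entry_root e))) == entry_child e then
    fun i => if i == entry_child e then f (entry_root e)
             else if i == entry_root e then entry_arc e else f i
  else f.

Fixpoint expand (log : seq entry) f : nat -> nat :=
  if log is e :: log' then expand log' (undo e f) else f.

(* The candidate [a] closes a cycle; walking back from [tl a] along it one meets
   only supernodes whose selected arc is the one chosen for them. *)
Inductive on_cycle S K ch f v : nat -> Prop :=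
| Cycle_end y : S y = S v -> on_cycle S K ch f v y
| Cycle_step y : f (K y) = ch (K y) -> ch (K y) != 0 -> S (hd (ch (K y))) = S y ->
    on_cycle S K ch f v (tl (ch (K y))) -> on_cycle S K ch f v y.

(** The restriction on selections while a cycle is half contracted. It is vacuous without a
    candidate, for a loop, and for a candidate joining two components, hence in all states from
    which a class gets served or a new arc is extracted. *)
Definition cycle_selected S K W ch ca f : Prop :=
  ca != 0 -> W (tl ca) = W (hd ca) -> S (tl ca) <> S (hd ca) ->
  f (K (hd ca)) = ca \/ on_cycle S K ch f (hd ca) (tl ca).

(** The primal half of the invariant. The first premise fixes the cells of absorbed classes, which
    keep the arc chosen last and are read again by [expand]. *)
Definition liftable S K W ch red D (log : seq entry) ca : Prop :=
  forall f, (forall i, i < n -> K i <> i -> f i = ch i) -> selection S K f ->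
    cycle_selected S K W ch ca f ->
    selection id K0 (expand log f) /\
    (\sum_(i <- iota 0 n | K0 i == i) w0 (expand log f i) =
     D + \sum_(i <- iota 0 n | K i == i) red (f i))%R.

(* [red] are the reduced weights and [D] is the value of the dual solution. *)
Definition lower_bound S red D : Prop := forall g, selection id K0 g ->
  (D + \sum_(i <- iota 0 n | (K0 i == i) && (S (tl (g i)) != S (hd (g i))))
         red (g i) <= \sum_(i <- iota 0 n | K0 i == i) w0 (g i))%R.

Definition covered S K ch y := (ch (K y) != 0) && (S (hd (ch (K y))) == S y).

(* [ht] witnesses that the chosen arcs form no cycle of supernodes. *)
Definition forest S K W ch red : Prop :=
  exists2 ht : nat -> nat, (forall i, i <= n -> ht (S i) = ht i) &
  forall k, k < n -> K k = k -> ch k != 0 ->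
    [/\ arc (ch k), K (hd (ch k)) = k, red (ch k) = 0%R &
     [/\ S (tl (ch k)) <> S (hd (ch k)), W (tl (ch k)) = W (hd (ch k)) &
      ht (tl (ch k)) < ht (hd (ch k))]].

(* [S], [K] and [W] map a node to the representatives of its supernode, its class
   and its component; [ch k] is the arc chosen for the class [k], with 0 for none;
   [ca] is the candidate for the class being served, likewise. *)
Record inv S K W ch red D (H : nat -> seq nat) log ca : Prop := Inv {
  i_parts : parts S K W;
  i_count : counted S K;
  i_lb : lower_bound S red D;
  i_lift : liftable S K W ch red D log ca;
  i_forest : forest S K W ch red;
  i_root : forall y z, y <= n -> z <= n -> W y = W z ->
    ~~ covered S K ch y -> ~~ covered S K ch z -> S y = S z;
  i_heap : forall k a, k < n -> K k = k -> a \in H k -> [/\ arc a, K (hd a) = k & (0 <= red a)%R];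
  i_arcs : forall a, arc a -> [\/ a \in H (K (hd a)), S (tl a) = S (hd a),
      a = ch (K (hd a)) | a = ca];
  i_ge0 : forall a, arc a -> S (tl a) <> S (hd a) -> (0 <= red a)%R;
  i_cand : ca != 0 -> [/\ arc ca, red ca = 0%R & ch (K (hd ca)) = 0]
}.

(** The auxiliary arc to [k] never becomes a loop, as the source is never merged; being neither
    chosen nor candidate, it is still in the heap. *)
Lemma heap_nonempty S K W ch red D H log k :
  inv S K W ch red D H log 0 -> k < n -> K k = k -> ch k = 0 ->
  H k <> [::].
Proof.
move=> I hk Kk ck hH; have p := i_parts I.
have [a [ha ta va]] := source_arc hk.
case: (i_arcs I ha); rewrite ?va ?Kk.
- by rewrite hH.
- rewrite ta (S_n p) => e; have := S_lt p hk; rewrite -e ltnn //.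
- by rewrite ck => e; move: ha; rewrite e.
- by move=> e; move: ha; rewrite e.
Qed.

(** At least one non-loop arc enters the class, by [nonloop_exists], so the sum drops by at least
    [y]. For contracted selections exactly one arc is counted per class, and the next lemma gives an
    equality. *)
Lemma sum_nonloop_extract S K W red g k y :
  parts S K W -> counted S K -> selection id K0 g -> k < n -> K k = k ->
  (0 <= y)%R ->
  (\sum_(i <- iota 0 n | (K0 i == i) && (S (tl (g i)) != S (hd (g i))))
      (if K (hd (g i)) == k then red (g i) - y else red (g i)) + y <=
   \sum_(i <- iota 0 n | (K0 i == i) && (S (tl (g i)) != S (hd (g i))))
      red (g i))%R.
Proof.
move=> p hc hg hk Kk hy.
have [i [hi Ki0 Ki hne]] := nonloop_exists p hc hg hk Kk.
have hKi : K (hd (g i)) = k.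
  have [_ e] := hg.1 _ hi Ki0; by rewrite -(K_K0 p) // e Ki.
have hin : i \in iota 0 n by rewrite mem_iota.
have hP : (K0 i == i) && (S (tl (g i)) != S (hd (g i))).
  by rewrite Ki0 eqxx; apply/eqP.
rewrite !(big_rem i hin) /= hP hKi eqxx.
rewrite addrAC subrK lerD2l; apply: ler_sum => j _.
by case: ifP => // _; rewrite gerBl.
Qed.

Lemma sum_selection_extract S K red f k y :
  (forall i, i < n -> K i = i -> K (hd (f i)) = i) -> k < n -> K k = k ->
  (\sum_(i <- iota 0 n | K i == i)
      (if K (hd (f i)) == k then red (f i) - y else red (f i)) + y =
   \sum_(i <- iota 0 n | K i == i) red (f i))%R.
Proof.
move=> hf hk Kk.
have hin : k \in iota 0 n by rewrite mem_iota.
rewrite !(big_rem k hin) /= Kk eqxx hf // eqxx addrAC subrK; congr (_ + _)%R.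
rewrite [LHS]big_seq_cond [RHS]big_seq_cond; apply: eq_bigr => j.
rewrite (mem_rem_uniq _ (iota_uniq _ _)) inE mem_iota /=.
case/andP => /andP[hjk hj] /eqP Kj.
by rewrite hf // (negbTE hjk).
Qed.

(** For a loop [cycle_selected] is vacuous, so liftability holds without a candidate; this also ends
    the contraction of a cycle. *)
Lemma inv_drop S K W ch red D H log ca :
  inv S K W ch red D H log ca -> S (tl ca) = S (hd ca) ->
  inv S K W ch red D H log 0.
Proof.
move=> [p hc hlb hl hf hr hh ha hg hcand] e; split => //.
- move=> f h1 h2 _; apply: hl => // _ _ []; exact: e.
- move=> a /[dup] ha' /ha [?|?|?|->]; first by constructor 1.
  + by constructor 2.
  + by constructor 3.
  + by constructor 2.
Qed.

(** Both bounds grow by the subtracted minimum. A fresh candidate imposes no obligation yet, since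
    lifting was unconditional before, and its own reduced weight is now 0. *)
Lemma inv_extract S K W ch red D H log k x H' :
  inv S K W ch red D H log 0 -> k < n -> K k = k -> ch k = 0 ->
  x \in H k -> (forall a, a \in H k -> (red x <= red a)%R) ->
  (forall j, j != k -> H' j = H j) ->
  (forall a, (a \in H k) = (a == x) || (a \in H' k)) ->
  inv S K W ch (fun a => if K (hd a) == k then (red a - red x)%R else red a)
    (D + red x)%R H' log x.
Proof.
move=> [p hc hlb hl hf hr hh ha hg hcand] hk Kk ck hx hmin hH' hH'k.
have [arcx Kx hx0] := hh _ _ hk Kk hx.
split => //.
- move=> g hsel; apply: le_trans (hlb g hsel); rewrite -addrA lerD2l addrC.
  exact: (sum_nonloop_extract red p hc hsel hk Kk hx0).
- move=> f h1 h2 _; have [|h3 h4] := hl f h1 h2; first by [].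
  split => //; rewrite h4 -addrA; congr (_ + _)%R.
  rewrite addrC; apply/esym/sum_selection_extract => // i hi Ki.
  by case: (h2.1 _ hi Ki).
- case: hf => ht hS hf; exists ht => // j hj Kj cj.
  have [h1 h2 h3 h4] := hf _ hj Kj cj; split => //.
  rewrite h2; case: eqP => // e; by rewrite e ck in cj.
- move=> j a hj Kj haj.
  have hin : a \in H j.
    case: (eqVneq j k) haj => [->|h]; last by rewrite hH'.
    by rewrite hH'k => ->; rewrite orbT.
  have [h1 h2 h3] := hh _ _ hj Kj hin; split => //.
  rewrite h2; case: eqP => // e; rewrite subr_ge0; apply: hmin; by rewrite -e.
- move=> a arca; case: (ha a arca) => [h|h|h|h].
  + case: (eqVneq (K (hd a)) k) h => [e|hne] h; last by (constructor 1; rewrite hH').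
    move: h; rewrite e hH'k => /orP[/eqP ->|h]; [by constructor 4|by constructor 1].
  + by constructor 2.
  + by constructor 3.
  + by move: arca; rewrite h.
- move=> a arca hne; case: eqP => [e|_]; last exact: hg.
  rewrite subr_ge0; case: (ha a arca) => [h|h|h|h].
  + by apply: hmin; rewrite -e.
  + by [].
  + by move: arca; rewrite h e ck.
  + by move: arca; rewrite h.
- move=> _; rewrite Kx eqxx subrr ck; by split.
Qed.

(** The head of the candidate is the uncovered root of its component. Choosing the arc hangs this
    component below the tail, and the root of the other component remains the only one. *)
Lemma inv_choose S K W ch red D H log ca c r :
  inv S K W ch red D H log ca -> ca != 0 ->
  (c = W (tl ca) /\ r = W (hd ca)) \/ (c = W (hd ca) /\ r = W (tl ca)) ->
  W (tl ca) <> W (hd ca) ->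
  inv S K (join W c r) (fun i => if i == K (hd ca) then ca else ch i) red D H
    log 0.
Proof.
move=> [p hc hlb hl hf hr hh ha hg hcand] hca hcr hW.
have [arcca redca chca] := hcand hca.
set ch' := fun i => _.
have hhd : hd ca <= n := ltnW (hd_lt ca).
have hS : S (tl ca) <> S (hd ca).
  by move=> e; apply: hW; have [_ ->] := eq_SK p (tl_le ca) hhd e.
have hcr' : c != r by apply/eqP => e; apply: hW; case: hcr => -[<- <-].
have joinE i j : join W c r i = join W c r j <->
   (W i = W j \/ (W i = W (tl ca) /\ W j = W (hd ca)) \/
    (W i = W (hd ca) /\ W j = W (tl ca))).
  move/eqP: hcr' => hcr'; rewrite /join.
  by case: hcr => -[<- <-]; case: (W i =P c) => hi; case: (W j =P c) => hj;
    split; intuition congruence.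
have Kca : K (K (hd ca)) = K (hd ca) by rewrite (K_idem p).
have cov' y : y <= n -> ~~ covered S K ch' y -> ~~ covered S K ch y.
  move=> hy; rewrite /covered /ch' /=; case: (K y =P _) => [->|//].
  by rewrite chca.
split => //.
- by case: p => q1 q2 q3 q4 q5 q6 q7 q8 q9; split => // i hi; rewrite /join q9.
- move=> f h1 h2 _; apply: hl => //.
    move=> i hi hKi; rewrite h1 // /ch'; case: eqP => // e.
    by case: hKi; rewrite e.
- case: hf => ht hhtS hf.
  (* Raising the whole component of the head by more than the height of the tail preserves the
     comparisons inside it and makes the new arc ascend. *)
  exists (fun y => ht y + (if W y == W (hd ca) then (ht (tl ca)).+1 else 0)).
    by move=> i hi; rewrite hhtS // (W_S p).
  move=> k hk Kk; rewrite /ch'; case: (k =P K (hd ca)) => [e|ne] ck.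
    split => //; split => //; first by apply/joinE; right; left.
    rewrite eqxx; by case: (W (tl ca) =P W (hd ca)) => // _; lia.
  have [h1 h2 h3 [h4 h5 h6]] := hf _ hk Kk ck; split => //; split => //.
    by apply/joinE; left.
  by rewrite h5; lia.
- move=> y z hy hz hyz hcy hcz.
  have hcy0 := cov' _ hy hcy; have hcz0 := cov' _ hz hcz.
  (* The only uncovered supernode in the component of the head was the head itself, and it is
     covered now. *)
  have nohd u : u <= n -> ~~ covered S K ch' u -> W u <> W (hd ca).
    move=> hu hcu e; have := hr u (hd ca) hu hhd e (cov' _ hu hcu) _.
    rewrite /covered chca eqxx => /(_ isT) e2.
    have [e3 _] := eq_SK p hu hhd e2.
    by move: hcu; rewrite /covered /ch' e3 eqxx hca e2 eqxx.
  case/joinE: hyz => [e|[[_ e]|[e _]]]; first exact: hr.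
    by case: (nohd z).
  by case: (nohd y).
- move=> a arca; case: (ha a arca) => [h|h|h|h].
  + by constructor 1.
  + by constructor 2.
  + rewrite /ch'; case: eqP => [e|_]; last by constructor 3.
    by move: arca; rewrite h e chca.
  + by constructor 3; rewrite h /ch' eqxx.
Qed.

Definition pair_of (c r a b : nat) := (c = a /\ r = b) \/ (c = b /\ r = a).

Lemma join_eqP S c r a b i j : pair_of c r a b -> a <> b ->
  join S c r i = join S c r j <->
  (S i = S j \/ (S i = a /\ S j = b) \/ (S i = b /\ S j = a)).
Proof.
move=> hcr hab; rewrite /join.
by case: hcr => -[-> ->]; case: (S i =P _) => hi; case: (S j =P _) => hj;
  split; intuition congruence.
Qed.

Lemma join_out S c r a b i : pair_of c r a b -> S i <> a -> S i <> b ->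
  join S c r i = S i.
Proof. by rewrite /join => -[[-> _]|[-> _]] ha hb; case: eqP. Qed.

Lemma join_in S c r a b i : pair_of c r a b -> S i = a \/ S i = b ->
  join S c r i = r.
Proof.
rewrite /join => -[[-> ->]|[-> ->]] [->|->]; rewrite ?eqxx //; by case: eqP.
Qed.

Lemma join_inv S c r a b i z : pair_of c r a b -> join S c r i = z -> z <> r ->
  S i = z.
Proof.
by rewrite /join => _; case: (S i =P c) => // _ <-.
Qed.

(** * One contraction step: merging the ends of the candidate and their classes *)

Section Merge.
Variables (S K W ch : nat -> nat) (red : nat -> R) (D : R).
Variables (H : nat -> seq nat) (log : seq entry) (ca : nat).
Variables (c r chd rt : nat) (H' : nat -> seq nat).
Hypothesis I : inv S K W ch red D H log ca.
Hypothesis ca_n0 : ca != 0.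
Hypothesis Sne : S (tl ca) <> S (hd ca).
Hypothesis Weq : W (tl ca) = W (hd ca).

Let x := tl ca.
Let v := hd ca.
Let k := K v.
Let q := K x.
Let b := ch q.

(** The head is uncovered, as its class has no chosen arc. Since the component has only one
    uncovered supernode, the tail is covered by some chosen arc [b], and its class is another
    one. *)
Lemma candidate_tail :
  [/\ q < n, b != 0, S (hd b) = S x, q <> k & x < n].
Proof.
have p := i_parts I; have [arcca redca chca] := i_cand I ca_n0.
have hv : v <= n := ltnW (hd_lt ca).
have cx : covered S K ch x.
  apply: contrapT => /negP hx; apply: Sne; apply: (i_root I) => //.
  by rewrite /covered chca.
case/andP: cx => b0 /eqP hb.
have hqk : q <> k by rewrite /k => e; move: b0; rewrite -/q e chca.
have hqn : q < n.
  have [e _] := eq_SK p (ltnW (hd_lt b)) (tl_le ca) hb; rewrite /q /x -e.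
  exact: (K_lt p).
split => //; rewrite ltn_neqAle tl_le andbT; apply/eqP => e.
by move: hqn; rewrite /q e (K_n p) ltnn.
Qed.

Hypothesis hcr : pair_of c r (S x) (S v).
Hypothesis hkq : pair_of chd rt q k.
Hypothesis hH' : forall j, j <> chd -> j <> rt -> H' j = H j.
Hypothesis hH'rt : forall a, (a \in H' rt) = (a \in H chd) || (a \in H rt).

Let S' := join S c r.
Let K' := join K chd rt.
Let ch1 := fun i => if i == k then ca else ch i.
Let ch' := fun i => if i == rt then 0 else ch1 i.

Let p : parts S K W := i_parts I.
Let hv : v < n := hd_lt ca.
Let hx : x < n. Proof. by have [] := candidate_tail. Qed.
Let hq : q < n. Proof. by have [] := candidate_tail. Qed.
Let qk : q <> k. Proof. by have [] := candidate_tail. Qed.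
Let hk : k < n. Proof. exact: (K_lt p). Qed.
Let Kk : K k = k. Proof. exact: (K_idem p (ltnW hv)). Qed.
Let Kq : K q = q. Proof. exact: (K_idem p (ltnW hx)). Qed.
Let b0 : b != 0. Proof. by have [] := candidate_tail. Qed.
Let Shb : S (hd b) = S x. Proof. by have [] := candidate_tail. Qed.
Let Khb : K (hd b) = q.
Proof. by have [-> _] := eq_SK p (ltnW (hd_lt b)) (ltnW hx) Shb. Qed.
Let chk : ch k = 0. Proof. by have [] := i_cand I ca_n0. Qed.
Let rtn : rt < n. Proof. by case: hkq => -[_ ->]. Qed.
Let chdn : chd < n. Proof. by case: hkq => -[-> _]. Qed.
Let Krt : K rt = rt. Proof. by case: hkq => -[_ ->]. Qed.
Let Kchd : K chd = chd. Proof. by case: hkq => -[-> _]. Qed.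
Let chdrt : chd <> rt.
Proof. by case: hkq => -[-> ->] e; apply: qk. Qed.
Let inkq z : z = q \/ z = k <-> z = chd \/ z = rt.
Proof. by case: hkq => -[-> ->]; intuition. Qed.

Let KinZ y : y <= n -> S y = S x \/ S y = S v -> K y = q \/ K y = k.
Proof.
move=> hy [e|e]; [left|right].
  by have [] := eq_SK p hy (ltnW hx) e.
by have [] := eq_SK p hy (ltnW hv) e.
Qed.

Let K'in y : K y = q \/ K y = k -> K' y = rt.
Proof. exact: join_in hkq. Qed.

Let K'out y : K y <> q -> K y <> k -> K' y = K y.
Proof. exact: join_out hkq. Qed.

Let S'eqP y z : S' y = S' z <->
  (S y = S z \/ (S y = S x /\ S z = S v) \/ (S y = S v /\ S z = S x)).
Proof. exact: join_eqP hcr _. Qed.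

Let S'in y : S' y = S' x <-> S y = S x \/ S y = S v.
Proof. by rewrite S'eqP; intuition congruence. Qed.

Let repsP z : z < n -> K' z = z -> z <> chd /\ (z = rt \/ [/\ z <> q, z <> k & K z = z]).
Proof.
move=> hz; rewrite /K' /join; case: (K z =P chd) => [e <-|ne e].
  by split; [exact/nesym|left].
split; first by move=> e2; apply: ne; rewrite e2.
case: (z =P rt) => hzr; [by left|right].
have [h1 h2] : z <> q /\ z <> k.
  by apply/not_orP => /inkq [h|//]; apply: ne; rewrite h.
by split.
Qed.

Lemma merge_parts : parts S' K' W.
Proof.
have hr : r < n by case: hcr => -[_ ->]; apply: (S_lt p).
have Sr : S r = r by case: hcr => -[_ ->]; apply: (S_idem p); exact: ltnW.
have cr : c <> r by case: hcr => -[-> ->] e; apply: Sne.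
have Kcr : K c = q /\ K r = k \/ K c = k /\ K r = q.
  by case: hcr => -[-> ->]; rewrite !(K_S p) ?(ltnW hx) ?(ltnW hv) //; [left|right].
have Wcr : W c = W r.
  by case: hcr => -[-> ->]; rewrite !(W_S p) ?(ltnW hx) ?(ltnW hv).
split.
- by move=> i hi; rewrite /S' /join; case: eqP => // _; exact: (S_lt p).
- move=> i hi; rewrite /S' /join; case: (S i =P c) => [_|ne].
    by rewrite Sr; case: eqP.
  by rewrite (S_idem p) //; case: eqP.
- rewrite /S' /join (S_n p); case: eqP => // e.
  have hc : c < n by case: hcr => -[-> _]; apply: (S_lt p).
  by move: hc; rewrite -e ltnn.
- by move=> i hi; rewrite /K' /join; case: eqP => // _; exact: (K_lt p).
- move=> i hi; rewrite /K' /join; case: (K i =P chd) => [_|ne].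
    by rewrite Krt; case: eqP.
  by rewrite (K_idem p) //; case: eqP.
- rewrite /K' /join (K_n p); case: eqP => // e.
  by move: chdn; rewrite -e ltnn.
- move=> i hi; rewrite /S' /join; case: (S i =P c) => [e|_]; last first.
    by rewrite /K' /join (K_S p).
  have e2 : K i = K c.
    by rewrite -(K_S p hi) e.
  have hKr : K r = q \/ K r = k by case: Kcr => -[_ ->]; auto.
  have hKi : K i = q \/ K i = k by rewrite e2; case: Kcr => -[-> _]; auto.
  by rewrite (K'in hKr) (K'in hKi).
- by move=> i hi; rewrite /K' /join (K_K0 p).
- move=> i hi; rewrite /S' /join; case: (S i =P c) => [e|_].
    by rewrite -(W_S p hi) e.
  by rewrite (W_S p).
Qed.

(** Add the equations of the two classes: nodes and colors add up, while one representative of a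
    supernode, [c], disappears, which turns the sum of two ones into a single one. *)
Lemma merge_counted : counted S' K'.
Proof.
have hc : c < n by case: hcr => -[-> _]; apply: (S_lt p).
have Sc : S c = c by case: hcr => -[-> _]; apply: (S_idem p); exact: ltnW.
have cr : c <> r by case: hcr => -[-> ->] e; apply: Sne.
have hC := i_count I.
have Kc : K c = q \/ K c = k.
  by case: hcr => -[-> _]; rewrite (K_S p) ?(ltnW hx) ?(ltnW hv) //; [left|right].
move=> z hz /(repsP hz) [zchd [->|[zq zk Kz]]]; last first.
  have eK i : (K' i == z) = (K i == z).
    apply/eqP/eqP => [e|e].
      by apply: (join_inv hkq e); case: hkq => -[_ ->].
    by rewrite K'out // e.
  have e1 : ncount n (fun i => K' i == z) = ncount n (fun i => K i == z).
    by apply: eq_ncount.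
  have e2 : ncount n (fun i => (K0 i == i) && (K' i == z)) =
            ncount n (fun i => (K0 i == i) && (K i == z)).
    by apply: eq_ncount => i _; rewrite eK.
  have e3 : ncount n (fun i => (S' i == i) && (K' i == z)) =
            ncount n (fun i => (S i == i) && (K i == z)).
    apply: eq_ncount => i hi; rewrite eK; case: (K i =P z) => e; rewrite ?andbF //.
    rewrite /S' /join; case: (S i =P c) => // e4; exfalso.
    have : K i = K c by rewrite -(K_S p (ltnW hi)) e4.
    by rewrite e => e5; case: Kc; rewrite -e5.
  by rewrite e1 e2 e3; exact: hC.
have eK i : ((K' i == rt) = (K i == chd) + (K i == rt) :> nat).
  rewrite /K' /join; case: (K i =P chd) => [->|_] //.
  by rewrite eqxx; case: eqP => // e; case: chdrt.
have e1 : ncount n (fun i => K' i == rt) =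
   ncount n (fun i => K i == chd) + ncount n (fun i => K i == rt).
  by apply: ncount_add => i _; rewrite eK.
have e2 : ncount n (fun i => (K0 i == i) && (K' i == rt)) =
   ncount n (fun i => (K0 i == i) && (K i == chd)) +
   ncount n (fun i => (K0 i == i) && (K i == rt)).
  by apply: ncount_add => i _; case: (K0 i == i) => //; rewrite eK.
have e3 : ncount n (fun i => (S i == i) && ((K i == chd) || (K i == rt))) =
   ncount n (fun i => (S' i == i) && (K' i == rt)) + ncount n (fun i => i == c).
  apply: ncount_add => i hi.
  have -> : (K' i == rt) = (K i == chd) || (K i == rt).
    by move: (eK i); case: (K' i == rt); case: (K i == chd); case: (K i == rt).
  rewrite /S' /join; case: (i =P c) => [->|ne].
    rewrite Sc eqxx /=; case: (r =P c) => [e|_]; first by case: cr.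
    by case/inkq: Kc => ->; rewrite eqxx ?orbT.
  case: (S i =P c) => [e|_]; last by rewrite addn0.
  rewrite e; case: (c =P i) => [e5|_]; first by case: ne.
  case: (r =P i) => [e5|//]; case: cr.
  by rewrite -e -e5; case: hcr => -[_ ->]; rewrite (S_idem p) // ltnW.
have e4 : ncount n (fun i => (S i == i) && ((K i == chd) || (K i == rt))) =
   ncount n (fun i => (S i == i) && (K i == chd)) +
   ncount n (fun i => (S i == i) && (K i == rt)).
  apply: ncount_add => i _; case: (S i == i) => //=.
  case: (K i =P chd) => [->|_] //=; case: eqP => // e; by case: chdrt.
have := hC _ chdn Kchd; have := hC _ rtn Krt.
rewrite ncount1 // in e3; lia.
Qed.

Let S'S y z : S y = S z -> S' y = S' z.
Proof. by move=> e; rewrite /S' /join e. Qed.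

(** Merging supernodes can only turn arcs into loops, and the terms lost were nonnegative until
    now. *)
Lemma merge_lower_bound : lower_bound S' red D.
Proof.
move=> g hg; apply: le_trans (i_lb I hg); rewrite lerD2l.
rewrite [leLHS]big_mkcond [leRHS]big_mkcond [leLHS]big_seq [leRHS]big_seq.
apply: ler_sum => i.
rewrite mem_iota /= => hi; case: (K0 i =P i) => //= Ki.
case: (S' _ =P _) => h1 /=; case: (S _ =P _) => h2 //=.
  by apply: (i_ge0 I) => //; case: (hg.1 i hi Ki).
by case: h1; exact: S'S.
Qed.

(** The merged supernode takes the smaller of the two heights. This is safe for chosen arcs leaving
    it, and none enters it, because the merged class has lost its choice. *)
Lemma merge_forest : forest S' K' W ch' red.
Proof.
case: (i_forest I) => ht htS hf.
exists (fun y => if S' y == S' x then minn (ht x) (ht v) else ht y).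
  move=> i hi; have -> : S' (S' i) = S' i.
    exact: (S_idem merge_parts).
  case: (S' i =P S' x) => // ne.
  have -> : S' i = S i.
    by apply: join_out hcr _ _ => e; apply: ne; apply/S'in; [left|right].
  exact: htS.
move=> z hz /(repsP hz) [zchd hz']; rewrite /ch'.
case: hz' => [->|[zq zk Kz]]; first by rewrite eqxx.
case: (z =P rt) => // zrt; rewrite /ch1; case: (z =P k) => // _ cz.
have [h1 h2 h3 [h4 h5 h6]] := hf z hz Kz cz.
have hhd : S' (hd (ch z)) <> S' x.
  by move=> /S'in /(KinZ (ltnW (hd_lt _))); rewrite h2 => -[].
split => //; first by rewrite K'out ?h2.
split => //.
  case/S'eqP => [//|[[_ e]|[e1 e2]]]; apply: hhd; apply/S'in; auto.
case: (S' (hd _) =P _) => // _; case: (S' (tl _) =P _) => // /S'in e.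
apply: leq_ltn_trans h6; case: e => e.
  by rewrite -(htS _ (tl_le (ch z))) e htS ?(ltnW hx) // geq_minl.
by rewrite -(htS _ (tl_le (ch z))) e htS ?(ltnW hv) // geq_minr.
Qed.

(** The merged supernode succeeds the head as the uncovered root of the component; dropping [b]
    uncovers no supernode other than that of the tail, which is part of it. *)
Lemma merge_root y z : y <= n -> z <= n -> W y = W z ->
    ~~ covered S' K' ch' y -> ~~ covered S' K' ch' z -> S' y = S' z.
Proof.
have key u : u <= n -> ~~ covered S' K' ch' u -> S' u <> S' x ->
    ~~ covered S K ch u.
  move=> hu hcu hne; apply: contra hcu => /andP[h1 /eqP h2].
  case: (K u =P k) => [e|uk]; first by rewrite e chk in h1.
  case: (K u =P q) => [e|uq].
    by case: hne; apply/S'in; left; rewrite -h2 e.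
  rewrite /covered (K'out uq uk) /ch'.
  have -> : (K u == rt) = false by apply/eqP => e; case: (inkq (K u)) => _ []; auto.
  rewrite /ch1; have -> : (K u == k) = false by apply/eqP.
  by rewrite h1 /=; apply/eqP; exact: S'S.
have uv : ~~ covered S K ch v by rewrite /covered chk.
have mixed u t : u <= n -> t <= n -> W u = W t -> S' u = S' x -> S' t <> S' x ->
    ~~ covered S' K' ch' t -> False.
  move=> hu ht hW /S'in hSu hSt hct; apply: (hSt); apply/S'in; right.
  apply: (i_root I) => //; [exact: ltnW|rewrite -hW|exact: key].
  case: hSu => e; first by have [_ ->] := eq_SK p hu (ltnW hx) e.
  by have [_ ->] := eq_SK p hu (ltnW hv) e.
move=> hy hz hW cy cz.
case: (S' y =P S' x) => ey; case: (S' z =P S' x) => ez.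
- by rewrite ey ez.
- by case: (mixed y z).
- by case: (mixed z y).
- by apply: S'S; apply: (i_root I) => //; exact: key.
Qed.


Lemma rooted_eq S1 K1 W1 f y z : parts S1 K1 W1 -> y <= n -> z <= n ->
  S1 y = S1 z -> rooted S1 K1 f y -> rooted S1 K1 f z.
Proof.
move=> p1 hy hz e h; have [eK _] := eq_SK p1 hy hz e.
case: h e eK => {y hy} y h1 => [|h2] e eK.
  by apply: Rooted_top; rewrite -e -eK.
by apply: Rooted_step; rewrite -?e -eK.
Qed.

(** * Lifting a selection through one merge *)

Section Lift.
Variable f : nat -> nat.
Hypothesis f_ch : forall i, i < n -> K' i <> i -> f i = ch' i.
Hypothesis f_sel : selection S' K' f.
Hypothesis f_cycle : cycle_selected S' K' W ch' b f.

Let e := f rt.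
Let f1 := undo (Entry K chd rt (ch1 rt)) f.

Let K'rt : K' rt = rt.
Proof. by apply: K'in; apply/inkq; right. Qed.

Let Khe : K (hd e) = q \/ K (hd e) = k.
Proof.
have [_ h] := f_sel.1 _ rtn K'rt; apply/inkq.
move: h; rewrite -/e /K' /join; case: (K _ =P chd) => [h _|_ h]; auto.
Qed.

(** A description of the undone selection that no longer depends on which of [q] and [k] became the
    child. *)
Let f1_in z : z = q \/ z = k -> f1 z = if K (hd e) == z then e else ch1 z.
Proof.
have hf : f chd = ch1 chd.
  rewrite f_ch //.
    by rewrite /ch'; case: (chd =P rt).
  by rewrite K'in; [exact/nesym|apply/inkq; left].
move=> /inkq hz; rewrite /f1 /undo /= -/e.
have /inkq he := Khe.
case: (K (hd e) =P chd) => h1.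
  case: hz => ->; first by rewrite eqxx h1 eqxx.
  case: (rt =P chd) => [h|_]; first by case: chdrt.
  by rewrite eqxx; case: (_ =P rt) => // h2; case: chdrt; rewrite -h1.
have h2 : K (hd e) = rt by case: he.
by case: hz => ->; case: (_ =P _) => // h3; case: chdrt; rewrite -h3.
Qed.

Let f1_out z : z <> q -> z <> k -> f1 z = f z.
Proof.
move=> h1 h2; rewrite /f1 /undo /=; case: ifP => // _.
have hz : ~ (z = chd \/ z = rt) by move=> /inkq [].
case: (z =P chd) => [h|_]; first by case: hz; left.
by case: (z =P rt) => [h|_] //; case: hz; right.
Qed.

Let ch1q : ch1 q = b.
Proof. by rewrite /ch1; case: (q =P k). Qed.
Let ch1k : ch1 k = ca.
Proof. by rewrite /ch1 eqxx. Qed.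

Let chosen_b : exists2 ht : nat -> nat, (forall i, i <= n -> ht (S i) = ht i) &
  [/\ arc b, red b = 0%R, S (tl b) <> S x, W (tl b) = W x & ht (tl b) < ht x /\
  forall z, z < n -> K z = z -> ch z != 0 -> ht (tl (ch z)) < ht (hd (ch z))].
Proof.
case: (i_forest I) => ht htS hf; exists ht => //.
have [h1 h2 h3 [h4 h5 h6]] := hf _ hq Kq b0.
have [_ hW] := eq_SK p (ltnW (hd_lt b)) (ltnW hx) Shb.
split => //; rewrite -?Shb -?hW //; split.
  by rewrite -(htS x) ?(ltnW hx) // -Shb htS // ltnW.
by move=> z hz Kz cz; have [_ _ _ []] := hf z hz Kz cz.
Qed.

Let f1_class z : z < n -> K z = z -> arc (f1 z) /\ K (hd (f1 z)) = z.
Proof.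
move=> hz Kz; have [ht htS [ab _ _ _ _]] := chosen_b.
have [aca _ _] := i_cand I ca_n0.
case: (z =P q) => [->|zq].
  rewrite f1_in; last by left.
  case: eqP => [h|_]; first by have [h1 _] := f_sel.1 _ rtn K'rt.
  by rewrite ch1q.
case: (z =P k) => [->|zk].
  rewrite f1_in; last by right.
  case: eqP => [h|_]; first by have [h1 _] := f_sel.1 _ rtn K'rt.
  by rewrite ch1k.
rewrite f1_out //; have [|h1 h2] := f_sel.1 z hz; first by rewrite K'out ?Kz.
split => //; apply: (join_inv hkq h2) => h.
by have [_ /(_ (or_intror h)) []] := inkq z.
Qed.

(** In the merged graph the walk may end at [x] or at [v]. Heights decrease along it and it starts
    below [x], so it ends at [v]. *)
Let on_cycle_lift ht y : (forall i, i <= n -> ht (S i) = ht i) ->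
  (forall z, z < n -> K z = z -> ch z != 0 -> ht (tl (ch z)) < ht (hd (ch z))) ->
  on_cycle S' K' ch' f (hd b) y -> y <= n -> ht y < ht x ->
  on_cycle S K ch f1 v y.
Proof.
move=> htS hf; elim=> {}y => [h hy hlt|h1 h2 h3 _ IH hy hlt].
  have /S'in [h'|h'] : S' y = S' x by rewrite h; apply: S'S.
    by move: hlt; rewrite -(htS y) // h' htS ?ltnn // ltnW.
  exact: Cycle_end.
have yrt : K' y <> rt by move=> h; move: h2; rewrite h /ch' eqxx.
have [yq yk] : K y <> q /\ K y <> k.
  by apply/not_orP => /K'in.
have eK := K'out yq yk.
have ech : ch' (K' y) = ch (K y).
  rewrite eK /ch' /ch1; case: (K y =P rt) => [h|_]; last by case: (K y =P k).
  by case: yrt; rewrite eK.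
rewrite ech in h1 h2 h3 IH.
have h3' : S (hd (ch (K y))) = S y.
  case/S'eqP: h3 => [//|[[_ h]|[_ h]]]; exfalso;
  by have /(KinZ hy) [] : S y = S x \/ S y = S v by rewrite h; auto.
have hyn : K y < n.
  apply: (K_lt p); rewrite ltn_neqAle hy andbT; apply/eqP => h.
  by move: h3'; rewrite h (S_n p) => h4; have := S_lt p (hd_lt (ch (K n)));
     rewrite h4 ltnn.
have hlt' := hf _ hyn (K_idem p hy) h2.
apply: Cycle_step => //; first by rewrite f1_out // -h1 eK.
apply: IH => //; apply: leq_ltn_trans hlt.
by apply: ltnW; apply: leq_trans hlt' _; rewrite -(htS (hd _)) ?h3' ?htS // ltnW.
Qed.

(** When [e] serves [k], the class [q] takes [b] back, and the walk from [x] must be shown to reach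
    [v]. If [tl b] is not in the merged supernode yet, the restriction on [f] applies; its first
    alternative would make [e] equal to [b], which enters [q]. *)
Let f1_cycle_tail : K (hd e) = k -> on_cycle S K ch f1 v x.
Proof.
move=> he; have [ht htS [_ _ h1 h2 [h3 h4]]] := chosen_b.
have f1q : f1 q = b.
  by rewrite f1_in ?he; [case: (k =P q) => // h; case: qk|left].
apply: Cycle_step => //.
case: (S' (tl b) =P S' (hd b)) => hb.
  have /S'in [//|h] : S' (tl b) = S' x by rewrite hb; apply: S'S.
  exact: Cycle_end.
case: (f_cycle b0 _ hb) => [|h|].
- by rewrite h2; have [_ ->] := eq_SK p (ltnW (hd_lt b)) (ltnW hx) Shb.
- exfalso; move: h; rewrite K'in; last by left.
  by rewrite -/e => h; apply: qk; rewrite -he h Khb.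
- by move=> h; apply: (on_cycle_lift htS h4 h).
Qed.

Let rooted_on_cycle y : on_cycle S K ch f1 v y -> y <= n ->
  rooted S K f1 v -> rooted S K f1 y.
Proof.
move=> h hy hv'; elim: h hy => {}y => [h|h1 h2 h3 _ IH] hy.
  by apply: (rooted_eq p) hv' => //; exact: ltnW.
by apply: Rooted_step; rewrite h1 //; apply: IH.
Qed.

(** The part served by [e] inherits the backward walks of [f]. The other part hangs on it, either by
    [ca] from [x] to [v] or by the chosen arcs leading from [v] to [x]. Outside the merged supernode
    the walks are those of [f]. *)
Let f1_rooted y : y <= n -> rooted S K f1 y.
Proof.
move=> hy; have hr := f_sel.2 _ hy.
have inZ z : z <= n -> S' z = S' x ->
   (S' (hd (f (K' z))) = S' z -> rooted S K f1 (tl (f (K' z)))) ->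
   rooted S K f1 z.
  move=> hz hzx hstep.
  have Kz : K' z = rt by apply: K'in; apply: KinZ => //; apply/S'in.
  rewrite Kz -/e hzx in hstep.
  have start u : u <= n -> S' u = S' x -> f1 (K u) = e -> rooted S K f1 u.
    move=> hu hux hf1; case: (S (hd e) =P S u) => h.
      by apply: Rooted_step; rewrite hf1 //; apply: hstep; rewrite -hux; apply: S'S.
    by apply: Rooted_top; rewrite hf1.
  have S'v : S' v = S' x by apply/S'in; right.
  have [rx rv] : rooted S K f1 x /\ rooted S K f1 v.
    case: Khe => he.
      have rx : rooted S K f1 x.
        apply: start => //; first exact: ltnW.
        by rewrite f1_in ?he ?eqxx //; left.
      split => //; have fk : f1 (K v) = ca.
        by rewrite f1_in ?he; [case: (q =P K v)|right].
      by apply: Rooted_step; rewrite fk.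
    have rv : rooted S K f1 v.
      apply: start => //; first exact: ltnW.
      by rewrite f1_in ?he ?eqxx //; right.
    split => //; apply: rooted_on_cycle => //; last exact: ltnW.
    exact: f1_cycle_tail.
  case/S'in: hzx => h.
    by apply: (rooted_eq p) rx => //; exact: ltnW.
  by apply: (rooted_eq p) rv => //; exact: ltnW.
have outZ z : z <= n -> S' z <> S' x ->
   (S' (hd (f (K' z))) = S' z -> rooted S K f1 (tl (f (K' z)))) ->
   rooted S K f1 z.
  move=> hz hzx hstep.
  case: (S (hd (f1 (K z))) =P S z) => h; last exact: Rooted_top.
  have hf : f1 (K z) = f (K' z).
    case: (K z =P q) => [hq'|zq].
      move: h; rewrite K'in ?hq'; last by left.
      rewrite f1_in; last by left.
      case: eqP => // _; rewrite ch1q Shb => h; case: hzx; apply/S'in; auto.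
    case: (K z =P k) => [hk'|zk].
      move: h; rewrite K'in ?hk'; last by right.
      rewrite f1_in; last by right.
      case: eqP => // _; rewrite ch1k => h; case: hzx; apply/S'in; auto.
    by rewrite f1_out // K'out.
  apply: Rooted_step => //; rewrite hf; apply: hstep; rewrite -hf.
  exact: S'S.
elim: hr hy => {}y => [h|h _ IH] hy.
  by case: (S' y =P S' x) => hyx; [apply: inZ|apply: outZ].
by case: (S' y =P S' x) => hyx; [apply: inZ|apply: outZ] => // _; apply: IH.
Qed.

Lemma lift_selection : selection S K f1.
Proof. by split; [exact: f1_class|exact: f1_rooted]. Qed.

Lemma lift_cycle_selected : cycle_selected S K W ch ca f1.
Proof.
move=> _ _ _; case: Khe => he; [left|right; exact: f1_cycle_tail].
rewrite f1_in; last by right.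
by rewrite he; case: (q =P K (hd ca)).
Qed.

(** One part keeps the arc [e] of the merged class; the other one takes [ca] or [b], both of reduced
    weight 0. *)
Lemma lift_sum : (\sum_(i <- iota 0 n | K i == i) red (f1 i) =
  \sum_(i <- iota 0 n | K' i == i) red (f i))%R.
Proof.
have [ht htS [_ redb _ _ _]] := chosen_b.
have [_ redca _] := i_cand I ca_n0.
have inn z : z < n -> z \in iota 0 n by rewrite mem_iota.
rewrite (big_rem chd (inn _ chdn)) Kchd eqxx /=.
have hin : rt \in rem chd (iota 0 n).
  rewrite (mem_rem_uniq _ (iota_uniq _ _)) inE inn // andbT.
  by apply/eqP/nesym.
rewrite (big_rem rt hin) Krt eqxx /=.
rewrite [RHS](big_rem chd (inn _ chdn)) /=.
have -> : (K' chd == chd) = false.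
  by apply/eqP; rewrite K'in; [exact/nesym|apply/inkq; left].
rewrite (big_rem rt hin) K'rt eqxx /= add0r -/e addrA.
have -> : (red (f1 chd) + red (f1 rt) = red e)%R.
  rewrite !f1_in; [|by apply/inkq; right|by apply/inkq; left].
  have red1 z : z = q \/ z = k -> red (ch1 z) = 0%R.
    by case=> ->; rewrite ?ch1q ?ch1k.
  have /inkq [->|->] := Khe; rewrite eqxx.
    case: eqP => [h|_]; first by case: chdrt.
    by rewrite red1 ?addr0 //; apply/inkq; right.
  case: eqP => [h|_]; first by case: chdrt.
  by rewrite red1 ?add0r //; apply/inkq; left.
congr (_ + _)%R; rewrite [LHS]big_seq_cond [RHS]big_seq_cond.
have hmem i : i \in rem rt (rem chd (iota 0 n)) ->
    [/\ i < n, i <> q & i <> k].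
  rewrite (mem_rem_uniq _ (rem_uniq _ (iota_uniq _ _))) inE.
  rewrite (mem_rem_uniq _ (iota_uniq _ _)) inE mem_iota /=.
  case/and3P => /eqP h1 /eqP h2 hi.
  by have [h3 h4] : i <> q /\ i <> k by apply/not_orP => /inkq [].
apply: eq_big => i; last first.
  by case/andP => /hmem [_ h1 h2] _; rewrite f1_out.
case: (boolP (i \in _)) => //= /hmem [hi h1 h2].
apply/eqP/eqP => h; first by rewrite K'out ?h.
have [_ [h3|[_ _ //]]] := repsP hi h.
by have [_ /(_ (or_intror h3)) []] := inkq i.
Qed.

End Lift.

Lemma merge_liftable :
  liftable S' K' W ch' red D (Entry K chd rt (ch1 rt) :: log) b.
Proof.
move=> f h1 h2 h3.
have h1' : forall i, i < n -> K i <> i ->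
    undo (Entry K chd rt (ch1 rt)) f i = ch i.
  move=> i hi hKi.
  have [iq ik] : i <> q /\ i <> k by split=> h; case: hKi; rewrite h.
  have [ichd irt] : i <> chd /\ i <> rt by apply/not_orP => /inkq [].
  have hfi : f i = ch i.
    rewrite h1 //.
      by rewrite /ch' /ch1; case: (i =P rt) => // _; case: (i =P k).
    move=> h; have [_ [|[_ _]]] := repsP hi h; by [].
  rewrite /undo /=; case: ifP => // _.
  by case: (i =P chd) => // _; case: (i =P rt).
have [h4 h5] := i_lift I h1' (lift_selection h1 h2 h3) (lift_cycle_selected h1 h2 h3).
by split => //; rewrite h5 lift_sum.
Qed.

(** As [ch1] already records the candidate for [k], the arc [ch1 rt] is the right one to log
    whichever representative survives. *)
Lemma inv_merge :
  inv S' K' W ch' red D H' (Entry K chd rt (ch1 rt) :: log) b.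
Proof.
have K'rt : K' rt = rt by apply: K'in; apply/inkq; right.
split.
- exact: merge_parts.
- exact: merge_counted.
- exact: merge_lower_bound.
- exact: merge_liftable.
- exact: merge_forest.
- exact: merge_root.
- move=> z a hz /(repsP hz) [zchd [->|[zq zk Kz]]].
    rewrite hH'rt => /orP[h|h].
      have [h1 h2 h3] := i_heap I chdn Kchd h; split => //.
      by apply: K'in; rewrite h2; apply/inkq; left.
    have [h1 h2 h3] := i_heap I rtn Krt h; split => //.
    by apply: K'in; rewrite h2; apply/inkq; right.
  have [z1 z2] : z <> chd /\ z <> rt by apply/not_orP => /inkq [].
  rewrite hH' // => h; have [h1 h2 h3] := i_heap I hz Kz h.
  by split => //; rewrite K'out ?h2.
- move=> a arca; case: (i_arcs I arca) => h.
  + constructor 1.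
    have [hkq'|hout] := EM (K (hd a) = q \/ K (hd a) = k).
      rewrite K'in // hH'rt; case/inkq: hkq' h => -> ->; by rewrite ?orbT.
    have [h1 h2] : K (hd a) <> q /\ K (hd a) <> k by apply/not_orP.
    rewrite K'out // hH' // => h3; apply: hout; apply/inkq; auto.
  + by constructor 2; apply: S'S.
  + case: (K (hd a) =P k) => [h1|h1].
      by move: arca; rewrite h h1 chk.
    case: (K (hd a) =P q) => [h2|h2]; first by constructor 4; rewrite h h2.
    constructor 3; rewrite K'out // /ch' /ch1.
    case: (_ =P rt) => [h3|_]; last by case: (_ =P k).
    by have [_ /(_ (or_intror h3)) []] := inkq (K (hd a)).
  + by constructor 2; rewrite h; apply/S'eqP; right; left.
- by move=> a arca ha; apply: (i_ge0 I) => // h; apply: ha; apply: S'S.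
- have [ht htS hf] := i_forest I; have [h1 h2 h3 _] := hf _ hq Kq b0.
  move=> _; split => //; rewrite K'in; last by left.
  by rewrite /ch' eqxx.
Qed.

End Merge.

(** With all classes served, [ch] is itself a selection and all its reduced weights are 0. Its
    expansion weighs exactly [D], and no selection weighs less, because non-loop reduced weights are
    nonnegative. *)
Lemma inv_optimal S K W ch red D H log :
  inv S K W ch red D H log 0 ->
  (forall k, k < n -> K k = k -> ch k != 0) ->
  selection id K0 (expand log ch) /\
  forall g, selection id K0 g ->
    (\sum_(i <- iota 0 n | K0 i == i) w0 (expand log ch i) <=
     \sum_(i <- iota 0 n | K0 i == i) w0 (g i))%R.
Proof.
move=> I hch; have p := i_parts I; have [ht htS hf] := i_forest I.
have hsel : selection S K ch.
  split.
    by move=> k hk Kk; have [h1 h2 _ _] := hf k hk Kk (hch k hk Kk).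
  (* A backward walk descends in height, so induction on the height shows that it stops. *)
  move=> y; move: {2}(ht y) (leqnn (ht y)) => N.
  elim: N y => [|N IH] y hN hy;
    (case: (S (hd (ch (K y))) =P S y) => h; last exact: Rooted_top);
    (have hyn : y < n; first (rewrite ltn_neqAle hy andbT; apply/eqP => e;
      move: h; rewrite e (S_n p) => h4; have := S_lt p (hd_lt (ch (K n)));
      by rewrite h4 ltnn));
    have [_ _ _ [_ _ hlt]] := hf _ (K_lt p hyn) (K_idem p hy)
       (hch _ (K_lt p hyn) (K_idem p hy));
    rewrite -(htS (hd _)) ?h ?htS // in hlt; try exact: ltnW (hd_lt _).
    lia.
  apply: Rooted_step => //; apply: IH => //; lia.
have [h1 h2] := i_lift I (f := ch) (fun i _ _ => erefl) hsel (fun h => False_ind _ (negP h (eqxx _))).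
split => // g hg; rewrite h2; apply: le_trans (i_lb I hg).
rewrite lerD2l [leLHS]big_seq_cond big1 => [|i /andP[]].
  rewrite [leRHS]big_seq_cond; apply: sumr_ge0 => i; rewrite mem_iota /=.
  case/and3P => hi /eqP Ki /eqP hne; apply: (i_ge0 I) => //.
  by case: (hg.1 i hi Ki).
by rewrite mem_iota /= => hi /eqP Ki; have [_ _ -> _] := hf i hi Ki (hch i hi Ki).
Qed.

End Contraction.

(** * The main loop *)

Notation aTail := 10.
Notation aHead := 11.
Notation aParS := 12.
Notation aRkS := 13.
Notation aParW := 14.
Notation aRkW := 15.
Notation aParK := 16.
Notation aRkK := 17.
Notation aHeap := 18.
Notation aChosen := 19.
Notation aLogChild := 28.
Notation aLogArc := 29.
Notation vI := 30.
Notation vK := 32.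
Notation vCand := 33.
Notation vU := 34.
Notation vV := 35.
Notation vChild := 36.
Notation vRoot := 37.
Notation vT := 38.
Notation vQ := 40.
Notation vX := 41.
Notation vY := 42.
Notation vNext := 43.

Definition extract : cmd :=
  Seq (vCand <-- IGet aHeap (var vK))
  (Seq (vA <-- IGet aNext (left_slot (var vCand)))
  (Seq (vB <-- IGet aNext (right_slot (var vCand)))
  (Seq meld
       (IPut aHeap (var vK) (IGet aNext (IConst 0)))))).

Definition choose : cmd :=
  Seq (union aParW aRkW vChild vRoot (var vX) (var vY))
  (Seq (IPut aChosen (var vK) (var vCand))
       (vCand <-- IConst 0)).

(** The order matters: the candidate is stored before the classes are united, so that the cell of
    the new root holds the arc to be logged, and the old arc of [vQ] is saved in [vNext] because the
    reset of that cell may erase it. *)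
Definition contract : cmd :=
  Seq (find_root aParK vQ (IGet aTail (var vCand)))
  (Seq (union aParS aRkS vChild vRoot (var vU) (var vV))
  (Seq (IPut aChosen (var vK) (var vCand))
  (Seq (vNext <-- IGet aChosen (var vQ))
  (Seq (union aParK aRkK vChild vRoot (var vQ) (var vK))
  (Seq (IPut aLogChild (var vT) (var vChild))
  (Seq (IPut aLogArc (var vT) (IGet aChosen (var vRoot)))
  (Seq (IPut aChosen (var vRoot) (IConst 0))
  (Seq (vA <-- IGet aHeap (var vK))
  (Seq (vB <-- IGet aHeap (var vQ))
  (Seq meld
  (Seq (IPut aHeap (var vRoot) (IGet aNext (IConst 0)))
  (Seq (vK <-- var vRoot)
  (Seq (vCand <-- var vNext)
       (vT <-- IAdd (var vT) (IConst 1))))))))))))))).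

Definition iteration : cmd :=
  If (BILe (var vCand) (IConst 0)) extract
  (Seq (find_root aParS vU (IGet aTail (var vCand)))
  (Seq (find_root aParS vV (IGet aHead (var vCand)))
  (If (BIEq (var vU) (var vV)) (vCand <-- IConst 0)
  (Seq (find_root aParW vX (IGet aTail (var vCand)))
  (Seq (find_root aParW vY (IGet aHead (var vCand)))
       (If (BIEq (var vX) (var vY)) contract choose)))))).

Section Main.
Variable R : realType.
Variables n E L : nat.
Variables tl hd K0 : nat -> nat.
Variable w0 : nat -> R.
Implicit Types (S K W : nat -> nat) (red : nat -> R) (D : R).
Implicit Types (I : nat -> nat -> nat) (F : nat -> R) (T : nat -> tree).

Hypothesis tl_le : forall a, tl a <= n.
Hypothesis hd_lt : forall a, hd a < n.
Hypothesis K0_lt : forall i, i < n -> K0 i < n.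
Hypothesis K0_idem : forall i, i < n -> K0 (K0 i) = K0 i.
Hypothesis K0_n : K0 n = n.
Hypothesis source_arc :
  forall i, i < n -> exists a, [/\ arc E a, tl a = n & hd a = i].
Hypothesis n_L : n.+1 <= 2 ^ L.
Hypothesis E_L : E.+1 <= 2 ^ (2 * L).

Fixpoint logged I (log : seq entry) : Prop :=
  if log is e :: l then
    [/\ I aLogChild (size l) = entry_child e, I aLogArc (size l) = entry_arc e
      & logged I l]
  else True.

Lemma logged_frame I I' log : I' aLogChild = I aLogChild ->
  I' aLogArc = I aLogArc -> logged I log -> logged I' log.
Proof.
by move=> h1 h2; elim: log => //= e l IH [h3 h4 h5]; rewrite h1 h2; split; auto.
Qed.

(* [par] is the parent array of the class partition after the merges in [log];
   resetting the last child to a root recovers the previous one. *)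
Fixpoint unwinds (par : nat -> nat) K (log : seq entry) : Prop :=
  if log is e :: l then
    let par' := fun j => if j == entry_child e then entry_child e else par j in
    [/\ par (entry_child e) = entry_root e, entry_child e < n,
        entry_child e <> entry_root e, shallow n.+1 L.+1 par' (entry_K e)
      & unwinds par' (entry_K e) l]
  else forall i, i <= n -> par i = K0 i.

(** The list [ex] of extracted arcs is not stored in memory. Together with the distinctness of the
    logged children it bounds the numbers of extractions and merges. *)
Record layout I F S K W red D T log (ex : seq nat) : Prop := Layout {
  l_tail : forall a, I aTail a = tl a;
  l_head : forall a, I aHead a = hd a;
  l_S : sized n.+1 (I aParS) (I aRkS) S;
  l_W : sized n.+1 (I aParW) (I aRkW) W;
  l_K : sized n.+1 (I aParK) (I aRkK) K;
  l_inv : inv n E tl hd K0 w0 S K W (I aChosen) red D (fun k => keys (T k)) log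
            (I vCand 0);
  l_heap : forall k, k < n -> K k = k ->
    [/\ uniq (keys (T k)), ordered red (T k), balanced (T k) &
        repr (I aNext) (I aSize) F red 0 (I aHeap k) (T k)];
  l_size0 : I aSize 0 = 0;
  l_ex : uniq ex /\ (forall a, a \in ex -> arc E a);
  l_fresh : forall k a, k < n -> K k = k -> a \in keys (T k) -> a \notin ex;
  l_count : I vT 0 = size log;
  l_logged : logged I log;
  l_unwinds : unwinds (I aParK) K log;
  l_children : uniq [seq entry_child e | e <- log] /\
    forall e, e \in [seq entry_child e | e <- log] -> e < n /\ K e <> e
}.

(** Every iteration lowers it: an extraction gives up 2 and creates a candidate worth 1, dropping or
    choosing a candidate gives up that 1, and a contraction lengthens the log while a candidate
    remains. *)
Definition potential (log : seq entry) (ex : seq nat) ca :=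
  2 * (E - size ex) + (n - size log) + (ca != 0).

Definition used := [:: aTail; aHead; aParS; aRkS; aParW; aRkW; aParK; aRkK;
  aHeap; aChosen; aNext; aSize; aLogChild; aLogArc; vT; vCand].

Lemma layout_frame I F I' S K W red D T log ex :
  layout I F S K W red D T log ex -> {in used, I' =1 I} ->
  layout I' F S K W red D T log ex.
Proof.
move=> l h; have e a : a \in used -> I' a = I a by exact: h.
case: l => a1 a2 a3 a4 a5 a6 a7 a8 a9 a10 a11 a12 a13 a14; split; rewrite ?e //.
by apply: logged_frame a12; rewrite e.
Qed.

Definition current I K i := [/\ I vK 0 < n, K i = I vK 0, K (I vK 0) = I vK 0
  & I vCand 0 != 0 -> K (hd (I vCand 0)) = I vK 0].

Lemma sized_find par rk S : sized n.+1 par rk S -> shallow n.+1 L.+1 par S.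
Proof. by move=> h; apply: sized_shallow h n_L. Qed.

Lemma heap_spine I F S K W red D T log ex k :
  layout I F S K W red D T log ex -> k < n -> K k = k ->
  spine (T k) <= 2 * L.
Proof.
move=> l hk Kk; have [h1 _ h2 _] := l_heap l hk Kk.
apply: spine_le => //; apply: leq_trans E_L; rewrite ltnS.
rewrite -(size_iota 1 E); apply: uniq_leq_size => // a ha.
have [h3 _ _] := i_heap (l_inv l) hk Kk ha.
by rewrite mem_iota add1n.
Qed.

Lemma wp_extract s S K W red D T log ex :
  layout (imem s) (rmem s aKey) S K W red D T log ex ->
  imem s vCand 0 = 0 -> imem s vK 0 < n -> K (imem s vK 0) = imem s vK 0 ->
  imem s aChosen (imem s vK 0) = 0 ->
  wp extract s (fun s' t => t <= 600 * L + 200 /\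
    (forall a, a \notin used -> a \notin scratch -> imem s' a = imem s a) /\
    imem s' aChosen = imem s aChosen /\
    imem s' vCand 0 != 0 /\ K (hd (imem s' vCand 0)) = imem s vK 0 /\
    exists red' D' T', layout (imem s') (rmem s' aKey) S K W red' D' T' log
      (imem s' vCand 0 :: ex)).
Proof.
move=> l hca hk Kk hch; set k := imem s vK 0 in hk Kk hch *.
have hinv := l_inv l; rewrite hca in hinv.
have hne := heap_nonempty source_arc hinv hk Kk hch.
have [hu ho hb hr] := l_heap l hk Kk.
have hsp := heap_spine l hk Kk.
case eT : (T k) hne hu ho hb hr hsp => [|x lt rt] //= _ /andP[hxn hu].
move=> /and3P[/allP hmin hol hor] /and3P[hsz hbl hbr] [hHk hx0 hSx hKx [hrl hrr]] hsp.
have hxT : x \in keys (T k) by rewrite eT mem_head.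
have [arcx Kx _] := i_heap hinv hk Kk hxT.
rewrite /extract; apply: wp_seq; apply: wp_iput; rewrite /= -/k hHk.
apply: wp_seq; apply: wp_iput; rewrite /= upd_hit upd_off //.
apply: wp_seq; apply: wp_iput; rewrite /=.
set M := upd _ vB 0 _.
have eM a : a != vCand -> a != vA -> a != vB -> M a = imem s a.
  by move=> h1 h2 h3; rewrite /M !upd_off.
have eA : M vA 0 = imem s aNext (x + x) by rewrite /M /upd /=.
have eB : M vB 0 = imem s aNext (x + x + 1).
  by rewrite /M /upd /= .
have eC : M vCand 0 = x by rewrite /M /upd /=.
apply: wp_seq.
have hm : wp meld (State M (rmem s)) (fun s' t =>
    merged red (red x) (State M (rmem s)) lt rt 0 s' /\
    t <= 140 * (spine lt + spine rt) + 45).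
  apply: wp_meld => //=.
  - by rewrite hol hor.
  - by rewrite hbl hbr.
  - by rewrite eM // (l_size0 l).
apply: wp_mono hm _ => s1 t1 [[[tr [hp hto htb hrt]] hN hSK hF hFr] ht1].
rewrite /= in hN hSK hF hFr.
have s1K : imem s1 vK 0 = k by rewrite hF // eM.
have s1C : imem s1 vCand 0 = x by rewrite hF // eC.
apply: wp_iput; rewrite /= s1K.
set red' := fun a => if K (hd a) == k then (red a - red x)%R else red a.
set T' := fun j => if j == k then tr else T j.
have hsl : spine lt + spine rt <= 4 * L.
  have hsl' : spine lt <= 2 * L.
    apply: spine_le => //; apply: leq_trans E_L.
    rewrite ltnS -(size_iota 1 E); apply: uniq_leq_size.
      by move: hu; rewrite cat_uniq => /and3P[].
    move=> a ha; have hin : a \in keys (T k).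
      by rewrite eT /= inE mem_cat ha orbT.
    by have [h3 _ _] := i_heap hinv hk Kk hin; rewrite mem_iota add1n.
  by move: hsp hsl'; clear; lia.
split; first by move: ht1 hsl; clear; lia.
split.
  move=> a ha1 ha2.
  rewrite upd_off; last by apply: contraNneq ha1 => ->.
  rewrite hF // eM //; [apply: contraNneq ha1|apply: contraNneq ha2|
    apply: contraNneq ha2] => -> //.
split; first by rewrite upd_off // hF // eM.
rewrite upd_off // s1C Kx; split; first by rewrite -lt0n.
split => //.
have hmem a : a \in keys lt ++ keys rt -> a \in keys (T k).
  by move=> ha; rewrite eT inE ha orbT.
have trmem a : (a \in keys tr) = (a \in keys lt ++ keys rt).
  exact: perm_mem hp a.
exists red', (D + red x)%R, T'.
have hfar j z : j < n -> K j = j -> j <> k -> z \in keys (T j) ->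
   [/\ 0 < z, z \notin keys lt ++ keys rt, z + z \notin slots (keys lt ++ keys rt)
     & z + z + 1 \notin slots (keys lt ++ keys rt)].
  move=> hj Kj hjk hz; have [_ _ _ hrj] := l_heap l hj Kj.
  have hz' : z \notin keys lt ++ keys rt.
    apply/negP => /hmem hz'; apply: hjk.
    have [_ <- _] := i_heap hinv hj Kj hz.
    by have [_ -> _] := i_heap hinv hk Kk hz'.
  by rewrite slot_left slot_right; split => //; exact: repr_gt0 hrj _ hz.
have eHeap j : upd (imem s1) aHeap k (imem s1 aNext 0) aHeap j =
   if j == k then imem s1 aNext 0 else imem s aHeap j.
  by rewrite upd_row (hF aHeap) // eM.
have eQ a : a \notin [:: aHeap; vCand] -> a \notin scratch ->
    upd (imem s1) aHeap k (imem s1 aNext 0) a = imem s a.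
  rewrite inE negb_or => /andP[h1]; rewrite inE => h2 h3; rewrite upd_off //.
  by rewrite hF // eM //; apply: contraNneq h3 => ->.
have eN a : a != aHeap -> upd (imem s1) aHeap k (imem s1 aNext 0) a = imem s1 a.
  by move=> ?; rewrite upd_off.
split; rewrite ?(eN vCand) // ?s1C ?(eN aNext) // ?(eN aSize) //.
- by move=> a; rewrite eQ // (l_tail l).
- by move=> a; rewrite eQ // (l_head l).
- by rewrite !eQ //; exact: l_S l.
- by rewrite !eQ //; exact: l_W l.
- by rewrite !eQ //; exact: l_K l.
- rewrite eQ //; apply: (inv_extract tl_le hd_lt K0_lt K0_idem K0_n hinv hk Kk hch hxT).
  + move=> a; rewrite eT inE => /orP[/eqP -> //|]; exact: hmin.
  + by move=> j hj; rewrite /T' (negbTE hj).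
  + by move=> a; rewrite /T' eqxx eT inE trmem.
- move=> j hj Kj; rewrite eHeap /T'; case: (j =P k) => [e|hjk].
    split => //.
    + by rewrite (perm_uniq hp).
    + rewrite (@ordered_ext _ red _ (red x)) // => z.
      rewrite trmem => /hmem hz.
      by rewrite /red'; have [_ -> _] := i_heap hinv hk Kk hz; rewrite eqxx.
    (* The subheaps were melded relative to the key of the extracted root; seen with the lowered
       weights, the same cells form a heap with base 0. *)
    + apply: (repr_ext (y := red x)) hrt; last by rewrite subrr.
      move=> z; rewrite trmem => /hmem hz; split => //.
      by rewrite /red'; have [_ -> _] := i_heap hinv hk Kk hz; rewrite eqxx.
  have [h1 h2 h3 h4] := l_heap l hj Kj.
  have hred z : z \in keys (T j) -> red' z = (red z - 0)%R.
    move=> hz; rewrite /red' subr0; have [_ -> _] := i_heap hinv hj Kj hz.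
    by case: (j =P k).
  split => //; first by rewrite (@ordered_ext _ red _ 0%R).
  apply: (repr_ext (y := 0%R)) h4; last by rewrite subr0.
  move=> z hz; have [g1 g2 g3 g4] := hfar _ _ hj Kj hjk hz.
  have [-> ->] := hSK _ g2; rewrite !hN // ?(eM aNext) // ?(eM aSize) //; last 2 first.
  + by rewrite addn1.
  + by rewrite -lt0n addn_gt0 g1.
  by split => //; exact: hred.
- have [|-> _] := hSK 0; last by rewrite eM // (l_size0 l).
  apply/negP => h0; have := repr_gt0 hrl; have := repr_gt0 hrr.
  by move: h0; rewrite mem_cat => /orP[h0|h0] h1 h2; [have := h2 _ h0|have := h1 _ h0].
- have [h1 h2] := l_ex l; split.
    by rewrite /= h1 andbT; exact: l_fresh l k x hk Kk hxT.
  by move=> a; rewrite inE => /orP[/eqP ->|/h2].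
- move=> j a hj Kj; rewrite /T'; case: (j =P k) => [_|hjk].
    rewrite trmem => ha; rewrite inE negb_or.
    rewrite (l_fresh l hk Kk (hmem _ ha)) andbT.
    by apply: contraNneq hxn => <-.
  move=> ha; rewrite inE negb_or (l_fresh l hj Kj ha) andbT.
  apply/eqP => e; apply: hjk; have [_ <- _] := i_heap hinv hj Kj ha.
  by rewrite e.
- by rewrite eQ //; exact: l_count l.
- by apply: logged_frame (l_logged l); rewrite eQ.
- by rewrite eQ //; exact: l_unwinds l.
- exact: l_children l.
Qed.

Implicit Types (s : state R).

(** In the last clause a served class may be absorbed by the unserved one; its nodes are then in the
    class being served, so they are not forgotten. *)
Definition after_step s S K W red D T log ex s' : Prop :=
  exists S' K' W' red' D' T' log' ex',
  [/\ layout (imem s') (rmem s' aKey) S' K' W' red' D' T' log' ex',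
      potential log' ex' (imem s' vCand 0) < potential log ex (imem s vCand 0),
      {in [:: 0; 4; vI], imem s' =1 imem s},
      forall i, i < n -> K i = imem s vK 0 -> current (imem s') K' i
    & forall i, i < n ->
        K i = imem s vK 0 \/ imem s aChosen (K i) != 0 ->
        K' i = imem s' vK 0 \/ imem s' aChosen (K' i) != 0].

Lemma ex_bound I F S K W red D T log ex :
  layout I F S K W red D T log ex -> size ex <= E.
Proof.
move=> l; have [h1 h2] := l_ex l.
rewrite -(size_iota 1 E); apply: uniq_leq_size => // a /h2.
by rewrite mem_iota add1n.
Qed.

Lemma log_bound I F S K W red D T log ex :
  layout I F S K W red D T log ex -> size log <= n.
Proof.
move=> l; have [h1 h2] := l_children l.
rewrite -(size_map entry_child) -(size_iota 0 n); apply: uniq_leq_size => // a /h2.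
by rewrite mem_iota => -[].
Qed.

Lemma wp_choose s S K W red D T log ex :
  layout (imem s) (rmem s aKey) S K W red D T log ex ->
  let ca := imem s vCand 0 in let k := imem s vK 0 in
  ca != 0 -> k < n -> K k = k -> K (hd ca) = k ->
  imem s vX 0 = W (tl ca) -> imem s vY 0 = W (hd ca) ->
  W (tl ca) <> W (hd ca) ->
  wp choose s (fun s' t => t <= 200 /\
    after_step s S K W red D T log ex s').
Proof.
move=> l ca k hca hk Kk Kca hX hY hW.
have hinv := l_inv l; rewrite -/ca in hinv.
have [ufW _] := l_W l.
have htl : tl ca < n.+1 by rewrite ltnS.
have hhd : hd ca < n.+1 by exact: ltnW (hd_lt ca).
apply: wp_seq; apply: (wp_union (l_W l)) => //=.
- move=> f hf; by rewrite !hf.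
- by rewrite hX; exact: rk_bnd ufW _ htl.
- by rewrite hY; exact: rk_bnd ufW _ hhd.
- by rewrite hX; exact: rk_idem ufW _ htl.
- by rewrite hY; exact: rk_idem ufW _ hhd.
- by rewrite hX hY; apply/eqP.
move=> c r f t; rewrite hX hY => hcr hs hpar hc hr hf ht.
apply: wp_seq; apply: wp_iput; rewrite /= !hf // -/k -/ca.
apply: wp_iput => /=.
split; first by move: ht; clear; lia.
set M := upd _ vCand 0 _.
have eM a : a \notin [:: aParW; aRkW; vChild; vRoot; aChosen; vCand] ->
    M a = imem s a.
  rewrite !inE !negb_or => /and5P[h1 h2 h3 h4 /andP[h5 h6]].
  by rewrite /M !upd_off // hf // !inE !negb_or h1 h2 h3 h4.
have eW : M aParW = f aParW /\ M aRkW = f aRkW by rewrite /M !upd_off.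
have eC : M aChosen = fun i => if i == K (hd ca) then ca else imem s aChosen i.
  by rewrite /M upd_off // upd_row hf // Kca.
have eV : M vCand 0 = 0 by rewrite /M upd_hit.
exists S, K, (join W c r), red, D, T, log, ex; split => /=.
- split; rewrite ?eV.
  + by move=> a; rewrite eM // (l_tail l).
  + by move=> a; rewrite eM // (l_head l).
  + by rewrite !eM //; exact: l_S l.
  + by rewrite eW.1 eW.2.
  + by rewrite !eM //; exact: l_K l.
  + by rewrite eC; apply: (inv_choose tl_le hd_lt K0_n hinv hca hcr hW).
  + move=> j hj Kj; have := l_heap l hj Kj; by rewrite !eM.
  + by rewrite eM //; exact: l_size0 l.
  + exact: l_ex l.
  + exact: l_fresh l.
  + by rewrite eM //; exact: l_count l.
  + by apply: logged_frame (l_logged l); rewrite eM.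
  + by rewrite eM //; exact: l_unwinds l.
  + exact: l_children l.
- by rewrite eV /potential -/ca hca; clear; lia.
- by move=> a; rewrite !inE => /or3P[/eqP ->|/eqP ->|/eqP ->]; rewrite eM.
- by move=> i hi Ki; split; rewrite ?eV ?eM.
- move=> i hi h; rewrite eC eM // Kca -/k; case: (K i =P k) => [->|ne]; first by left.
  by right; case: h.
Qed.

Lemma wp_contract s S K W red D T log ex :
  layout (imem s) (rmem s aKey) S K W red D T log ex ->
  let ca := imem s vCand 0 in let k := imem s vK 0 in
  ca != 0 -> k < n -> K k = k -> K (hd ca) = k ->
  imem s vU 0 = S (tl ca) -> imem s vV 0 = S (hd ca) ->
  S (tl ca) <> S (hd ca) -> W (tl ca) = W (hd ca) ->
  wp contract s (fun s' t => t <= 600 * L + 600 /\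
    after_step s S K W red D T log ex s').
Proof.
move=> l ca k hca hk Kk Kca hU hV hS hW.
have hinv := l_inv l; rewrite -/ca in hinv.
have [ufS _] := l_S l; have [ufK _] := l_K l.
have [_ _ chk] := i_cand hinv hca; rewrite Kca in chk.
have htl : tl ca < n.+1 by rewrite ltnS.
have hhd : hd ca < n.+1 by exact: ltnW (hd_lt ca).
have [] := candidate_tail tl_le hd_lt hinv hca hS hW.
set q := K (tl ca); rewrite Kca => hq hb Shb hqk hxn.
have Kq : K q = q by exact: rk_idem ufK _ htl.
have k0 : k < n.+1 := ltnW hk.
have q0 : q < n.+1 := ltnW hq.
apply: wp_seq; apply: (wp_find_root (S := K) (N := n.+1) (L := L.+1)) => //=.
- exact: sized_find (l_K l).
- by rewrite (l_tail l) -/ca.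
rewrite (l_tail l) -/ca -/q => t1 ht1.
apply: wp_seq; apply: (wp_union (N := n.+1) (S := S)) => //=.
- by rewrite !upd_off //; exact: l_S l.
- by move=> f hf; rewrite !hf.
- by rewrite upd_off // hU; exact: rk_bnd ufS _ htl.
- by rewrite upd_off // hV; exact: rk_bnd ufS _ hhd.
- by rewrite upd_off // hU; exact: rk_idem ufS _ htl.
- by rewrite upd_off // hV; exact: rk_idem ufS _ hhd.
- by rewrite !upd_off // hU hV; apply/eqP.
move=> c r f t2; rewrite !upd_off // hU hV => hcr hsS _ _ _ hf ht2.
have ef a : a \notin [:: aParS; aRkS; vChild; vRoot; vQ] -> f a = imem s a.
  rewrite !inE !negb_or => /and5P[h1 h2 h3 h4 h5].
  by rewrite hf ?upd_off // !inE !negb_or h1 h2 h3.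
have fQ : f vQ 0 = q by rewrite hf // upd_hit.
apply: wp_seq; apply: wp_iput; rewrite /= !ef // -/k -/ca.
apply: wp_seq; apply: wp_iput; rewrite /= (@upd_off _ f aChosen vQ) // fQ upd_row ef //.
have -> : (q == k) = false by apply/eqP.
set M2 := upd _ vNext 0 _.
have eM2 a : a \notin [:: aParS; aRkS; vChild; vRoot; vQ; aChosen; vNext] ->
   M2 a = imem s a.
  rewrite !inE !negb_or => /and5P[h1 h2 h3 h4 /and3P[h5 h6 h7]].
  by rewrite /M2 !upd_off // ef // !inE !negb_or h1 h2 h3 h4.
have M2Q : M2 vQ 0 = q by rewrite /M2 !upd_off.
have M2N : M2 vNext 0 = imem s aChosen q by rewrite /M2 upd_hit.
have M2C : M2 aChosen = fun i => if i == k then ca else imem s aChosen i.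
  by rewrite /M2 upd_off // upd_row ef.
have M2S : M2 aParS = f aParS /\ M2 aRkS = f aRkS by rewrite /M2 !upd_off.
apply: wp_seq; apply: (wp_union (N := n.+1) (S := K)) => //=;
  rewrite ?M2Q ?(eM2 vK) // -/k.
- by rewrite !eM2 //; exact: l_K l.
- by move=> g hg; rewrite !hg // M2Q eM2.
- by apply/eqP.
move=> chd rt g t3 hkq hsK hparK gch grt hg ht3.
have eg a : a \notin [:: aParS; aRkS; vChild; vRoot; vQ; aChosen; vNext; aParK; aRkK] ->
   g a = imem s a.
  rewrite !inE !negb_or => /and5P[h1 h2 h3 h4 /and5P[h5 h6 h7 h8 h9]].
  by rewrite hg ?eM2 // !inE !negb_or ?h1 ?h2 ?h3 ?h4 ?h5 ?h6 ?h7 ?h8 ?h9.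
have gC : g aChosen = fun i => if i == k then ca else imem s aChosen i by rewrite hg.
have gQ : g vQ 0 = q by rewrite hg.
have gN : g vNext 0 = imem s aChosen q by rewrite hg.
have gS : g aParS = f aParS /\ g aRkS = f aRkS by rewrite !hg // M2S.1 M2S.2.
have hT := l_count l.
apply: wp_seq; apply: wp_iput; rewrite /= eg // hT gch.
apply: wp_seq; apply: wp_iput; rewrite /= !upd_off // eg // hT grt gC.
apply: wp_seq; apply: wp_iput; rewrite /= !upd_off // grt.
apply: wp_seq; apply: wp_iput; rewrite /= !upd_off // !eg // -/k.
apply: wp_seq; apply: wp_iput; rewrite /= !upd_off // (eg aHeap) // gQ.
set ar := if rt == k then ca else imem s aChosen rt.
set M3 := upd _ vB 0 _.
have eM3 a : a \notin [:: aLogChild; aLogArc; aChosen; vA; vB] -> M3 a = g a.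
  rewrite !inE !negb_or => /and5P[h1 h2 h3 h4 h5].
  by rewrite /M3 !upd_off.
have M3A : M3 vA 0 = imem s aHeap k by rewrite /M3 upd_off // upd_hit.
have M3B : M3 vB 0 = imem s aHeap q by rewrite /M3 upd_hit.
have M3C : M3 aChosen = fun i => if i == rt then 0 else
    (fun i => if i == k then ca else imem s aChosen i) i.
  by rewrite /M3 2?upd_off // upd_row !upd_off // gC.
have M3L : M3 aLogChild = fun i => if i == size log then chd else imem s aLogChild i.
  by rewrite /M3 4?upd_off // upd_row eg.
have M3R : M3 aLogArc = fun i => if i == size log then ar else imem s aLogArc i.
  by rewrite /M3 3?upd_off // upd_row !upd_off // eg.
have [hu1 ho1 hb1 hr1] := l_heap l hk Kk.
have [hu2 ho2 hb2 hr2] := l_heap l hq Kq.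
have disj z : z \in keys (T q) -> z \notin keys (T k).
  move=> h1; apply/negP => h2; apply: hqk.
  have [_ <- _] := i_heap hinv hq Kq h1.
  by have [_ <- _] := i_heap hinv hk Kk h2.
have hm : wp meld (State M3 (rmem s)) (fun s' t =>
    merged red 0%R (State M3 (rmem s)) (T k) (T q) 0 s' /\
    t <= 140 * (spine (T k) + spine (T q)) + 45).
  apply: wp_meld => /=.
  - rewrite cat_uniq hu1 hu2 andbT; apply/hasPn => z; exact: disj.
  - by rewrite ho1 ho2.
  - by rewrite hb1 hb2.
  - by rewrite eM3 // eg // (l_size0 l).
  - by rewrite M3A (eM3 aNext) // (eM3 aSize) // !eg.
  - by rewrite M3B (eM3 aNext) // (eM3 aSize) // !eg.
have hs1 := heap_spine l hk Kk; have hs2 := heap_spine l hq Kq.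
apply: wp_seq; apply: wp_mono hm _ => s4 t4 [[[tr [hp hto htb hrt]] hN hSK hF hFr] ht4].
rewrite /= in hN hSK hF hFr.
have s4R : imem s4 vRoot 0 = rt by rewrite hF // eM3.
have s4N : imem s4 vNext 0 = imem s aChosen q by rewrite hF // eM3.
have s4T : imem s4 vT 0 = size log by rewrite hF // eM3 // eg.
apply: wp_seq; apply: wp_iput; rewrite /= s4R.
apply: wp_seq; apply: wp_iput; rewrite /= upd_off // s4R.
apply: wp_seq; apply: wp_iput; rewrite /= !upd_off // s4N.
apply: wp_iput; rewrite /= !upd_off // s4T addn1.
split.
  by move: ht1 ht2 ht3 ht4 hs1 hs2; clear; lia.
set M := upd _ vT 0 _.
have eM a : a \notin [:: aHeap; vK; vCand; vT] -> M a = imem s4 a.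
  by rewrite !inE !negb_or => /and4P[h1 h2 h3 h4]; rewrite /M !upd_off.
have eM' a : a \notin [:: aHeap; vK; vCand; vT; aLogChild; aLogArc; aChosen] ->
    a \notin scratch -> M a = g a.
  move=> hh h8; move: hh.
  rewrite !inE !negb_or => /and5P[h1 h2 h3 h4 /and3P[h5 h6 h7]].
  have e1 : M a = imem s4 a by apply: eM; rewrite !inE !negb_or h1 h2 h3 h4.
  rewrite e1 hF //; apply: eM3; rewrite !inE !negb_or h5 h6 h7 /=.
  by move: h8; rewrite !inE !negb_or => /and5P[_ _ -> ->].
have MH : M aHeap = fun j => if j == rt then imem s4 aNext 0 else imem s aHeap j.
  by rewrite /M 3?upd_off // upd_row (hF aHeap) // eM3 // eg.
have MC : M aChosen = M3 aChosen by rewrite eM // hF.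
have MV : M vCand 0 = imem s aChosen q by rewrite /M upd_off // upd_hit.
have MK : M vK 0 = rt by rewrite /M 2?upd_off // upd_hit.
have MT : M vT 0 = (size log).+1 by rewrite /M upd_hit ?addn1.
have ML : M aLogChild = M3 aLogChild by rewrite eM // hF.
have MR : M aLogArc = M3 aLogArc by rewrite eM // hF.
set T' := fun j => if j == rt then tr else T j.
have hkq' : pair_of chd rt (K (tl ca)) (K (hd ca)) by rewrite Kca.
have hcr' : pair_of c r (S (tl ca)) (S (hd ca)) by [].
have chdrt : chd <> rt.
  by case: hkq => -[-> ->] e; apply: hqk.
have chdn : chd < n by case: hkq => -[-> _].
have rtn : rt < n by case: hkq => -[_ ->].
have Kchd : K chd = chd by case: hkq => -[-> _].
have Krt : K rt = rt by case: hkq => -[_ ->].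
have trmem z : (z \in keys tr) = (z \in keys (T chd)) || (z \in keys (T rt)).
  by rewrite (perm_mem hp) mem_cat; case: hkq => -[-> ->] //; rewrite orbC.
have hinv' := @inv_merge R n E tl hd K0 w0 tl_le hd_lt K0_n S K W (imem s aChosen)
  red D (fun k => keys (T k)) log ca c r chd rt (fun k => keys (T' k)) hinv hca
  hS hW hcr' hkq' _ _.
have {}hinv' : inv n E tl hd K0 w0 (join S c r) (join K chd rt) W (M aChosen)
   red D (fun k => keys (T' k)) (Entry K chd rt ar :: log) (imem s aChosen q).
  rewrite MC M3C /ar -Kca; apply: hinv'.
    by move=> j h1 h2; rewrite /T'; case: (j =P rt).
  by move=> a; rewrite /T' eqxx trmem; case: (chd =P rt).
have K'rt j : K j = q \/ K j = k -> join K chd rt j = rt.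
  by rewrite /join; case: hkq => -[-> ->] [->|->]; rewrite ?eqxx //; case: eqP.
have K'out j : K j <> q -> K j <> k -> join K chd rt j = K j.
  by rewrite /join => h1 h2; case: hkq => -[-> _]; case: eqP.
exists (join S c r), (join K chd rt), W, red, D, T', (Entry K chd rt ar :: log), ex.
split => /=; rewrite ?MV.
- split; rewrite ?MV.
  + by move=> a; rewrite eM' // eg // (l_tail l).
  + by move=> a; rewrite eM' // eg // (l_head l).
  + by rewrite !eM' // gS.1 gS.2.
  + by rewrite !eM' // !eg //; exact: l_W l.
  + by rewrite !eM'.
  + exact: hinv'.
  + move=> j hj Kj; rewrite MH /T' !(eM aNext) // !(eM aSize) //.
    case: (j =P rt) => [e|hjrt].
      split => //.
      by rewrite (perm_uniq hp) cat_uniq hu1 hu2 andbT; apply/hasPn => z; exact: disj.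
    have [jq jk Kj'] : [/\ j <> q, j <> k & K j = j].
      move: Kj; rewrite /join; case: (K j =P chd) => [_ e|ne Kj]; first by case: hjrt.
      by rewrite Kj in ne; case: hkq => -[<- <-].
    have [h1 h2 h3 h4] := l_heap l hj Kj'.
    have hz0 := repr_gt0 h4.
    split => //; apply: (repr_ext (y := 0%R)) h4; last by rewrite subr0.
    move=> z hz; have z0 := hz0 _ hz.
    have hz' : z \notin keys (T k) ++ keys (T q).
      have [_ h5 _] := i_heap hinv hj Kj' hz.
      rewrite mem_cat negb_or; apply/andP; split; apply/negP => hz'.
        by have [_ h6 _] := i_heap hinv hk Kk hz'; apply: jk; rewrite -h5.
      by have [_ h6 _] := i_heap hinv hq Kq hz'; apply: jq; rewrite -h5.
    have [-> ->] := hSK _ hz'.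
    rewrite !hN ?slot_left ?slot_right //; last 2 first.
    * by rewrite addn1.
    * by rewrite -lt0n addn_gt0 z0.
    by rewrite !eM3 // !eg // subr0.
  + rewrite eM //; have [|-> _] := hSK 0; last by rewrite eM3 // eg // (l_size0 l).
    rewrite mem_cat; apply/orP => -[] h0.
      by have := repr_gt0 hr1 h0.
    by have := repr_gt0 hr2 h0.
  + exact: l_ex l.
  + move=> j a hj Kj; rewrite /T'; case: (j =P rt) => [_|hjrt].
      by rewrite trmem => /orP[] ha; apply: (l_fresh l _ _ ha).
    have Kj' : K j = j.
      move: Kj; rewrite /join; case: (K j =P chd) => [_ e|//]; by case: hjrt.
    exact: l_fresh l j a hj Kj'.
  + by rewrite MT.
  + rewrite /= ML MR M3L M3R eqxx; split => //.
    have : forall l', size l' <= size log -> logged (imem s) l' -> logged M l'.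
      elim=> //= en l' IH hl' [h1 h2 h3].
      rewrite ML MR M3L M3R ltn_eqF //; split => //; apply: IH => //; exact: ltnW.
    by apply; [|exact: l_logged l].
  + rewrite /= eM' // hparK eqxx.
    (* The child was a root before the union, so making it a root again gives back the previous
       parent array exactly. *)
    have -> : (fun j => if j == chd then chd else if j == chd then rt else M2 aParK j) =
              imem s aParK.
      apply: funext => j; rewrite eM2 //; case: (j =P chd) => [->|//].
      by apply/esym/eqP; rewrite (rk_root ufK) ?Kchd // ltnW.
    split => //; [exact: sized_find (l_K l)|exact: l_unwinds l].
  + have [h1 h2] := l_children l; split.
      rewrite /= h1 andbT; apply/negP => /h2 [_ /(_ Kchd)] //.
    move=> e; rewrite inE => /orP[/eqP ->|/h2 [he hne]].
      by split => //; rewrite K'rt; [exact/nesym|case: hkq => -[-> _]; rewrite ?Kq ?Kk; auto].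
    split => //; rewrite /join; case: (K e =P chd) => // h3 h4.
    by apply: hne; rewrite -{1}h4 Krt.
(* The truncated difference [n - size log] really drops: the new child is still a representative and
   hence not in the log, so the log was shorter than [n]. *)
- have := log_bound l; rewrite /potential -/ca hca hb /=.
  have : size log < n.
    have [h1 h2] := l_children l.
    have : uniq (chd :: [seq entry_child e | e <- log]).
      by rewrite /= h1 andbT; apply/negP => /h2 [_ /(_ Kchd)].
    move=> /(@uniq_leq_size _ _ (iota 0 n)); rewrite /= size_iota size_map; apply.
    by move=> z; rewrite inE mem_iota => /orP[/eqP -> //|/h2 []].
  by clear; lia.
- by move=> a; rewrite !inE => /or3P[/eqP ->|/eqP ->|/eqP ->]; rewrite eM' // eg.
- move=> i hi Ki; split; rewrite ?MK ?MV //.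
  + by rewrite K'rt //; right.
  + by rewrite K'rt // Krt; case: hkq => -[_ ->]; auto.
  + move=> _; apply: K'rt; left.
    by have [-> _] := eq_SK (i_parts hinv) (ltnW (hd_lt _)) (tl_le ca) Shb.
- move=> i hi h; rewrite MK.
  case: (EM (K i = q \/ K i = k)) => [hin|/not_orP[h1 h2]]; first by left; rewrite K'rt.
  right; rewrite K'out // MC M3C.
  have -> : (K i == rt) = false.
    by apply/eqP => e; case: hkq => -[_ e2]; [apply: h2|apply: h1]; rewrite e e2.
  by case: (K i =P k) => // _; case: h.
Qed.

Lemma after_step_frame s s2 S K W red D T log ex s' :
  (forall a, a \notin [:: vU; vV; vX; vY] -> imem s2 a = imem s a) ->
  after_step s2 S K W red D T log ex s' ->
  after_step s S K W red D T log ex s'.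
Proof.
move=> h [S1 [K1 [W1 [red1 [D1 [T1 [log1 [ex1 [h1 h2 h3 h4 h5]]]]]]]]].
exists S1, K1, W1, red1, D1, T1, log1, ex1; split => //.
- by move: h2; rewrite h.
- by move=> a ha; rewrite h3 //; move: ha; rewrite !inE => /or3P[/eqP ->|/eqP ->|/eqP ->];
    rewrite h.
- by move=> i hi Ki; apply: h4 => //; rewrite Ki h.
- by move=> i hi hk; apply: h5 => //; rewrite !h.
Qed.

Lemma wp_iteration s S K W red D T log ex :
  layout (imem s) (rmem s aKey) S K W red D T log ex ->
  let ca := imem s vCand 0 in let k := imem s vK 0 in
  k < n -> K k = k -> imem s aChosen k = 0 -> (ca != 0 -> K (hd ca) = k) ->
  wp iteration s (fun s' t => t + 10 <= 1000 * L.+1 /\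
    after_step s S K W red D T log ex s').
Proof.
move=> l ca k hk Kk hch hcur; have hinv := l_inv l; rewrite -/ca in hinv.
apply: wp_if => /=; rewrite leqn0 -/ca => hca.
  apply: wp_mono (wp_extract l (eqP hca) hk Kk hch) _.
  move=> s' t [ht [hf [hC [hc0 [hKc [red' [D' [T' l']]]]]]]].
  have hvK : imem s' vK 0 = k by rewrite hf.
  split; first by move: ht; clear; lia.
  exists S, K, W, red', D', T', log, (imem s' vCand 0 :: ex); split => //.
  - rewrite /potential -/ca hc0 (eqP hca) /=; have := ex_bound l'.
    by rewrite /=; clear; lia.
  - by move=> a; rewrite !inE => /or3P[/eqP ->|/eqP ->|/eqP ->]; rewrite hf.
  - by move=> i hi Ki; split; rewrite ?hvK.
  - by move=> i hi h; rewrite hvK hC.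
have {}hcur := hcur hca.
have hs (f : nat -> nat -> nat) : (forall a, a \notin [:: vU; vV; vX; vY] -> f a = imem s a) ->
   layout f (rmem s aKey) S K W red D T log ex.
  by move=> h; apply: layout_frame l _ => a ha; apply: h;
     apply: contraTN ha; rewrite !inE => /or4P[] /eqP ->.
have htl : tl ca < n.+1 by rewrite ltnS.
have hhd : hd ca < n.+1 by exact: ltnW (hd_lt ca).
apply: wp_seq; apply: (wp_find_root (sized_find (l_S l))) => //=.
  by rewrite (l_tail l).
rewrite (l_tail l) -/ca => t1 ht1.
apply: wp_seq; apply: (wp_find_root (N := n.+1) (L := L.+1) (S := S)) => //=.
- by rewrite upd_off //; exact: sized_find (l_S l).
- by rewrite !upd_off // (l_head l) -/ca.
rewrite !upd_off // (l_head l) -/ca => t2 ht2.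
apply: wp_if => /=; rewrite !(upd_hit, @upd_off _ _ vV) // -eqn_leq => hS.
  apply: wp_iput => /=; split; first by move: ht1 ht2; clear; lia.
  set M := upd _ vCand _ _.
  have eM a : a \notin [:: vU; vV; vCand] -> M a = imem s a.
    by rewrite !inE !negb_or => /and3P[h1 h2 h3]; rewrite /M !upd_off.
  have eV : M vCand 0 = 0 by rewrite /M upd_hit.
  exists S, K, W, red, D, T, log, ex; split => //=; rewrite ?eV.
  - split; rewrite ?eV.
    + by move=> a; rewrite eM // (l_tail l).
    + by move=> a; rewrite eM // (l_head l).
    + by rewrite !eM //; exact: l_S l.
    + by rewrite !eM //; exact: l_W l.
    + by rewrite !eM //; exact: l_K l.
    + by rewrite eM //; apply: inv_drop hinv (eqP hS).
    + move=> j hj Kj; have := l_heap l hj Kj; by rewrite !eM.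
    + by rewrite eM //; exact: l_size0 l.
    + exact: l_ex l.
    + exact: l_fresh l.
    + by rewrite eM //; exact: l_count l.
    + by apply: logged_frame (l_logged l); rewrite eM.
    + by rewrite eM //; exact: l_unwinds l.
    + exact: l_children l.
  - by rewrite /potential -/ca hca /=; clear; lia.
  - by move=> a; rewrite !inE => /or3P[/eqP ->|/eqP ->|/eqP ->]; rewrite eM.
apply: wp_seq; apply: (wp_find_root (N := n.+1) (L := L.+1) (S := W)) => //=.
- by rewrite !upd_off //; exact: sized_find (l_W l).
- by rewrite !upd_off // (l_tail l) -/ca.
rewrite !upd_off // (l_tail l) -/ca => t3 ht3.
apply: wp_seq; apply: (wp_find_root (N := n.+1) (L := L.+1) (S := W)) => //=.
- by rewrite !upd_off //; exact: sized_find (l_W l).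
- by rewrite !upd_off // (l_head l) -/ca.
rewrite !upd_off // (l_head l) -/ca => t4 ht4.
set M := upd _ vY 0 _.
have eM a : a \notin [:: vU; vV; vX; vY] -> M a = imem s a.
  by rewrite !inE !negb_or => /and4P[h1 h2 h3 h4]; rewrite /M !upd_off.
have eU : M vU 0 = S (tl ca) by rewrite /M 3?upd_off // upd_hit.
have eV : M vV 0 = S (hd ca) by rewrite /M 2?upd_off // upd_hit.
have eX : M vX 0 = W (tl ca) by rewrite /M upd_off // upd_hit.
have eY : M vY 0 = W (hd ca) by rewrite /M upd_hit.
have l2 := hs M eM.
have eC : M vCand = imem s vCand by rewrite eM.
have eK : M vK = imem s vK by rewrite eM.
have frame s' : after_step (State M (rmem s)) S K W red D T log ex s' ->
    after_step s S K W red D T log ex s'.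
  exact: after_step_frame.
apply: wp_if => /=; rewrite eX eY -eqn_leq => hW.
  have hc : wp contract (State M (rmem s)) (fun s' t => t <= 600 * L + 600 /\
    after_step (State M (rmem s)) S K W red D T log ex s').
    by apply: wp_contract; rewrite /= ?eC ?eK //; exact/eqP.
  apply: wp_mono hc _ => s' t [ht h]; split; last exact: frame.
  by move: ht ht1 ht2 ht3 ht4; clear; lia.
have hc : wp choose (State M (rmem s)) (fun s' t => t <= 200 /\
    after_step (State M (rmem s)) S K W red D T log ex s').
  by apply: wp_choose; rewrite /= ?eC ?eK //; exact/eqP.
apply: wp_mono hc _ => s' t [ht h]; split; last exact: frame.
by move: ht ht1 ht2 ht3 ht4; clear; lia.
Qed.

(** * Serving all classes *)

Definition grow : cmd :=
  While (BILe (IAdd (var vI) (IConst 1)) (var 0))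
    (Seq (find_root aParK vK (var vI))
    (Seq (While (BILe (IGet aChosen (var vK)) (IConst 0)) iteration)
         (vI <-- IAdd (var vI) (IConst 1)))).

Definition all_chosen s : Prop :=
  exists S K W red D T log ex,
  [/\ layout (imem s) (rmem s aKey) S K W red D T log ex,
      imem s vCand 0 = 0 & forall i, i < n -> imem s aChosen (K i) != 0].

(** One potential pays for both loops: the inner loop spends it across all rounds of the outer one,
    and each outer round needs only one more unit of [B] for its search and bookkeeping. *)
Lemma wp_grow s S K W red D T log ex :
  layout (imem s) (rmem s aKey) S K W red D T log ex ->
  imem s vCand 0 = 0 -> imem s vI 0 = 0 -> imem s 0 0 = n ->
  log = [::] -> ex = [::] ->
  wp grow s (fun s' t => t <= 1000 * L.+1 * (2 * E + 2 * n) + 10 /\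
     all_chosen s' /\ imem s' 0 = imem s 0 /\ imem s' 4 = imem s 4).
Proof.
move=> l hca hI hn hlog hex.
pose B := 1000 * L.+1.
pose inv_i s1 b := exists S K W red D T log ex,
  [/\ layout (imem s1) (rmem s1 aKey) S K W red D T log ex,
    imem s1 vCand 0 = 0, imem s1 0 = imem s 0 /\ imem s1 4 = imem s 4,
    forall i, i < imem s1 vI 0 -> i < n -> imem s1 aChosen (K i) != 0
  & b = B * (potential log ex 0 + (n - imem s1 vI 0))].
apply: (@wp_while_budget _ inv_i _ _ _ (B * (2 * E + 2 * n))); last 2 first.
- exists S, K, W, red, D, T, log, ex; split => //; first by rewrite hI.
  rewrite hI hlog hex /potential /= !subn0; congr (_ * _); clear; lia.
- move=> s' b t [S1 [K1 [W1 [red1 [D1 [T1 [log1 [ex1 [l1 h1 [h2 h2'] h3 _]]]]]]]]].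
  rewrite /= h2 hn addn1 -leqNgt => hle ht; split; first by move: ht; clear; lia.
  split => //; exists S1, K1, W1, red1, D1, T1, log1, ex1; split => //.
  by move=> i hi; apply: h3 => //; exact: leq_trans hle.
move=> s1 b [S1 [K1 [W1 [red1 [D1 [T1 [log1 [ex1 [l1 h1 [h2 h2'] h3 ->]]]]]]]]].
rewrite /= h2 hn addn1 => hlt; set i := imem s1 vI 0 in h3 hlt *.
have p1 := i_parts (l_inv l1).
have [ufK _] := l_K l1.
apply: wp_seq; apply: (wp_find_root (sized_find (l_K l1))) => //=.
  by rewrite ltnS ltnW.
rewrite -/i => t1 ht1.
set s2 := State _ _.
have l2 : layout (imem s2) (rmem s2 aKey) S1 K1 W1 red1 D1 T1 log1 ex1.
  apply: layout_frame l1 _ => a ha; rewrite /s2 /= upd_off //.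
  by apply: contraTneq ha => ->.
pose inv_k s3 b := exists S K W red D T log ex,
  [/\ layout (imem s3) (rmem s3 aKey) S K W red D T log ex,
    current (imem s3) K i, {in [:: 0; 4; vI], imem s3 =1 imem s1},
    forall j, j < i -> K j = imem s3 vK 0 \/ imem s3 aChosen (K j) != 0
  & b = B * potential log ex (imem s3 vCand 0)].
apply: wp_seq.
apply: (@wp_while_budget _ inv_k _ _ _ (B * potential log1 ex1 0)).
- move=> s3 b3 [S3 [K3 [W3 [red3 [D3 [T3 [log3 [ex3 [l3 [c1 c2 c3 c4] f3 g3 ->]]]]]]]]].
  rewrite /= leqn0 => /eqP ch3.
  apply: wp_mono (wp_iteration l3 c1 c3 ch3 c4) _ => s4 t4 [ht4].
  move=> [S4 [K4 [W4 [red4 [D4 [T4 [log4 [ex4 [l4 pot f4 g4 h4]]]]]]]]].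
  exists (B * potential log4 ex4 (imem s4 vCand 0)).
    exists S4, K4, W4, red4, D4, T4, log4, ex4; split => //.
    + exact: g4.
    + by move=> a ha; rewrite f4 // f3.
    + move=> j hj; apply: h4; last exact: g3.
      exact: leq_trans hj (ltnW hlt).
  apply: (@leq_trans (B * (potential log4 ex4 (imem s4 vCand 0)).+1)).
    by rewrite mulnS addnC leq_add2r /B; move: ht4; clear; lia.
  by rewrite leq_mul2l pot orbT.
- exists S1, K1, W1, red1, D1, T1, log1, ex1; split => //.
  + split; rewrite /s2 /= ?upd_hit ?upd_off // ?h1 //.
      exact: (K_lt p1).
    by rewrite (K_idem p1) // ltnW.
  + by move=> a; rewrite !inE => /or3P[/eqP ->|/eqP ->|/eqP ->]; rewrite /s2 /= upd_off.
  + move=> j hj; right; rewrite /s2 /= upd_off //; apply: h3 => //.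
    exact: ltn_trans hj hlt.
  + by rewrite /s2 /= upd_off // h1.
move=> s3 b3 t3 [S3 [K3 [W3 [red3 [D3 [T3 [log3 [ex3 [l3 [c1 c2 c3 c4] f3 g3 hb]]]]]]]]].
rewrite /= -ltnNge => ch3 ht3.
(* A pending candidate would enter the class being served, which would then have no chosen arc; but
   the loop has just found one. *)
have ca3 : imem s3 vCand 0 = 0.
  apply/eqP; case: (boolP (imem s3 vCand 0 == 0)) => // hne; exfalso.
  have [_ _ h] := i_cand (l_inv l3) hne.
  by move: ch3; rewrite -(c4 hne) h.
apply: wp_iput; rewrite /= f3 // -/i addn1.
exists (B * (potential log3 ex3 0 + (n - i.+1))).
  exists S3, K3, W3, red3, D3, T3, log3, ex3; split => /=.
  + apply: layout_frame l3 _ => a ha; rewrite upd_off //.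
    by apply: contraTneq ha => ->.
  + by rewrite upd_off.
  + by rewrite !upd_off // !f3.
  + move=> j; rewrite upd_hit ltnS upd_off // leq_eqVlt => /orP[/eqP ->|hj] hjn.
      by rewrite c2 -lt0n.
    by case: (g3 j hj) => [->|//]; rewrite -lt0n.
  + by rewrite upd_hit.
have e : n - i = (n - i.+1).+1 by move: hlt; clear; lia.
rewrite e; rewrite hb ca3 in ht3.
have : t1 + 50 <= B by rewrite /B; move: ht1; clear; lia.
move: ht3; move: (potential _ _ _) (potential _ _ _) (n - _) => x y z.
rewrite (mulnDr B y) (mulnDr B x) mulnS.
move: (B * _) (B * _) (B * _) => b1 b2 b4; clear; lia.
Qed.

Notation vArc := 44.
Notation vClass := 45.

(** The log stores no roots: without path compression, the parent of the child is again the root of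
    its merge once the later merges are undone. The head is looked up after the child has been
    detached, hence in the earlier partition. *)
Definition unroll_step : cmd :=
  Seq (vT <-- ISub (var vT) (IConst 1))
  (Seq (vChild <-- IGet aLogChild (var vT))
  (Seq (vRoot <-- IGet aParK (var vChild))
  (Seq (vArc <-- IGet aChosen (var vRoot))
  (Seq (IPut aParK (var vChild) (var vChild))
  (Seq (find_root aParK vClass (IGet aHead (var vArc)))
       (If (BIEq (var vClass) (var vChild))
           (Seq (IPut aChosen (var vChild) (var vArc))
                (IPut aChosen (var vRoot) (IGet aLogArc (var vT))))
           Skip)))))).

Definition unroll : cmd := While (BILe (IConst 1) (var vT)) unroll_step.

Definition unrolling (f : nat -> nat) s K (log : seq entry) : Prop :=
  [/\ imem s vT 0 = size log, logged (imem s) log,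
      unwinds (imem s aParK) K log, expand hd log (imem s aChosen) = f
    & forall a, imem s aHead a = hd a].

Lemma wp_unroll_step f s K e log : unrolling f s K (e :: log) ->
  wp unroll_step s (fun s' t => [/\ unrolling f s' (entry_K e) log,
     {in [:: 0; 4], imem s' =1 imem s} & t + 5 <= 100 * L.+1]).
Proof.
case=> hT [/= hc ha hl] [hpar hcn hcr hsh hu] hf hh.
apply: wp_seq; apply: wp_iput; rewrite /= hT subn1 /=.
apply: wp_seq; apply: wp_iput; rewrite /= upd_hit upd_off // hc.
apply: wp_seq; apply: wp_iput; rewrite /= upd_hit !upd_off // hpar.
apply: wp_seq; apply: wp_iput; rewrite /= upd_hit !upd_off //.
apply: wp_seq; apply: wp_iput; rewrite /= 2?upd_off // upd_hit.
set ar := imem s aChosen (entry_root e).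
set M := upd _ aParK _ _.
have eM a : a \notin [:: vT; vChild; vRoot; vArc; aParK] -> M a = imem s a.
  by rewrite !inE !negb_or => /and5P[h1 h2 h3 h4 h5]; rewrite /M !upd_off.
have eT : M vT 0 = size log by rewrite /M 4?upd_off // upd_hit.
have eC : M vChild 0 = entry_child e by rewrite /M 3?upd_off // upd_hit.
have eR : M vRoot 0 = entry_root e by rewrite /M 2?upd_off // upd_hit.
have eA : M vArc 0 = ar by rewrite /M upd_off // upd_hit.
have eP : M aParK = fun j => if j == entry_child e then entry_child e else imem s aParK j.
  by rewrite /M upd_row !upd_off.
apply: wp_seq; apply: (wp_find_root (N := n.+1) (L := L.+1) (S := entry_K e)) => //=.
  by rewrite eA eM // hh; exact: ltnW (hd_lt _).
rewrite eA eM // hh => t1 ht1.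
rewrite -/(undo hd e (imem s aChosen)) in hf.
apply: wp_if => /=; rewrite upd_hit upd_off // eC -eqn_leq => hcmp.
- apply: wp_seq; apply: wp_iput; rewrite /= !upd_off // eC eA.
  apply: wp_iput; rewrite /= !upd_off // eR eT (eM aLogArc) // ha.
  split; last by move: ht1; clear; lia.
    split => /=.
    + by rewrite !upd_off.
    + by apply: logged_frame hl; rewrite !upd_off // eM.
    + by rewrite !upd_off // eP.
    + rewrite -hf; congr expand; rewrite /undo -/ar hcmp.
      apply: funext => j; rewrite upd_row upd_row upd_off // eM //.
      case: (j =P entry_root e) => [->|//].
      by case: (_ =P entry_child e) => // h; case: hcr.
    + by move=> a; rewrite !upd_off // eM.
  by move=> a; rewrite !inE => /orP[/eqP ->|/eqP ->]; rewrite /= !upd_off // eM.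
- apply: wp_skip; split; last by move: ht1; clear; lia.
    split => /=.
    + by rewrite !upd_off.
    + by apply: logged_frame hl; rewrite !upd_off // eM.
    + by rewrite upd_off // eP.
    + by rewrite upd_off // -hf eM // /undo -/ar (negbTE hcmp).
    + by move=> a; rewrite !upd_off // eM.
  by move=> a; rewrite !inE => /orP[/eqP ->|/eqP ->]; rewrite /= !upd_off // eM.
Qed.

Lemma wp_unroll f s K log : unrolling f s K log ->
  wp unroll s (fun s' t => [/\ imem s' aChosen = f,
     forall i, i <= n -> imem s' aParK i = K0 i,
     {in [:: 0; 4], imem s' =1 imem s} & t <= 100 * L.+1 * size log + 5]).
Proof.
elim: log s K => [|e log IH] s K hu.
  case: hu => hT _ hp hf _; apply: wp_while => /=; rewrite hT // => _.
  by split => //; clear; lia.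
apply: wp_while => [_|]; last by case: hu => /= ->.
apply: wp_mono (wp_unroll_step hu) _ => s1 t1 [hu1 hf1 ht1].
apply: wp_mono (IH _ _ hu1) _ => s2 t2 [h1 h2 h3 h4]; split => //.
  by move=> a ha; rewrite h3 // hf1.
by rewrite /= mulnS; move: h4 ht1; clear; lia.
Qed.

(** After unrolling, the parent of a node is the first node of its color. Auxiliary arcs mark cells
    beyond the indices of the input arcs, which the output never reads. *)
Definition output : cmd :=
  Seq (vI <-- IConst 0)
  (While (BILe (IAdd (var vI) (IConst 1)) (var 0))
    (Seq (IPut 4 (ISub (IGet aChosen (IGet aParK (var vI))) (IConst 1)) (IConst 1))
         (vI <-- IAdd (var vI) (IConst 1)))).

Lemma wp_output s :
  imem s 0 0 = n -> (forall j, imem s 4 j = 0) ->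
  wp output s (fun s' t => t <= 40 * n + 20 /\
    forall j, (imem s' 4 j != 0) <->
      exists2 i, i < n & imem s aChosen (imem s aParK i) - 1 = j).
Proof.
move=> hn h4; apply: wp_seq; apply: wp_iput => /=.
pose I0 s1 b := [/\ imem s1 0 0 = n, imem s1 aChosen = imem s aChosen,
  imem s1 aParK = imem s aParK, imem s1 vI 0 <= n /\ b = 40 * (n - imem s1 vI 0)
  & forall j, (imem s1 4 j != 0) <->
     exists2 i, i < imem s1 vI 0 & imem s aChosen (imem s aParK i) - 1 = j].
apply: (@wp_while_budget _ I0 _ _ _ (40 * n)).
- move=> s1 b [h1 h2 h3 [h5 ->] h6] /=; rewrite h1 addn1 => hlt.
  apply: wp_seq; apply: wp_iput; rewrite /= h2 h3.
  apply: wp_iput; rewrite /= !upd_off // addn1.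
  exists (40 * (n - (imem s1 vI 0).+1)); last by move: hlt; clear; lia.
  split; rewrite /= ?upd_hit ?(upd_off _ _ _ (isT : 0 != vI)) ?(upd_off _ _ _ (isT : 4 != vI)); try by rewrite ?upd_off.
  move=> j; rewrite upd_row; case: (j =P _) => [->|ne]; split => //.
  - by move=> _; exists (imem s1 vI 0).
  - by move=> /h6 [i hi <-]; exists i => //; exact: ltnW.
  - case=> i; rewrite ltnS leq_eqVlt => /orP[/eqP ->|hi] hj; first by case: ne.
    by apply/h6; exists i.
- split; rewrite /= ?upd_hit ?upd_off // ?subn0 //.
  by move=> j; rewrite h4; split => // -[].
move=> s' b t [h1 h2 h3 [h5 ->] h6] /=; rewrite h1 addn1 -leqNgt => hle ht.
split; first by move: ht; clear; lia.
have e : imem s' vI 0 = n by apply/eqP; rewrite eqn_leq h5 hle.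
by move=> j; rewrite h6 e.
Qed.

Lemma wp_solve s S K W red D T log ex :
  layout (imem s) (rmem s aKey) S K W red D T log ex ->
  imem s vCand 0 = 0 -> imem s vI 0 = 0 -> imem s 0 0 = n ->
  log = [::] -> ex = [::] -> (forall j, imem s 4 j = 0) ->
  wp (Seq grow (Seq unroll output)) s (fun s' t =>
    t <= 1000 * L.+1 * (2 * E + 4 * n) + 100 /\
    exists g, [/\ selection n E tl hd id K0 g,
      forall g', selection n E tl hd id K0 g' ->
      (\sum_(i <- iota 0 n | K0 i == i) w0 (g i) <=
       \sum_(i <- iota 0 n | K0 i == i) w0 (g' i))%R &
      forall j, (imem s' 4 j != 0) <-> exists2 i, i < n & g (K0 i) - 1 = j]).
Proof.
move=> l hca hI hn hlog hex h4.
apply: wp_seq; apply: wp_mono (wp_grow l hca hI hn hlog hex) _.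
move=> s1 t1 [ht1 [[S1 [K1 [W1 [red1 [D1 [T1 [log1 [ex1 [l1 hca1 hch]]]]]]]]] [f0 f4]]].
have hinv := l_inv l1; rewrite hca1 in hinv.
have [k hk Kk|hsel hopt] := inv_optimal tl_le hd_lt K0_n hinv.
  by rewrite -Kk; exact: hch.
have hu : unrolling (expand hd log1 (imem s1 aChosen)) s1 K1 log1.
  split => //; [exact: l_count l1|exact: l_logged l1|exact: l_unwinds l1|].
  exact: l_head l1.
apply: wp_seq; apply: wp_mono (wp_unroll hu) _.
move=> s2 t2 [h1 h2 h3 ht2].
apply: wp_mono (@wp_output s2 _ _) _.
- by rewrite h3 // f0.
- by move=> j; rewrite h3 // f4 h4.
move=> s3 t3 [ht3 hout]; split.
  have hlog1 := log_bound l1.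
  have : 100 * L.+1 * size log1 <= 100 * L.+1 * n by rewrite leq_mul2l hlog1 orbT.
  have : 1000 * L.+1 * (2 * E + 4 * n) =
     1000 * L.+1 * (2 * E + 2 * n) + 2000 * L.+1 * n.
    by rewrite (_ : 2 * E + 4 * n = (2 * E + 2 * n) + 2 * n) ?mulnDr //; nia.
  move=> -> hb.
  have : 2000 * L.+1 * n >= 100 * L.+1 * n + 40 * n by nia.
  move: hb ht1 ht2 ht3; clear.
  move: (1000 * L.+1 * _) (100 * L.+1 * n) (100 * L.+1 * _) (2000 * L.+1 * n) => a b c d.
  by lia.
exists (expand hd log1 (imem s1 aChosen)); split => //.
move=> j; rewrite hout h1; split => -[i hi <-]; exists i => //; rewrite h2 //;
  exact: ltnW.
Qed.
End Main.

(** * Initialization *)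

Notation aFirst := 27.
Notation vJ := 31.
Notation aBound := 2.
Notation nodes_nb := (var 0).
Notation arcs_nb := (IGet 0 (IConst 1)).

(** Colors are arbitrary numbers, so [aFirst] is an array indexed by colors; it holds the first node
    plus one, 0 meaning none yet. From then on a color is named by its first node, the center of a
    star, which therefore gets rank 1. *)
Definition init_node : cmd :=
  Seq (IPut aParS (var vI) (var vI))
  (Seq (IPut aParW (var vI) (var vI))
  (Seq (If (BILe (IGet aFirst (IGet 3 (var vI))) (IConst 0))
           (Seq (IPut aFirst (IGet 3 (var vI)) (IAdd (var vI) (IConst 1)))
                (IPut aRkK (var vI) (IConst 1)))
           Skip)
  (Seq (IPut aParK (var vI) (ISub (IGet aFirst (IGet 3 (var vI))) (IConst 1)))
       (vI <-- IAdd (var vI) (IConst 1))))).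

Definition init_nodes : cmd :=
  Seq (While (BILe (IAdd (var vI) (IConst 1)) nodes_nb) init_node)
  (Seq (IPut aParS nodes_nb nodes_nb)
  (Seq (IPut aParW nodes_nb nodes_nb)
  (Seq (IPut aParK nodes_nb nodes_nb)
       (vI <-- IConst 0)))).

Notation rvar a := (RGet a (IConst 0)).

Definition init_bound : cmd :=
  Seq (RPut aBound (IConst 0) (RConst 1))
  (Seq (While (BILe (IAdd (var vJ) (IConst 1)) arcs_nb)
          (Seq (If (BRLe (RConst 0) (RGet 0 (var vJ)))
                   (RPut aBound (IConst 0) (RAdd (rvar aBound) (RGet 0 (var vJ))))
                   (RPut aBound (IConst 0) (RSub (rvar aBound) (RGet 0 (var vJ)))))
               (vJ <-- IAdd (var vJ) (IConst 1))))
       (vJ <-- IConst 0)).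

Notation next_arc := (IAdd (var vJ) (IConst 1)).

Definition init_arc : cmd :=
  Seq (If (BILe next_arc arcs_nb)
        (Seq (IPut aTail next_arc (IGet 1 (var vJ)))
        (Seq (IPut aHead next_arc (IGet 2 (var vJ)))
             (RPut aKey next_arc (RAdd (RGet 0 (var vJ)) (rvar aBound)))))
        (Seq (IPut aTail next_arc nodes_nb)
        (Seq (IPut aHead next_arc (ISub (var vJ) arcs_nb))
             (RPut aKey next_arc
                (RAdd (rvar aBound) (RAdd (rvar aBound) (rvar aBound)))))))
  (Seq (IPut aSize next_arc (IConst 1))
  (Seq (vA <-- next_arc)
  (Seq (vQ <-- IGet aParK (IGet aHead next_arc))
  (Seq (vB <-- IGet aHeap (var vQ))
  (Seq meld
  (Seq (IPut aHeap (var vQ) (IGet aNext (IConst 0)))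
       (vJ <-- next_arc))))))).

Definition init_arcs : cmd :=
  While (BILe next_arc (IAdd nodes_nb arcs_nb)) init_arc.

Definition rainbow_program : cmd :=
  Seq init_nodes (Seq init_bound (Seq init_arcs
    (Seq grow (Seq unroll output)))).

Section Init.
Variable R : realType.
Variables n m L : nat.
Variables src dst col : nat -> nat.
Variable w : nat -> R.
Implicit Types (s : state R).

Hypothesis n_gt0 : 0 < n.
Hypothesis src_lt : forall j, j < m -> src j < n.
Hypothesis dst_lt : forall j, j < m -> dst j < n.

Let E := m + n.

Definition colors := mkseq col n.

Definition first_node i := if i < n then index (col i) colors else i.

(** Numbers 1 to m are the input arcs, and m + 1 + i is the auxiliary arc to node i. All other
    numbers get 0, the content of a cell never written, so that the arrays agree with these
    functions everywhere. *)
Definition arc_tail a :=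
  if a is j.+1 then if j < m then src j else if j < E then n else 0 else 0.

Definition arc_head a :=
  if a is j.+1 then if j < m then dst j else if j < E then j - m else 0 else 0.

Definition weight_bound : R := (1 + \sum_(j <- iota 0 m) `|w j|)%R.

(* Auxiliary arcs are so heavy that using as few of them as possible has
   priority over the weights of the arcs of the digraph. *)
Definition arc_weight a : R :=
  if a.-1 < m then (w a.-1 + weight_bound)%R
  else (weight_bound + (weight_bound + weight_bound))%R.

Lemma size_colors : size colors = n. Proof. exact: size_mkseq. Qed.

Lemma nth_colors i : i < n -> nth 0 colors i = col i.
Proof. by move=> h; rewrite nth_mkseq. Qed.

Lemma first_node_lt i : i < n -> first_node i < n.
Proof.
move=> h; rewrite /first_node h -[X in _ < X]size_colors index_mem.
by rewrite -(nth_colors h); apply: mem_nth; rewrite size_colors.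
Qed.

Lemma first_node_color i : i < n -> col (first_node i) = col i.
Proof.
move=> h; rewrite -(nth_colors (first_node_lt h)) /first_node h nth_index //.
by rewrite -(nth_colors h); apply: mem_nth; rewrite size_colors.
Qed.

Lemma first_node_idem i : i < n -> first_node (first_node i) = first_node i.
Proof.
move=> h; rewrite {1}/first_node first_node_lt // first_node_color //.
by rewrite /first_node h.
Qed.

Lemma first_node_eq i j : i < n -> j < n ->
  (first_node i == first_node j) = (col i == col j).
Proof.
move=> hi hj; apply/eqP/eqP => [e|e].
  by rewrite -(first_node_color hi) e first_node_color.
by rewrite /first_node hi hj e.
Qed.

Lemma first_node_n : first_node n = n.
Proof. by rewrite /first_node ltnn. Qed.

Lemma arc_tail_le a : arc_tail a <= n.
Proof.
case: a => //= j; case: ifP => [/src_lt /ltnW //|_].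
by case: ifP.
Qed.

Lemma arc_head_lt a : arc_head a < n.
Proof.
case: a => //= j; case: ifP => [/dst_lt //|]; case: ifP => //.
by rewrite /E; lia.
Qed.

Lemma source_arc_init i : i < n ->
  exists a, [/\ arc E a, arc_tail a = n & arc_head a = i].
Proof.
move=> hi; exists (m + i).+1; rewrite /arc /= /E.
have -> : (m + i < m) = false by lia.
have h : m + i < m + n by lia.
by rewrite h; split => //; lia.
Qed.

Lemma weight_bound_ge j : j < m -> (`|w j| < weight_bound)%R.
Proof.
move=> hj; rewrite /weight_bound (big_rem j) ?mem_iota //= addrCA.
rewrite ltrDl; apply: ltr_wpDr; [|by rewrite ltr01].
by apply: sumr_ge0 => i _.
Qed.

Lemma weight_bound_gt0 : (0 < weight_bound)%R.
Proof. by apply: ltr_wpDr; [apply: sumr_ge0 => i _|exact: ltr01]. Qed.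

Lemma arc_weight_ge0 a : arc E a -> (0 <= arc_weight a)%R.
Proof.
move=> _; rewrite /arc_weight; case: ifP => [h|_].
  have := weight_bound_ge h; rewrite ltr_norml => /andP[h1 _]; lra.
have := weight_bound_gt0; lra.
Qed.

Lemma index_new x i : i < n -> col i = x -> x \notin take i colors ->
  index x colors = i.
Proof.
move=> hi hx hn; rewrite -(cat_take_drop i colors) index_cat (negbTE hn).
have hs : i < size colors by rewrite size_colors.
rewrite (drop_nth 0 hs) nth_colors // hx /= eqxx addn0 size_take hs //.
Qed.

Lemma index_old x i : x \in take i colors -> index x colors < i.
Proof.
move=> h; rewrite -(cat_take_drop i colors) index_cat h.
have := h; rewrite -index_mem => h2; apply: leq_trans h2 _.
by rewrite size_take; case: ifP => // /negbT; rewrite -leqNgt.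
Qed.

Section Run.
Hypothesis n_L : n.+1 <= 2 ^ L.
Hypothesis E_L : E.+1 <= 2 ^ (2 * L).
Variable s0 : state R.
Hypothesis s0_n : imem s0 0 0 = n.
Hypothesis s0_m : imem s0 0 1 = m.
Hypothesis s0_src : forall j, j < m -> imem s0 1 j = src j.
Hypothesis s0_dst : forall j, j < m -> imem s0 2 j = dst j.
Hypothesis s0_col : forall i, i < n -> imem s0 3 i = col i.
Hypothesis s0_w : forall j, j < m -> rmem s0 0 j = w j.
Hypothesis s0_0 : forall a i, 3 < a -> imem s0 a i = 0.

Definition nodes_ready i s : Prop :=
  [/\ forall j, imem s aParS j = if j < i then j else 0,
      forall j, imem s aParW j = if j < i then j else 0,
      forall j, imem s aParK j = if j < i then first_node j else 0,
      forall j, imem s aRkK j = ((j < i) && (j < n) && (first_node j == j))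
    & (forall a, a \notin [:: vI; aParS; aParW; aParK; aRkK; aFirst] ->
         imem s a = imem s0 a) /\ rmem s = rmem s0].

Lemma wp_init_node i s : i < n -> imem s vI 0 = i ->
  nodes_ready i s ->
  (forall x, imem s aFirst x =
     if x \in take i colors then (index x colors).+1 else 0) ->
  wp init_node s (fun s' t => [/\ imem s' vI 0 = i.+1, nodes_ready i.+1 s',
   (forall x, imem s' aFirst x =
     if x \in take i.+1 colors then (index x colors).+1 else 0) & t <= 60]).
Proof.
move=> hi hI [h1 h2 h3 h4 [h5 h6]] hF.
have hnth : nth 0 colors i = col i by rewrite nth_colors.
have htake : take i.+1 colors = rcons (take i colors) (col i).
  by rewrite (take_nth 0) ?size_colors // hnth.
have lt1 j : (j < i.+1) = (j == i) || (j < i) by rewrite ltnS leq_eqVlt.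
apply: wp_seq; apply: wp_iput; rewrite /= hI.
apply: wp_seq; apply: wp_iput; rewrite /= !upd_off // hI.
apply: wp_seq.
set M := upd _ aParW _ _.
have eM a : a \notin [:: aParS; aParW] -> M a = imem s a.
  by rewrite !inE !negb_or => /andP[? ?]; rewrite /M !upd_off.
have eS : M aParS = fun j => if j == i then i else imem s aParS j.
  by rewrite /M upd_off // upd_row.
have eW : M aParW = fun j => if j == i then i else imem s aParW j.
  by rewrite /M upd_row upd_off.
have col_i : M 3 i = col i by rewrite eM // h5 // s0_col.
have rest s1 t1 : t1 <= 25 -> rmem s1 = rmem s0 ->
  (forall a, a \notin [:: aFirst; aRkK] -> imem s1 a = M a) ->
  (forall j, imem s1 aRkK j = ((j < i.+1) && (j < n) && (first_node j == j))) ->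
  (forall x, imem s1 aFirst x =
     if x \in take i.+1 colors then (index x colors).+1 else 0) ->
  wp (Seq (IPut aParK (var vI) (ISub (IGet aFirst (IGet 3 (var vI))) (IConst 1)))
       (vI <-- IAdd (var vI) (IConst 1))) s1 (fun s' t =>
   [/\ imem s' vI 0 = i.+1, nodes_ready i.+1 s',
   (forall x, imem s' aFirst x =
     if x \in take i.+1 colors then (index x colors).+1 else 0) & 5 + (5 + (t1 + t)) <= 60]).
  move=> ht1 hr1 hs1 hrk hf1.
  have e1 : imem s1 vI 0 = i by rewrite hs1 // eM.
  apply: wp_seq; apply: wp_iput; rewrite /= e1 (hs1 3) // col_i hf1.
  rewrite htake mem_rcons mem_head subn1 /=.
  apply: wp_iput; rewrite /= (@upd_off _ (imem s1) aParK vI) // e1 addn1.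
  split => /=; [by rewrite upd_hit| | |by move: ht1; clear; lia].
    split => /=.
    - move=> j; rewrite !upd_off // hs1 // eS h1 lt1.
      by case: (j =P i) => [->|].
    - move=> j; rewrite !upd_off // hs1 // eW h2 lt1.
      by case: (j =P i) => [->|].
    - move=> j; rewrite upd_off // upd_row hs1 // eM // h3 lt1.
      by case: (j =P i) => [->|] //; rewrite /first_node hi.
    - by move=> j; rewrite !upd_off.
    - split => // a; rewrite !inE !negb_or => /and5P[a1 a2 a3 a4 /andP[a5 a6]].
      rewrite !upd_off // hs1 ?inE ?negb_or ?a5 ?a6 //.
      by rewrite eM ?h5 // ?inE ?negb_or ?a1 ?a2 ?a3 ?a4 ?a5.
  by move=> x; rewrite !upd_off // hf1 htake.
apply: wp_if; rewrite /= leqn0 !eM // hI (h5 3) // s0_col // hF => hb.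
- have hnew : col i \notin take i colors by move: hb; case: ifP.
  have hidx := index_new hi erefl hnew.
  apply: wp_seq; apply: wp_iput; rewrite /= !eM // hI (h5 3) // s0_col // addn1.
  apply: wp_iput; rewrite /= upd_off // eM // hI.
  apply: rest => //=.
  + move=> a; rewrite !inE negb_or => /andP[a1 a2]; by rewrite !upd_off.
  + move=> j; rewrite upd_row upd_off // eM // h4 lt1.
    by case: (j =P i) => [->|//]; rewrite hi /first_node hi hidx eqxx.
  + move=> x; rewrite upd_off // upd_row eM // hF htake mem_rcons inE.
    by case: (x =P col i) => [->|//]; rewrite hidx.
- have hold : col i \in take i colors by move: hb; case: ifP.
  have hidx := index_old hold.
  apply: wp_skip; apply: rest => //=.
  + by move=> j; rewrite eM // h4 lt1; case: (j =P i) => [->|//];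
       rewrite ltnn /first_node hi ltn_eqF // andbF.
  + move=> x; rewrite eM // hF htake mem_rcons inE.
    by case: (x =P col i) => [->|//]; rewrite hold.
Qed.

Lemma wp_init_nodes :
  wp init_nodes s0 (fun s' t => [/\
    forall j, j <= n -> imem s' aParS j = j /\ imem s' aParW j = j /\
       imem s' aParK j = first_node j,
    forall j, imem s' aRkK j = ((j < n) && (first_node j == j)),
    (forall a, a \notin [:: aParS; aParW; aParK; aRkK; aFirst; vI] ->
         imem s' a = imem s0 a) /\ imem s' vI 0 = 0,
    rmem s' = rmem s0 & t <= 100 * n + 60]).
Proof.
pose I0 s b := [/\ imem s vI 0 <= n, nodes_ready (imem s vI 0) s,
   (forall x, imem s aFirst x = if x \in take (imem s vI 0) colors
       then (index x colors).+1 else 0) & b = 100 * (n - imem s vI 0)].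
apply: wp_seq; apply: (@wp_while_budget _ I0 _ _ _ (100 * n)).
- move=> s b [h1 h2 h3 ->]; have [_ _ _ _ [h4 _]] := h2.
  rewrite /= (h4 0) // s0_n addn1 => hlt.
  apply: wp_mono (wp_init_node hlt erefl h2 h3) _ => s1 t1 [g1 g2 g3 g4].
  exists (100 * (n - (imem s vI 0).+1)); first by split; rewrite ?g1.
  by move: hlt g4; clear; lia.
- have e : imem s0 vI 0 = 0 by rewrite s0_0.
  split; rewrite ?e ?subn0 //.
    by split => // *; rewrite s0_0.
  by move=> x; rewrite take0 s0_0.
move=> s b t [h1 h2 h3 ->]; have [q1 q2 q3 q4 [q5 q6]] := h2.
rewrite /= (q5 0) // s0_n addn1 -leqNgt => hge ht.
have e : imem s vI 0 = n by apply/eqP; rewrite eqn_leq h1 hge.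
rewrite e in q1 q2 q3 q4.
apply: wp_seq; apply: wp_iput; rewrite /= (q5 0) // s0_n.
apply: wp_seq; apply: wp_iput; rewrite /= upd_off // (q5 0) // s0_n.
apply: wp_seq; apply: wp_iput; rewrite /= !upd_off // (q5 0) // s0_n.
apply: wp_iput => /=; split => //=.
- move=> j hj; rewrite /upd /= q1 q2 q3 (ltn_neqAle j) hj andbT.
  by case: (j =P n) => [->|]; rewrite ?first_node_n.
- by move=> j; rewrite !upd_off // q4; case: (j < n).
- split; last by rewrite upd_hit.
  move=> a; rewrite !inE !negb_or => /and5P[a1 a2 a3 a4 /andP[a5 a6]].
  by rewrite !upd_off // q5 // !inE !negb_or a1 a2 a3 a4 a5 a6.
- by move: ht; clear; lia.
Qed.

Lemma wp_init_bound s :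
  imem s 0 = imem s0 0 -> imem s vJ 0 = 0 -> rmem s = rmem s0 ->
  wp init_bound s (fun s' t => [/\ rmem s' aBound 0 = weight_bound,
    forall a, a != aBound -> rmem s' a = rmem s0 a,
    forall a, a != vJ -> imem s' a = imem s a,
    imem s' vJ 0 = 0 & t <= 60 * m + 40]).
Proof.
move=> h0 hJ hr; apply: wp_seq; apply: wp_rput => /=.
pose I0 s1 b := [/\ imem s1 vJ 0 <= m,
  (rmem s1 aBound 0 = 1 + \sum_(k <- iota 0 (imem s1 vJ 0)) `|w k|)%R,
  forall a, a != aBound -> rmem s1 a = rmem s0 a,
  forall a, a != vJ -> imem s1 a = imem s a & b = 60 * (m - imem s1 vJ 0)].
apply: wp_seq; apply: (@wp_while_budget _ I0 _ _ _ (60 * m)).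
- move=> s1 b [h1 h2 h3 h4 ->]; rewrite /= (h4 0) // h0 s0_m addn1 => hlt.
  have step x : x = (rmem s1 aBound 0 + `|w (imem s1 vJ 0)|)%R -> forall t, t <= 20 ->
     wp (vJ <-- IAdd (var vJ) (IConst 1))
        (State (imem s1) (upd (rmem s1) aBound 0 x))
        (fun s2 t2 => exists2 k1, I0 s2 k1 &
          k1 + (((2 + 1).+1 + 2).+1 + (t + t2)).+1 <= 60 * (m - imem s1 vJ 0)).
    move=> -> t ht; apply: wp_iput; rewrite /= addn1.
    exists (60 * (m - (imem s1 vJ 0).+1)); last by move: hlt ht; clear; lia.
    split; cbn [imem rmem]; rewrite ?upd_hit //.
    + by rewrite h2 -addrA -(addn1 (imem s1 vJ 0)) iotaD big_cat /= big_seq1.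
    + by move=> a ha; rewrite upd_off // h3.
    + by move=> a ha; rewrite upd_off // h4.
  apply: wp_seq; apply: wp_if => /= hs; apply: wp_rput => /=; apply: step => //=.
  + by move: hs; rewrite h3 // s0_w // => /ger0_norm ->.
  + by move: hs; rewrite h3 // s0_w // -ltNge => /ltr0_norm ->.
- split; rewrite /= ?hJ ?big_nil ?addr0 ?upd_hit ?subn0 //.
  by move=> a ha; rewrite upd_off // hr.
move=> s1 b t [h1 h2 h3 h4 ->]; rewrite /= (h4 0) // h0 s0_m addn1 -leqNgt => hge ht.
have e : imem s1 vJ 0 = m by apply/eqP; rewrite eqn_leq h1 hge.
apply: wp_iput => /=; split; rewrite ?upd_hit //.
- by rewrite h2 e.
- by move=> a ha; rewrite upd_off // h4.
- by move: ht; clear; lia.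
Qed.

(** * Building the initial heaps *)

Section Arcs.
Variable s1 : state R.
Hypothesis s1_0 : forall a, a < 4 -> imem s1 a = imem s0 a.
Hypothesis s1_n : imem s1 0 = imem s0 0.
Hypothesis s1_K : forall j, j <= n -> imem s1 aParK j = first_node j.
Hypothesis s1_w : rmem s1 0 = rmem s0 0.
Hypothesis s1_M : rmem s1 aBound 0 = weight_bound.
Hypothesis s1_J : imem s1 vJ 0 = 0.
Hypothesis s1_zero : forall a i,
  a \in [:: aTail; aHead; aHeap; aNext; aSize] -> imem s1 a i = 0.

Definition arc_arrays := [:: aTail; aHead; aHeap; vQ; vJ] ++ scratch.

(** The slots beyond [j + j + 1] are those of later arcs; that they are still 0 makes the next arc a
    leaf. *)
Definition heaps_ready j s (T : nat -> tree) : Prop :=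
  [/\ forall k, k < n -> first_node k = k ->
    [/\ uniq (keys (T k)), ordered arc_weight (T k), balanced (T k) &
        repr (imem s aNext) (imem s aSize) (rmem s aKey) arc_weight 0
          (imem s aHeap k) (T k)],
   forall k a, k < n -> first_node k = k ->
     (a \in keys (T k)) = (0 < a <= j) && (first_node (arc_head a) == k),
   forall a, imem s aTail a = (if a <= j then arc_tail a else 0) /\
             imem s aHead a = (if a <= j then arc_head a else 0),
   (forall p, j + j + 1 < p -> imem s aNext p = 0) /\ imem s aSize 0 = 0
   & (forall a, a \notin arc_arrays -> imem s a = imem s1 a) /\
     (forall a, a != aKey -> rmem s a = rmem s1 a)].

Lemma wp_init_arc j s T : j < E -> imem s vJ 0 = j -> heaps_ready j s T ->
  wp init_arc s (fun s' t => [/\ imem s' vJ 0 = j.+1,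
    exists T', heaps_ready j.+1 s' T' & t <= 280 * L + 300]).
Proof.
move=> hj hJ [hT hmem hth [hN hS0] [hI hR]].
have hIn : imem s 0 0 = n by rewrite hI // s1_n.
have hIm : imem s 0 1 = m by rewrite hI // s1_n.
set x := j.+1.
set k := first_node (arc_head x).
have hk : k < n by apply: first_node_lt; exact: arc_head_lt.
have Kk : first_node k = k by apply: first_node_idem; exact: arc_head_lt.
have [hu ho hb hr] := hT k hk Kk.
have hxT i : i < n -> first_node i = i -> x \notin keys (T i).
  by move=> hi Ki; rewrite (hmem i x hi Ki) /= ltnn.
have rest f g t1 : t1 <= 40 ->
  (forall a, a \notin [:: aTail; aHead] -> f a = imem s a) ->
  (forall i, f aTail i = if i == x then arc_tail x else imem s aTail i) ->
  (forall i, f aHead i = if i == x then arc_head x else imem s aHead i) ->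
  (forall a, a != aKey -> g a = rmem s a) ->
  (forall i, g aKey i = if i == x then arc_weight x else rmem s aKey i) ->
  wp (Seq (IPut aSize next_arc (IConst 1))
  (Seq (vA <-- next_arc)
  (Seq (vQ <-- IGet aParK (IGet aHead next_arc))
  (Seq (vB <-- IGet aHeap (var vQ))
  (Seq meld
  (Seq (IPut aHeap (var vQ) (IGet aNext (IConst 0)))
       (vJ <-- next_arc))))))) (State f g)
   (fun s' t => [/\ imem s' vJ 0 = j.+1,
    exists T', heaps_ready j.+1 s' T' & t1 + t <= 280 * L + 300]).
  move=> ht1 hf hft hfh hg hgk.
  have fJ : f vJ 0 = j by rewrite hf.
  have fH : f aHead x = arc_head x by rewrite hfh eqxx.
  have fK : f aParK (arc_head x) = k.
    by rewrite hf // hI // s1_K // ltnW // arc_head_lt.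
  apply: wp_seq; apply: wp_iput; rewrite /= fJ addn1 -/x.
  apply: wp_seq; apply: wp_iput; rewrite /= upd_off // fJ addn1 -/x.
  apply: wp_seq; apply: wp_iput; rewrite /= !upd_off // fJ addn1 -/x fH fK.
  apply: wp_seq; apply: wp_iput; rewrite /= upd_hit !upd_off // hf //.
  set M := upd _ vB 0 _.
  have eM a : a \notin [:: aTail; aHead; aSize; vA; vQ; vB] -> M a = imem s a.
    rewrite !inE !negb_or => /and5P[h1 h2 h3 h4 /andP[h5 h6]].
    by rewrite /M !upd_off // hf // !inE negb_or h1.
  have MS i : M aSize i = if i == x then 1 else imem s aSize i.
    by rewrite /M 3?upd_off // upd_row hf.
  have MA : M vA 0 = x by rewrite /M 2?upd_off // upd_hit.
  have MB : M vB 0 = imem s aHeap k by rewrite /M upd_hit.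
  have MQ : M vQ 0 = k by rewrite /M upd_off // upd_hit.
  have MT : M aTail = f aTail /\ M aHead = f aHead by rewrite /M !upd_off.
  have keep i : i < n -> first_node i = i ->
     repr (M aNext) (M aSize) (g aKey) arc_weight 0 (imem s aHeap i) (T i).
    move=> hi Ki; have [_ _ _ hri] := hT i hi Ki.
    apply: (repr_ext (y := 0%R)) hri; last by rewrite subr0.
    move=> z hz; have hzx : (z == x) = false.
      by apply: contraNF (hxT i hi Ki) => /eqP <-.
    by rewrite eM // MS hgk hzx subr0.
  have hm : wp meld (State M g) (fun s' t =>
    merged arc_weight 0%R (State M g) (Node x Leaf Leaf) (T k) 0 s' /\
    t <= 140 * (spine (Node x Leaf Leaf) + spine (T k)) + 45).
    apply: wp_meld => //=.
    - by rewrite hxT.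
    - by rewrite MS /= hS0.
    - split => //; first by rewrite MS eqxx.
      + by rewrite hgk eqxx subr0.
      + by rewrite !eM // !hN // /x; lia.
    - by rewrite MB; exact: keep.
  have hsp : spine (T k) <= 2 * L.
    apply: spine_le => //; apply: leq_trans E_L; rewrite ltnS -(size_iota 1 E).
    apply: uniq_leq_size => // a; rewrite (hmem k a hk Kk) mem_iota add1n ltnS.
    by case/andP => /andP[-> ha] _; apply: leq_trans ha (ltnW hj).
  apply: wp_seq; apply: wp_mono hm _ => s2 t2 [[[tr [hp hto htb hrt]] hN2 hSK hF hFr] ht2].
  rewrite /= in hp hN2 hSK hF hFr ht2.
  have s2Q : imem s2 vQ 0 = k by rewrite hF.
  have s2J : imem s2 vJ 0 = j by rewrite hF // eM.
  apply: wp_seq; apply: wp_iput; rewrite /= s2Q.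
  apply: wp_iput; rewrite /= (@upd_off _ (imem s2) aHeap vJ) // s2J addn1.
  set M' := upd _ vJ 0 _.
  have eM' a : a != aHeap -> a != vJ -> M' a = imem s2 a.
    by move=> h1 h2; rewrite /M' !upd_off.
  have MH i : M' aHeap i = if i == k then imem s2 aNext 0 else imem s aHeap i.
    by rewrite /M' upd_off // upd_row (hF aHeap) // eM.
  have trmem a : (a \in keys tr) = (a == x) || (a \in keys (T k)).
    by rewrite (perm_mem hp) inE.
  split => /=; [by rewrite /M' upd_hit| |by move: ht1 ht2 hsp; clear; lia].
  exists (fun i => if i == k then tr else T i); split => /=.
  - move=> i hi Ki; rewrite MH !eM' //; case: (i =P k) => [_|hik].
      split => //; rewrite (perm_uniq hp) /= hxT //.
    have [hu1 ho1 hb1 hr1] := hT i hi Ki; split => //.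
    apply: (repr_ext (y := 0%R)) (keep i hi Ki); last by rewrite subr0.
    move=> z hz; have z0 := repr_gt0 hr1 hz.
    have hz' : z \notin x :: keys (T k).
      rewrite inE negb_or; apply/andP; split.
        by apply: contraNneq (hxT i hi Ki) => <-.
      move: hz; rewrite (hmem i z hi Ki) (hmem k z hk Kk) => /andP[_ /eqP ->].
      by rewrite negb_and; apply/orP; right; apply/eqP.
    have [-> ->] := hSK _ hz'.
    rewrite !hN2 ?slot_left ?slot_right // ?subr0 //.
      by rewrite addn1.
    by rewrite -lt0n addn_gt0 z0.
  - move=> i a hi Ki.
    have hle : (0 < a <= j.+1) = (a == x) || (0 < a <= j).
      rewrite (leq_eqVlt a) ltnS -/x; case: (a =P x) => [->|] //=.
    rewrite hle; case: (i =P k) => [->|hik].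
      rewrite trmem (hmem k a hk Kk); case: (a =P x) => [->|//] /=.
      by rewrite /k -/x eqxx.
    rewrite (hmem i a hi Ki); case: (a =P x) => [->|//] /=.
    by rewrite ltnn /=; apply/esym/eqP => h; apply: hik.
  - move=> a; rewrite !eM' // !hF // MT.1 MT.2 hft hfh.
    have [-> ->] := hth a; rewrite (leq_eqVlt a j.+1) ltnS -/x.
    by case: (a =P x) => [->|].
  - split.
      move=> p hp2; rewrite eM' // hN2.
      + by rewrite eM // hN //; move: hp2; rewrite /x; clear; lia.
      + by move: hp2; case: (p).
      + rewrite mem_slots; apply/hasPn => z; rewrite inE (hmem k z hk Kk).
        move=> hz; have {}hz : z <= x.
          by case/orP: hz => [/eqP -> //|/andP[/andP[_ h] _]]; exact: leqW.
        by move: hp2 hz; rewrite /x; clear; lia.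
    rewrite eM' //; have [|-> _] := hSK 0; last by rewrite MS /= hS0.
    by rewrite inE /= (hmem k 0 hk Kk).
  - split; last by move=> a ha; rewrite hFr // hg // hR.
    move=> a; rewrite /arc_arrays mem_cat negb_or => /andP[ha1 ha2].
    have ha3 : a \notin [:: aTail; aHead; aHeap; vQ; vJ] by [].
    move: ha1; rewrite !inE !negb_or => /and5P[a1 a2 a3 a4 a5].
    have ha6 : a \notin [:: aTail; aHead; aSize; vA; vQ; vB].
      rewrite !inE !negb_or a1 a2 a4 /= .
      by move: ha2; rewrite !inE !negb_or => /and5P[_ -> -> -> _].
    rewrite eM' // hF // eM // hI // /arc_arrays mem_cat negb_or ha2.
    by rewrite ha3.
apply: wp_seq; apply: wp_if; rewrite /= hJ hIm addn1 -/x => hjm.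
- have hjm' : j < m by [].
  apply: wp_seq; apply: wp_iput; rewrite /= hJ addn1 -/x (hI 1) // s1_0 // s0_src //.
  apply: wp_seq; apply: wp_iput; rewrite /= !upd_off // hJ addn1 -/x (hI 2) // s1_0 // s0_dst //.
  apply: wp_rput; rewrite /= !upd_off // hJ addn1 -/x !hR // s1_w s0_w // s1_M.
  apply: rest => //=.
  + move=> a; rewrite !inE negb_or => /andP[a1 a2]; by rewrite !upd_off.
  + by move=> i; rewrite upd_off // upd_row /arc_tail /= hjm'.
  + by move=> i; rewrite upd_row upd_off // /arc_head /= hjm'.
  + by move=> a ha; rewrite upd_off.
  + by move=> i; rewrite upd_row /arc_weight /= hjm'.
- have hjm' : (j < m) = false by apply/negbTE; rewrite -leqNgt in hjm *.
  apply: wp_seq; apply: wp_iput; rewrite /= hJ addn1 -/x hIn.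
  apply: wp_seq; apply: wp_iput; rewrite /= !upd_off // hJ addn1 -/x hIm.
  apply: wp_rput; rewrite /= !upd_off // hJ addn1 -/x !hR // s1_M.
  apply: rest => //=.
  + move=> a; rewrite !inE negb_or => /andP[a1 a2]; by rewrite !upd_off.
  + by move=> i; rewrite upd_off // upd_row /arc_tail /= hjm' hj.
  + by move=> i; rewrite upd_row upd_off // /arc_head /= hjm' hj.
  + by move=> a ha; rewrite upd_off.
  + by move=> i; rewrite upd_row /arc_weight /= hjm'.
Qed.

Lemma wp_init_arcs :
  wp init_arcs s1 (fun s' t => (exists T, heaps_ready E s' T) /\
    t <= (280 * L + 320) * E + 20).
Proof.
pose I0 s b := [/\ imem s vJ 0 <= E, exists T, heaps_ready (imem s vJ 0) s T
  & b = (280 * L + 320) * (E - imem s vJ 0)].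
have hE s T j : heaps_ready j s T -> imem s 0 0 = n /\ imem s 0 1 = m.
  by case=> _ _ _ _ [h _]; rewrite h // s1_n.
apply: (@wp_while_budget _ I0 _ _ _ ((280 * L + 320) * E)).
- move=> s b [h1 [T hT] ->]; have [e1 e2] := hE _ _ _ hT.
  rewrite /= e1 e2 addn1 [n + m]addnC -/E => hlt.
  apply: wp_mono (wp_init_arc hlt erefl hT) _ => s2 t2 [g1 g2 g3].
  exists ((280 * L + 320) * (E - (imem s vJ 0).+1)); first by split; rewrite ?g1.
  have -> : E - imem s vJ 0 = (E - (imem s vJ 0).+1).+1 by move: hlt; clear; lia.
  by rewrite mulnS; move: g3; move: (_ * (E - _)) => z; clear; lia.
- split; rewrite ?s1_J ?subn0 //.
  exists (fun _ => Leaf); split => //=.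
  + by move=> k hk Kk; split => //; rewrite s1_zero.
  + by move=> k a hk Kk; case: a.
  + by move=> a; rewrite !s1_zero //; case: a.
  + by split; [move=> p _|]; rewrite s1_zero.
move=> s b t [h1 [T hT] ->]; have [e1 e2] := hE _ _ _ hT.
rewrite /= e1 e2 addn1 [n + m]addnC -/E -leqNgt => hge ht.
have e : imem s vJ 0 = E by apply/eqP; rewrite eqn_leq h1 hge.
split; first by exists T; rewrite -e.
by move: ht; clear; lia.
Qed.


End Arcs.

Lemma inv_init T :
  (forall k a, k < n -> first_node k = k ->
     (a \in keys (T k)) = (0 < a <= E) && (first_node (arc_head a) == k)) ->
  inv n E arc_tail arc_head first_node arc_weight id first_node id (fun=> 0)
    arc_weight 0%R (fun k => keys (T k)) [::] 0.
Proof.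
move=> hmem; split => //.
- split => //; [exact: first_node_lt|move=> i hi|exact: first_node_n|
    exact: first_node_idem].
  move: hi; rewrite leq_eqVlt => /orP[/eqP ->|]; last exact: first_node_idem.
  by rewrite !first_node_n.
- move=> k hk Kk; rewrite addnC; congr (_ + _).
    rewrite -(ncount1 hk); apply: eq_ncount => i hi.
    case: (i =P k) => [->|ne]; first by rewrite Kk eqxx.
    case: (first_node i =P i) => //= ->; exact/esym/eqP.
  by apply: eq_ncount => i hi; rewrite eqxx.
- move=> g hg; rewrite add0r [leLHS]big_mkcond [leRHS]big_mkcond /=.
  rewrite [leLHS]big_seq [leRHS]big_seq; apply: ler_sum => i.
  rewrite mem_iota /= => hi; case: (first_node i =P i) => //= Ki.
  case: ifP => // _; apply: arc_weight_ge0; by case: (hg.1 i hi Ki).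
- by move=> f _ h _; split => //; rewrite add0r.
- by exists id => // k _ _ /eqP.
- move=> k a hk Kk; rewrite hmem // => /andP[ha /eqP hka]; split => //.
  exact: arc_weight_ge0.
- move=> a ha; constructor 1; rewrite hmem ?eqxx ?andbT //.
    by apply: first_node_lt; exact: arc_head_lt.
  by apply: first_node_idem; exact: arc_head_lt.
- by move=> a ha _; exact: arc_weight_ge0.
Qed.

Lemma sized_id par rk : (forall i, i <= n -> par i = i) -> (forall i, rk i = 0) ->
  sized n.+1 par rk id.
Proof.
move=> hp hr; split; first by split=> i hi; rewrite ?hp ?eqxx.
by move=> i hi _; rewrite hr (ncount1 hi).
Qed.

Lemma ncount_gt0 N (p : nat -> bool) i : i < N -> p i -> 0 < ncount N p.
Proof.
move=> hi hpi; rewrite /ncount -has_count; apply/hasP; exists i => //.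
by rewrite mem_iota.
Qed.

Lemma sized_first_node par (rk : nat -> nat) : (forall i, i <= n -> par i = first_node i) ->
  (forall i, rk i = ((i < n) && (first_node i == i))) ->
  sized n.+1 par rk first_node.
Proof.
move=> hp hr.
have lt i : i < n.+1 -> first_node i < n.+1.
  rewrite ltnS leq_eqVlt => /orP[/eqP ->|/first_node_lt /ltnW //].
  by rewrite first_node_n.
have idem i : i < n.+1 -> first_node (first_node i) = first_node i.
  rewrite ltnS leq_eqVlt => /orP[/eqP ->|/first_node_idem //].
  by rewrite !first_node_n.
split; first split => //.
- by move=> i hi; rewrite hp // lt.
- by move=> i hi; rewrite hp // idem.
- by move=> i hi; rewrite hp.
- move=> i hi; rewrite hp // => hne; rewrite !hr (negbTE hne) andbF.
  have hin : i < n.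
    rewrite ltn_neqAle -ltnS hi andbT; apply: contraNneq hne => ->.
    by rewrite first_node_n.
  by rewrite idem // eqxx first_node_lt.
move=> i hi Ki; have h := @ncount_gt0 n.+1 (fun j => first_node j == i) i hi.
have {}h : 0 < ncount n.+1 (fun j => first_node j == i) by apply: h; rewrite Ki.
apply: (@leq_trans (2 * 1)); last by rewrite leq_mul2l.
by rewrite hr; case: (_ && _).
Qed.

Lemma layout_init s1 s T : heaps_ready s1 E s T ->
  (forall j, j <= n -> imem s1 aParS j = j /\ imem s1 aParW j = j /\
       imem s1 aParK j = first_node j) ->
  (forall j, imem s1 aRkK j = ((j < n) && (first_node j == j))) ->
  (forall a i, a \in [:: aRkS; aRkW; aChosen; vT; vCand] -> imem s1 a i = 0) ->
  layout n E L arc_tail arc_head first_node arc_weight (imem s) (rmem s aKey)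
    id first_node id arc_weight 0%R T [::] [::].
Proof.
move=> [hT hmem hth [_ hS0] [hI hR]] hpar hrk h0.
have e0 a i : a \in [:: aRkS; aRkW; aChosen; vT; vCand] -> imem s a i = 0.
  move=> ha; rewrite hI ?h0 //.
  by move: ha; rewrite !inE; do 4 (case/orP; first by move/eqP ->); move/eqP ->.
have hch : imem s aChosen = fun=> 0 by apply: funext => i; rewrite e0.
split => //.
- move=> a; have [-> _] := hth a; case: ifP => // h; rewrite /arc_tail.
  case: a h => //= j h; rewrite h; case: ifP => // hjm.
  by move: h hjm; rewrite /E; clear; lia.
- move=> a; have [_ ->] := hth a; case: ifP => // h; rewrite /arc_head.
  case: a h => //= j h; rewrite h; case: ifP => // hjm.
  by move: h hjm; rewrite /E; clear; lia.
- apply: sized_id => i; last by rewrite e0.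
  by move=> hi; rewrite hI //; have [] := hpar i hi.
- apply: sized_id => i; last by rewrite e0.
  by move=> hi; rewrite hI //; have [_ []] := hpar i hi.
- apply: sized_first_node => i; last by rewrite hI.
  by move=> hi; rewrite hI //; have [_ []] := hpar i hi.
- by rewrite hch e0 //; exact: inv_init.
- by rewrite e0.
- by move=> i hi; rewrite hI //; have [_ []] := hpar i hi.
Qed.

Lemma wp_rainbow_program :
  wp rainbow_program s0 (fun s' t => t <= 1000 * 10 * (L.+1 * E) /\
    exists g, [/\ selection n E arc_tail arc_head id first_node g,
      forall g', selection n E arc_tail arc_head id first_node g' ->
      (\sum_(i <- iota 0 n | first_node i == i) arc_weight (g i) <=
       \sum_(i <- iota 0 n | first_node i == i) arc_weight (g' i))%R &
      forall j, (imem s' 4 j != 0) <->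
        exists2 i, i < n & g (first_node i) - 1 = j]).
Proof.
apply: wp_seq; apply: wp_mono wp_init_nodes _.
move=> s1 t1 [hpar hrk [hI1 hvI1] hR1 ht1].
have z1 a i : a \notin [:: aParS; aParW; aParK; aRkK; aFirst; vI] -> 3 < a ->
   imem s1 a i = 0.
  by move=> h1 h2; rewrite hI1 // s0_0.
apply: wp_seq; apply: wp_mono (@wp_init_bound s1 _ _ _) _ => //.
- by rewrite hI1.
- by rewrite z1.
move=> s2 t2 [hM hR2 hI2 hJ2 ht2].
apply: wp_seq; apply: wp_mono (@wp_init_arcs s2 _ _ _ _ _ _ _) _ => //.
- by move=> [|[|[|[|a]]]] // _; rewrite hI2 // hI1.
- by rewrite hI2 // hI1.
- by move=> j /hpar [_ []]; rewrite hI2.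
- by rewrite hR2.
- move=> a i; rewrite !inE => ha; rewrite hI2 ?z1 //;
  by move: ha; do 4 (case/orP; first by move/eqP ->); move/eqP ->.
move=> s3 t3 [[T hT] ht3].
have l := @layout_init s2 s3 T hT.
have {}l : layout n E L arc_tail arc_head first_node arc_weight (imem s3)
   (rmem s3 aKey) id first_node id arc_weight 0%R T [::] [::].
  apply: l.
  - by move=> j /hpar; rewrite !hI2.
  - by move=> j; rewrite hI2.
  - move=> a i; rewrite !inE => ha; rewrite hI2 ?z1 //;
    by move: ha; do 4 (case/orP; first by move/eqP ->); move/eqP ->.
have [_ _ _ _ [hI3 _]] := hT.
have hw := @wp_solve R n E L arc_tail arc_head first_node arc_weight arc_tail_le
  arc_head_lt first_node_lt first_node_idem first_node_n source_arc_init
  n_L E_L s3 id first_node id arc_weight 0%R T [::] [::] l.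
apply: wp_mono (hw _ _ _ erefl erefl _) _.
- by rewrite hI3 // hI2 // z1.
- by rewrite hI3 // hI2 // hvI1.
- by rewrite hI3 // hI2 // hI1.
- by move=> j; rewrite hI3 // hI2 // z1.
move=> s4 t4 [ht4 hg]; split => //.
have hE : n <= E by rewrite /E leq_addl.
have hm : m <= E by rewrite /E leq_addr.
have hE0 : 0 < E by exact: leq_trans n_gt0 hE.
(* Everything is measured in [L.+1 * E], as [E] dominates both m and n: at most 6000 units for
   solving and 320 for the heaps, so that 10000 also covers the linear parts. *)
have h1 : 1000 * L.+1 * (2 * E + 4 * n) <= 1000 * 6 * (L.+1 * E).
  apply: (@leq_trans (1000 * L.+1 * (6 * E))).
    rewrite leq_mul2l; apply/orP; right; move: hE; clear; lia.
  by rewrite mulnACA.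
have h2 : (280 * L + 320) * E <= 320 * (L.+1 * E).
  by rewrite mulnA leq_mul2r; apply/orP; right; clear; lia.
have h3 : E <= L.+1 * E by rewrite leq_pmull.
move: ht1 ht2 ht3 ht4 h1 h2 h3 hE hm hE0; clear.
move: (L.+1 * E) (_ * (2 * E + _)) (_ * E) => x y z.
lia.
Qed.
End Run.
End Init.

(** * Selections and branchings *)

Section Cycles.
Variable V : finType.
Implicit Types (B : {set V * V}) (Z : pred V).

Definition backward_closed B Z :=
  forall v, Z v -> exists2 a, a \in B & a.2 = v /\ Z a.1.

(** Choose for each node of [Z] a predecessor in [Z]. Iterating this map in a finite type runs into
    a periodic orbit, and the arcs along it form a cycle. *)
Lemma acyclic_backward_closed B Z v :
  undirected_acyclic B -> backward_closed B Z -> ~~ Z v.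
Proof.
move=> hB hZ; apply/negP => hv.
have hp u : exists p, Z u -> (p, u) \in B /\ Z p.
  case: (boolP (Z u)) => hu; last by exists u.
  by have [[p q] hpB [/= <- hzp]] := hZ u hu; exists p.
have [p {}hp] := choice hp.
have hit i : Z (iter i p v) by elim: i => //= i IH; case: (hp _ IH).
pose N := order p v.
(* The walk first repeats by returning to its position [i]; the part from there on is the cycle,
   without repetitions. *)
have /trajectP [i hi e] : iter N p v \in traject p v N by exact: looping_order.
pose z := iter i p v; pose k := N - i.
have k0 : 0 < k by rewrite /k subn_gt0.
have cyc : iter k p z = z by rewrite /z /k -iterD subnK ?e // ltnW.
have hzi j : Z (iter j p z) by rewrite /z -iterD.
pose vs := traject p z k.
have hvs u : u \in vs -> Z u by case/trajectP => j _ ->.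
have rotE : rot 1 vs = map p vs.
  rewrite /vs; case: (k) k0 cyc => // k' _ cyc.
  have -> : map p (traject p z k'.+1) = traject p (p z) k'.+1.
    by elim: (k'.+1) (z) => //= l IH y; rewrite IH.
  by rewrite [RHS]trajectSr -iterSr cyc /= rot1_cons.
apply: (negP (hB vs [seq (p u, u) | u <- vs] _)).
  by move=> a /mapP [u hu ->]; case: (hp u (hvs u hu)).
rewrite /undirected_cycle; apply/and4P; split.
- by rewrite /vs; case: (k) k0.
- have := orbit_uniq p v; rewrite /orbit -/N -(subnKC (ltnW hi)) trajectD.
  by rewrite cat_uniq => /and3P[].
- rewrite map_inj_uniq; last by move=> a b [].
  have := orbit_uniq p v; rewrite /orbit -/N -(subnKC (ltnW hi)) trajectD.
  by rewrite cat_uniq => /and3P[].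
- rewrite rotE; elim: (vs) => //= u l ->.
  by rewrite /joins /= eqxx orbT.
Qed.

(** With indegrees at most 1, an undirected cycle is directed: its arcs have distinct heads and are
    as many as its nodes, so every node of the cycle is the head of one of them. *)
Lemma cycle_backward_closed B vs es :
  (forall v, #|[set a in B | a.2 == v]| <= 1) ->
  {subset es <= B} -> undirected_cycle vs es -> backward_closed B (mem vs).
Proof.
move=> hdeg hes /and4P[_ hvs hes1 hj].
have hsz : size es = size vs.
  have : size es = size (zip vs (rot 1 vs)) by apply/eqP; move: hj; rewrite all2E => /andP[].
  by rewrite size_zip size_rot minnn.
have hin a : a \in es -> a.1 \in vs /\ a.2 \in vs.
  have hz e : e \in zip vs (rot 1 vs) -> e.1 \in vs /\ e.2 \in vs.
    move=> he; split.
      by rewrite -(@unzip1_zip _ _ vs (rot 1 vs)) ?size_rot // map_f.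
    rewrite -(mem_rot 1) -(@unzip2_zip _ _ vs (rot 1 vs)) ?size_rot //.
    exact: map_f.
  move: hj hz; elim: es (zip _ _) {hes hes1 hsz} => [|b l IH] [|e zs] //=.
  case/andP => hb hl hz; rewrite inE => /orP[/eqP ->|]; last first.
    by apply: IH hl _ => e' he'; apply: hz; rewrite inE he' orbT.
  have [h1 h2] := hz e (mem_head _ _).
  by move: hb; rewrite /joins => /orP[] /eqP ->.
have uh : uniq [seq a.2 | a <- es].
  rewrite map_inj_in_uniq // => a b ha hb e.
  have /card_le1_eqP := hdeg a.2; by apply; rewrite inE hes //= e eqxx.
have hs : {subset [seq a.2 | a <- es] <= vs} by move=> u /mapP [a /hin [_ h] ->].
have [_ heq] := uniq_min_size uh hs (eq_leq (esym (etrans (size_map _ _) hsz))).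
move=> v /= hv; have : v \in [seq a.2 | a <- es] by rewrite heq.
case/mapP => a ha e; exists a; first exact: hes.
by split; [rewrite e|case: (hin a ha)].
Qed.

End Cycles.

(** * Selections of the augmented digraph and matroid branchings *)

Section Link.
Variable R : realType.
Variable V : finType.
Variables (A : {set V * V}) (w : V * V -> R) (c : V -> nat).
Variables (nodes : seq V) (arcs : seq (V * V)) (v0 : V).
Hypothesis nodesP : perm_eq nodes (enum V).
Hypothesis arcsP : perm_eq arcs (enum A).

Let n := size nodes.
Let m := size arcs.
Let node i := nth v0 nodes i.
Let idx v := index v nodes.
Let arc_at j := nth (v0, v0) arcs j.
Let src j := idx (arc_at j).1.
Let dst j := idx (arc_at j).2.
Let col i := c (node i).
Let wt j := w (arc_at j).
Let tl := arc_tail n m src.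
Let hd := arc_head n m dst.
Let K0 := first_node n col.
Let M : R := weight_bound m wt.
Let w0 := arc_weight m wt.
Let E := m + n.

Let nodes_uniq : uniq nodes. Proof. by rewrite (perm_uniq nodesP) enum_uniq. Qed.
Let mem_nodes v : v \in nodes. Proof. by rewrite (perm_mem nodesP) mem_enum. Qed.
Let arcs_uniq : uniq arcs. Proof. by rewrite (perm_uniq arcsP) enum_uniq. Qed.
Let mem_arcs a : (a \in arcs) = (a \in A).
Proof. by rewrite (perm_mem arcsP) mem_enum. Qed.
Let idx_lt v : idx v < n. Proof. by rewrite index_mem. Qed.
Let node_idx v : node (idx v) = v. Proof. exact: nth_index. Qed.
Let idx_node i : i < n -> idx (node i) = i.
Proof. by move=> hi; exact: index_uniq. Qed.
Let col_idx v : col (idx v) = c v. Proof. by rewrite /col node_idx. Qed.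
Let idx_inj u v : idx u = idx v -> u = v.
Proof. by move=> e; rewrite -(node_idx u) e node_idx. Qed.

Let id_of a := (index a arcs).+1.

Let arc_atK a : a \in A -> arc_at (index a arcs) = a.
Proof. by move=> h; rewrite /arc_at nth_index ?mem_arcs. Qed.

Let index_lt a : a \in A -> index a arcs < m.
Proof. by move=> h; rewrite index_mem mem_arcs. Qed.

Let tl_id a : a \in A -> tl (id_of a) = idx a.1.
Proof. by move=> h; rewrite /tl /= index_lt // /src arc_atK. Qed.

Let hd_id a : a \in A -> hd (id_of a) = idx a.2.
Proof. by move=> h; rewrite /hd /= index_lt // /dst arc_atK. Qed.

Let K0_eq u v : (K0 (idx u) == K0 (idx v)) = (c u == c v).
Proof. by rewrite first_node_eq // !col_idx. Qed.

Let K0_lt i : i < n -> K0 i < n. Proof. exact: first_node_lt. Qed.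
Let K0_idem i : i < n -> K0 (K0 i) = K0 i. Proof. exact: first_node_idem. Qed.

Let n_gt0 : 0 < n. Proof. exact: leq_ltn_trans (leq0n _) (idx_lt v0). Qed.
Let dst_lt j : j < m -> dst j < n. Proof. by move=> _; exact: idx_lt. Qed.
Let hd_lt a : hd a < n. Proof. exact: (arc_head_lt n_gt0 dst_lt). Qed.

Definition selected_arcs (g : nat -> nat) : {set V * V} :=
  [set a in A | g (K0 (idx a.2)) == id_of a].

Let sel g := selection n E tl hd id K0 g.

Lemma selected_matroid_branching g : sel g ->
  matroid_branching A (rainbow_matroid c) (selected_arcs g).
Proof.
move=> [hg hr].
have hinj a b : a \in selected_arcs g -> b \in selected_arcs g ->
    c a.2 = c b.2 -> a = b.
  rewrite !inE => /andP[ha /eqP ea] /andP[hb /eqP eb] e.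
  have e2 : K0 (idx a.2) = K0 (idx b.2) by apply/eqP; rewrite K0_eq e.
  have : id_of a = id_of b by rewrite -ea -eb e2.
  by case=> e3; rewrite -(arc_atK ha) e3 arc_atK.
have hdeg v : #|[set a in selected_arcs g | a.2 == v]| <= 1.
  apply/card_le1_eqP => a b; rewrite !(inE, in_set) => /andP[ha /eqP ea] /andP[hb /eqP eb].
  by apply: hinj; rewrite ?inE // ea eb.
split; first split => //.
- by apply/subsetP => a; rewrite inE => /andP[].
- move=> vs es hes; apply/negP => hc.
  have hz := cycle_backward_closed hdeg hes hc.
  have [v hv] : exists v, v \in vs.
    by case/and4P: hc; case: (vs) => // v l _ _ _ _; exists v; rewrite mem_head.
  (* From the nodes of the cycle one could walk backwards forever. *)
  apply: (@rooted_closed tl hd K0 g (fun i => (i < n) && (node i \in vs)) (idx v)).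
  + exact: hr (ltnW (idx_lt v)).
  + by rewrite idx_lt node_idx.
  + move=> i /andP[hi hin]; have [a] := hz _ hin.
    rewrite inE => /andP[ha /eqP ea] [e1 e2].
    rewrite e1 idx_node // in ea; rewrite ea hd_id // e1 idx_node //; split => //.
    by rewrite tl_id // idx_lt node_idx.
rewrite inE; apply/forallP => u; apply/card_le1_eqP => x y.
rewrite !inE => /andP[/imsetP [a ha ->] /eqP ea] /andP[/imsetP [b hb ->] /eqP eb].
by rewrite (hinj a b ha hb) // ea eb.
Qed.

Let classes := [seq i <- iota 0 n | K0 i == i].

(** Every class pays 3M for an auxiliary arc; an input arc instead costs its weight plus M and so
    saves 2M. The number of classes is the same for all selections. *)
Lemma selected_weight g : sel g ->
  (\sum_(i <- iota 0 n | K0 i == i) w0 (g i) =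
   (M + (M + M)) *+ size classes + arcs_weight w (selected_arcs g)
     - (M + M) *+ #|selected_arcs g|)%R.
Proof.
move=> [hg _].
have hclass i : i \in classes -> [/\ i < n, arc E (g i) & K0 (hd (g i)) = i].
  rewrite mem_filter mem_iota /= => /andP[/eqP Ki hi].
  by have [h1 h2] := hg i hi Ki.
pose big i := (g i).-1 < m.
rewrite -big_filter -/classes.
have -> : (\sum_(i <- classes) w0 (g i) = \sum_(i <- classes) (M + (M + M)) +
   \sum_(i <- classes | big i) (w (arc_at (g i).-1) - (M + M)))%R.
  rewrite [X in _ = (_ + X)%R]big_mkcond -big_split /=; apply: eq_bigr => i _.
  rewrite /w0 /arc_weight -/(big i) -/M; case: ifP => _; last by rewrite addr0.
  by rewrite /wt; ring.
rewrite big_const_seq count_predT iter_addr_0 -[RHS]addrA; congr (_ + _)%R.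
rewrite -big_filter.
transitivity (\sum_(a <- [seq arc_at (g i).-1 | i <- [seq i <- classes | big i]])
    (w a - (M + M)))%R; first by rewrite big_map.
have hperm : perm_eq [seq arc_at (g i).-1 | i <- [seq i <- classes | big i]]
                     (enum (selected_arcs g)).
  apply: uniq_perm; last 1 first.
  - move=> a; rewrite mem_enum inE; apply/mapP/andP.
      move=> [i]; rewrite mem_filter => /andP[hbi hi] ->.
      have [h1 h2 h3] := hclass i hi.
      have hin : arc_at (g i).-1 \in A by rewrite -mem_arcs mem_nth.
      split => //; have e : id_of (arc_at (g i).-1) = g i.
        rewrite /id_of /arc_at index_uniq // prednK //.
        by case/andP: h2.
      by rewrite -hd_id // e h3.
    move=> [ha /eqP ea]; exists (K0 (idx a.2)); last by rewrite ea /= arc_atK.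
    rewrite mem_filter /big ea /= index_lt //= mem_filter K0_idem // eqxx /=.
    by rewrite mem_iota /= K0_lt.
  - rewrite map_inj_in_uniq; first by rewrite !filter_uniq // iota_uniq.
    move=> i j; rewrite mem_filter => /andP[hbi hi].
    rewrite mem_filter => /andP[hbj hj] e.
    have [i1 i2 i3] := hclass i hi; have [j1 j2 j3] := hclass j hj.
    have e2 : (g i).-1 = (g j).-1.
      by apply/eqP; rewrite -(nth_uniq (v0, v0) hbi hbj arcs_uniq); apply/eqP.
    rewrite -i3 -j3; congr (K0 (hd _)); move: i2 j2 e2; rewrite /arc.
    by clear; lia.
  - exact: enum_uniq.
rewrite (perm_big _ hperm) /= big_enum /arcs_weight big_split /=.
by rewrite sumrN sumr_const.
Qed.

(** A color that [B] does not cover takes the auxiliary arc to its first node. *)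
Lemma branching_selection B : matroid_branching A (rainbow_matroid c) B ->
  exists2 g, sel g & selected_arcs g = B.
Proof.
move=> [[hBA hac hdeg] hrb].
have hinj a b : a \in B -> b \in B -> c a.2 = c b.2 -> a = b.
  move=> ha hb e; have e2 : a.2 = b.2.
    move: hrb; rewrite inE => /forallP /(_ b.2) /card_le1_eqP; apply;
      rewrite inE ?e eqxx andbT; exact: imset_f.
  by have /card_le1_eqP := hdeg a.2; apply; rewrite inE ?ha ?hb /= ?e2.
have inA a : a \in B -> a \in A by move/(subsetP hBA).
pose g i := if [pick a in B | K0 (idx a.2) == i] is Some a then id_of a
            else (m + i).+1.
have gB a : a \in B -> g (K0 (idx a.2)) = id_of a.
  move=> ha; rewrite /g; case: pickP => [b /andP[hb /eqP e]|/(_ a)]; last first.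
    by rewrite ha eqxx.
  congr id_of; apply: hinj => //; apply/eqP; by rewrite -K0_eq e.
have gcase i : (exists2 a, a \in B & K0 (idx a.2) = i /\ g i = id_of a) \/
    g i = (m + i).+1.
  rewrite /g; case: pickP => [a /andP[ha /eqP e]|_]; [left|by right].
  by exists a.
have hgs : sel g.
  split.
    move=> i hi Ki; case: (gcase i) => [[a ha [e ->]]|->].
      rewrite hd_id ?inA // e; split => //.
      by rewrite /arc /=; apply: leq_trans (index_lt (inA _ ha)) (leq_addr _ _).
    rewrite /arc /E ltn_add2l hi; split => //; rewrite /hd /arc_head.
    rewrite ltnNge leq_addr /= ltn_add2l hi addKn //.
  move=> y hy; apply: contrapT => hny.
  (* A backward walk stops at the source. Hence the nodes where it does not stop are entered by arcs
     of [B] from such nodes, which contradicts acyclicity. *)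
  pose Z := [pred v : V | `[< ~ rooted tl hd id K0 g (idx v) >]].
  have nroot i : i <= n -> ~ rooted tl hd id K0 g i ->
     exists2 a, a \in B & idx a.2 = i /\ ~ rooted tl hd id K0 g (idx a.1).
    move=> hi hnr; have hh : hd (g (K0 i)) = i.
      by apply: contrapT => hne; apply: hnr; exact: Rooted_top.
    have ht : ~ rooted tl hd id K0 g (tl (g (K0 i))).
      by move=> h; apply: hnr; apply: Rooted_step.
    case: (gcase (K0 i)) => [[a ha [e1 e2]]|e].
      exists a => //; rewrite e2 hd_id ?inA // in hh; split => //.
      by rewrite e2 tl_id ?inA in ht.
    exfalso; apply: ht; rewrite e /tl /=.
    case: (ltnP (m + K0 i) m) => h; first by move: h; clear; lia.
    have hn0 : rooted tl hd id K0 g n.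
      apply: Rooted_top => /= h2; have := hd_lt (g (K0 n)).
      by rewrite h2 ltnn.
    case: ifP => //; rewrite ltn_add2l => h4; exfalso; move: h4.
    have h5 := hd_lt (g (K0 i)); rewrite hh in h5; by rewrite K0_lt.
  have hZ : backward_closed B Z.
    move=> v /asboolP hv; have [a ha [e1 e2]] := nroot _ (ltnW (idx_lt v)) hv.
    by exists a => //; split; [exact: idx_inj|apply/asboolP].
  have [a ha [e1 e2]] := nroot y hy hny.
  have := acyclic_backward_closed a.1 hac hZ.
  by move/negP; apply; apply/asboolP.
exists g => //; apply/setP => a; rewrite inE; apply/andP/idP.
  move=> [ha /eqP e]; case: (gcase (K0 (idx a.2))) => [[b hb [e1 e2]]|e1].
    have : id_of b = id_of a by rewrite -e2 e.
    by case=> e3; rewrite -(arc_atK ha) -e3 arc_atK ?inA.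
  have := index_lt ha; have : id_of a = (m + K0 (idx a.2)).+1 by rewrite -e e1.
  by rewrite /id_of => -[->]; rewrite ltnNge leq_addr.
by move=> ha; rewrite inA // gB.
Qed.

Lemma arcs_weight_lt (B : {set V * V}) : B \subset A -> (`|arcs_weight w B| < M)%R.
Proof.
move=> hB; apply: le_lt_trans (ler_norm_sum _ _ _) _.
have -> : M = (1 + \sum_(a in A) `|w a|)%R.
  rewrite /M /weight_bound; congr (_ + _)%R.
  rewrite -big_enum -(perm_big _ arcsP) /= (big_nth (v0, v0)) /index_iota subn0.
  by [].
rewrite ltr_pwDl // ?ltr01 //; rewrite [leRHS](big_setID B) /= (setIidPr hB).
by rewrite lerDl; apply: sumr_ge0.
Qed.

(** One more input arc gains 2M, whereas the weights of two branchings, each strictly between -M and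
    M, differ by less than 2M. So the optimum has maximum cardinality, and among equal cardinalities
    only the weights count. *)
Lemma optimal_selection g : sel g ->
  (forall g', sel g' -> (\sum_(i <- iota 0 n | K0 i == i) w0 (g i) <=
       \sum_(i <- iota 0 n | K0 i == i) w0 (g' i))%R) ->
  min_weight_max_matroid_branching A (rainbow_matroid c) w (selected_arcs g).
Proof.
move=> hg hopt; have hB := selected_matroid_branching hg.
have key B' : matroid_branching A (rainbow_matroid c) B' ->
   (arcs_weight w (selected_arcs g) + (M + M) *+ #|B'| <=
    arcs_weight w B' + (M + M) *+ #|selected_arcs g|)%R.
  move=> /branching_selection [g' hg' eB]; have := hopt g' hg'.
  rewrite !selected_weight // eB; set x := (_ *+ _)%R; lra.
have hM : (0 < M)%R by exact: weight_bound_gt0.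
have hBA B' : matroid_branching A (rainbow_matroid c) B' -> B' \subset A.
  by case=> -[].
have hmax : max_matroid_branching A (rainbow_matroid c) (selected_arcs g).
  split => // B' hB'; rewrite leqNgt; apply/negP => hlt.
  have := key _ hB'; rewrite -(subnKC hlt) addSn mulrS mulrnDr.
  have h1 := arcs_weight_lt (hBA _ hB').
  have h2 := arcs_weight_lt (hBA _ hB).
  have h3 : (0 <= (M + M) *+ (#|B'| - #|selected_arcs g|.+1))%R.
    by rewrite mulrn_wge0 // addr_ge0 // ltW.
  move: h1 h2; rewrite !ltr_norml => /andP[h4 h5] /andP[h6 h7].
  by move: h3 h4 h5 h6 h7; lra.
split => // B' [hB' hB'max].
have e : #|B'| = #|selected_arcs g|.
  by apply/eqP; rewrite eqn_leq hmax.2 // hB'max.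
by have := key _ hB'; rewrite e lerD2r.
Qed.
End Link.

Lemma card_augmented_arcs (V : finType) (A : {set V * V}) :
  #|augmented_arcs A| = #|A| + #|V|.
Proof.
rewrite /augmented_arcs cardsU.
have -> : [set (Some a.1, Some a.2) | a in A] :&: [set (None, Some v) | v : V] = set0.
  apply/setP => x; rewrite !inE; apply/negP => /andP[/imsetP [a _ ->] /imsetP [v _]].
  by [].
rewrite cards0 subn0 !card_imset //; first by move=> x y [].
by move=> [x1 x2] [y1 y2] [-> ->].
Qed.

(** Split [L.+1] as [L.-1] plus 2: the former costs one logarithm because 2 ^ (L - 1) < N + 1, and
    each of the two remaining units at most one more. *)
Lemma up_log_ln (R : realType) N : 0 < N ->
  ((up_log 2 N.+1).+1%:R * ln 2 <= 3 * ln N.+1%:R :> R)%R.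
Proof.
move=> hN; set L := up_log 2 N.+1.
have L0 : 0 < L by rewrite /L up_log_gt0.
have hlt : 2 ^ L.-1 < N.+1 by rewrite up_log_gtn.
have ln2 : (0 < ln 2 :> R)%R by rewrite ln_gt0 // ltr1n.
have h1 : (L.-1%:R * ln 2 <= ln N.+1%:R :> R)%R.
  rewrite mulr_natl -lnXn //; rewrite ler_ln ?posrE ?exprn_gt0 ?ltr0n //.
  by rewrite -natrX ler_nat ltnW.
have h2 : (ln 2 <= ln N.+1%:R :> R)%R.
  by rewrite ler_ln ?posrE ?ltr0n // ler_nat ltnS.
have -> : (L.+1%:R = L.-1%:R + 2 :> R)%R by rewrite -natrD -{1}(prednK L0) addn2.
rewrite mulrDl; lra.
Qed.

Theorem theorem4 (R : realType) :
  exists (p : cmd) (C : R),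
  forall (V : finType) (A : {set V * V}) (w : V * V -> R) (c : V -> nat)
         (nodes : seq V) (arcs : seq (V * V)),
    0 < #|V| ->
    perm_eq nodes (enum V) ->
    perm_eq arcs (enum A) ->
  exists (s : state R) (t : nat),
    [/\ exec p (input_state nodes arcs w c) s t,
        min_weight_max_matroid_branching A (rainbow_matroid c) w
          (output_arcs arcs s)
      & (t%:R <= C * (#|augmented_arcs A|%:R * ln #|{: option V}|%:R))%R].
Proof.
(* The program takes at most 10000 per unit of (L + 1)(m + n), and L + 1 is at most 3 / ln 2 times
   the logarithm of n + 1. *)
exists rainbow_program, (1000 * 30 / ln 2)%R => V A w c nodes arcs hV hnodes harcs.
have [v0 _] : exists v0 : V, true by case/card_gt0P: hV => v0 _; exists v0.
have sn : size nodes = #|V| by rewrite (perm_size hnodes) -cardE.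
have sm : size arcs = #|A| by rewrite (perm_size harcs) -cardE.
set n := size nodes in sn; set m := size arcs in sm.
have n_gt0 : 0 < n by rewrite sn.
pose L := up_log 2 n.+1.
have n_L : n.+1 <= 2 ^ L by exact: up_logP.
(* The arcs form a subset of V x V, so m + n + 1 is at most the square of n + 1. *)
have E_L : (m + n).+1 <= 2 ^ (2 * L).
  have hm : m <= n * n by rewrite sm sn -card_prod; exact: max_card.
  rewrite mulnC expnM; apply: leq_trans (leq_mul n_L n_L).
  by rewrite mulSn mulnS addSn ltnS; move: hm; move: (n * n) => x; clear; lia.
pose arc_at j := nth (v0, v0) arcs j.
pose src j := index (arc_at j).1 nodes.
pose dst j := index (arc_at j).2 nodes.
pose col i := c (nth v0 nodes i).
have mem_nodes v : v \in nodes by rewrite (perm_mem hnodes) mem_enum.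
have hsrc j : j < m -> src j < n by rewrite index_mem.
have hdst j : j < m -> dst j < n by rewrite index_mem.
have hprog := @wp_rainbow_program R n m L src dst col (fun j => w (arc_at j))
  n_gt0 hsrc hdst n_L E_L (input_state nodes arcs w c).
have [|||||||s [t [hex [ht [g [hg hopt hout]]]]]] := hprog.
- by [].
- by [].
- by move=> j hj /=; rewrite (nth_map (v0, v0)).
- by move=> j hj /=; rewrite (nth_map (v0, v0)).
- by move=> i hi /=; rewrite (nth_map v0).
- by move=> j hj /=; rewrite (nth_map (v0, v0)).
- by case=> [|[|[|[|a]]]] i.
exists s, t; split => //.
  have -> : output_arcs arcs s = selected_arcs A c nodes arcs v0 g.
    apply/setP => a; rewrite !inE (perm_mem harcs) mem_enum.
    case: (boolP (a \in A)) => //= ha.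
    have ha' : index a arcs < m by rewrite index_mem (perm_mem harcs) mem_enum.
    apply/idP/eqP => [/hout [i hi e]|e]; last first.
      apply/hout; exists (index a.2 nodes); first by rewrite index_mem.
      by rewrite e subn1.
    have [/andP[h1 _] h2] := hg.1 _ (first_node_lt col hi) (first_node_idem col hi).
    have e' : g (first_node n col i) = (index a arcs).+1.
      by rewrite -e subn1 prednK.
    move: h2; rewrite e' /= ha' /dst /arc_at nth_index => [->|]; first exact: e'.
    by rewrite -index_mem.
  exact: (optimal_selection hnodes harcs hg hopt).
rewrite card_augmented_arcs -sm -sn card_option -sn.
have h := up_log_ln R n_gt0; rewrite -/L in h.
have ln2 : (0 < ln 2 :> R)%R by rewrite ln_gt0 // ltr1n.
have h1 : (t%:R <= 1000 * 10 * (L.+1%:R * (m + n)%:R) :> R)%R.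
  by rewrite -!natrM ler_nat.
apply: le_trans h1 _.
have -> : (1000 * 30 / ln 2 * ((m + n)%:R * ln n.+1%:R) =
    1000 * 10 * (3 * ln n.+1%:R / ln 2 * (m + n)%:R) :> R)%R.
  by field; rewrite gt_eqF.
rewrite ler_wpM2l ?ler_wpM2r ?ler0n ?ler_pdivlMr //.
by rewrite mulr_ge0 // ler0n.
Qed.
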